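(* Let $\ell>0$ and let $\varepsilon>0$ be sufficiently small. Then, for all $p\in(6-\varepsilon,6)$, there exist two distinct positive energy ground states on $\mathcal{G}_\ell$ with the same mass.
   Context: The $\mathcal{T}$-graph $\mathcal{G}_\ell$ ($\ell>0$) is the metric graph made of two half-lines $e_1,e_2$, identified with $I_1=I_2=[0,\infty)$, and a terminal edge $e_3$, identified with $I_3=[0,\ell]$, all glued at the vertex $\mathbf{0}$ (coordinate $0$ on each edge); the other end of $e_3$ has coordinate $\ell$. A function on $\mathcal{G}_\ell$ is a triple $u=(u_1,u_2,u_3)$, $u_i:I_i\to\mathbb{R}$; $u\in H^1(\mathcal{G}_\ell)$ means $u_i\in H^1(I_i)$ and $u_1(0)=u_2(0)=u_3(0)$. Energy: $E(u,\mathcal{G}_\ell)=\frac12\int_{\mathcal{G}_\ell}|u'|^2dx-\frac1p\int_{\mathcal{G}_\ell}|u|^p\,dx$. For $\nu>0$, an energy ground state of mass $\nu$ is a minimizer of $E(\cdot,\mathcal{G}_\ell)$ over $\{u\in H^1(\mathcal{G}_\ell):\int_{\mathcal{G}_\ell}|u|^2dx=\nu\}$. *)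

(* Defs.v *)
From HB Require Import structures.
From mathcomp Require Import all_boot all_order all_algebra.
From mathcomp Require Import all_classical all_reals all_analysis.
Set Implicit Arguments.
Unset Strict Implicit.
Unset Printing Implicit Defensive.
Import Order.TTheory GRing.Theory Num.Theory.
Import numFieldNormedType.Exports.
Local Open Scope classical_set_scope.
Local Open Scope ring_scope.

Section Sobolev.
Context {R : realType}.
Implicit Types (I : set R) (u g phi : R -> R).

Definition L2 I u : Prop :=
  measurable_fun I u /\
  (@lebesgue_measure R).-integrable I (fun x => (`|u x| ^+ 2)%:E).

(* C^1 functions with compact support in the interior of [I]. *)
Definition C1c I phi : Prop :=
  [/\ forall x, derivable phi x 1,
      continuous (derive1 phi),
      compact (closure [set x | phi x != 0])
    & closure [set x | phi x != 0] `<=` I°].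

Definition is_weak_deriv I u g : Prop :=
  L2 I g /\
  forall phi, C1c I phi ->
    \int[lebesgue_measure]_(x in I) (u x * derive1 phi x) =
    - \int[lebesgue_measure]_(x in I) (g x * phi x).

(* An element of H^1(I), I an interval, is given by its continuous
   representative on I; the values of [u] off [I] are irrelevant. *)
Definition H1 I u : Prop :=
  [/\ {within I, continuous u}, L2 I u & exists g, is_weak_deriv I u g].

(* A chosen weak derivative. Weak derivatives are unique almost everywhere on
   [I], so integrals over [I] do not depend on the choice; it is only
   meaningful when [H1 I u] holds. *)
Definition weak_deriv I u : R -> R := xget (cst 0) [set g | is_weak_deriv I u g].

End Sobolev.

Section TGraph.
Context {R : realType}.
Implicit Types (l p nu : R).

(* The index [ord_max] (value 2) is the terminal edge of length [l]; 0 and 1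
   are the half-lines. The vertex is the coordinate 0 of every edge. *)
Definition edge l (i : 'I_3) : set R :=
  if i == ord_max then `[0, l]%classic else `[0, +oo[%classic.

(* [u i] matters only on [edge l i]. *)
Definition graph_fun : Type := 'I_3 -> R -> R.
Implicit Types u v : graph_fun.

Definition graph_H1 l u : Prop :=
  (forall i, H1 (edge l i) (u i)) /\ (forall i j, u i 0 = u j 0).

Definition mass l u : R :=
  \sum_(i < 3) \int[lebesgue_measure]_(x in edge l i) (`|u i x| ^+ 2).

Definition energy l p u : R :=
  2^-1 * (\sum_(i < 3) \int[lebesgue_measure]_(x in edge l i)
            (`|weak_deriv (edge l i) (u i) x| ^+ 2))
  - p^-1 * (\sum_(i < 3) \int[lebesgue_measure]_(x in edge l i)
            (`|u i x| `^ p)).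

Definition ground_state l p nu u : Prop :=
  [/\ graph_H1 l u, mass l u = nu
    & forall v, graph_H1 l v -> mass l v = nu -> energy l p u <= energy l p v].

Definition graph_positive l u : Prop :=
  forall i x, edge l i x -> 0 < u i x.

Definition graph_distinct l u v : Prop :=
  exists i x, edge l i x /\ u i x <> v i x.

End TGraph.
Arguments graph_fun : clear implicits.

(* Main.v *)
Require Import Defs.
From mathcomp Require Import all_boot all_order all_algebra.
From mathcomp Require Import all_classical all_reals all_analysis.
From mathcomp Require Import measurable_realfun ring lra zify.
Set Implicit Arguments.
Unset Strict Implicit.
Unset Printing Implicit Defensive.
Import Order.TTheory GRing.Theory Num.Theory.
Import numFieldNormedType.Exports.
Local Open Scope classical_set_scope.
Local Open Scope ring_scope.

(* A profile is a nonincreasing function f >= 0 on the half-line; it is spread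
   over the graph by filling the terminal edge from its tip to the vertex with
   f on [0, l] and giving each half-line a copy of f(l + 2x). Rearranging a
   competitor v by its joint distribution function gives a profile with the
   same mass and L^p norm, and with int w |f'|^2 <= int |v'|^2, where w = 1 on
   [0, l[ and w = 4 beyond: a superlevel set of measure at least l meets a
   half-line, so that its level is crossed at least twice. Hence the scaled
   unfolding of a maximizer of J_s(f) = int f^p - s int w |f'|^2 under
   int f^2 <= 1 is an energy ground state, whose mass depends only on p and s.

   Fix p < 6 close to 6. Some small k0 > 0 is never the Dirichlet integral of a
   maximizer with s >= 23/20: f(l)^4 <= int w |f'|^2 gives int f^p <= 23/20 k0
   for every profile with int w |f'|^2 <= k0, hence J_s(f) <= 0 if equality
   holds, whereas very spread-out tents have J_s > 0 because p < 6. For s = 23/20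
   a tent at the tip, for which int f^6 = 9/7 int w |f'|^2, forces maximizers
   above k0; for s large all are below. At the supremum s of the multipliers with
   a maximizer above k0, limits of maximizers (Helly-type compactness) are
   maximizers on both sides of k0, hence two of them with the same mass. *)

(** * Dirichlet energy along partitions *)

(** The exponent 6 is critical: under mass-preserving dilations int f^6 and int |f'|^2 scale alike,
    so only the ratio of the two decides. It is at most about 1 for small energies and reaches 9/7
    at the tip; replacing [p] by 6 costs factors 11/10 and 20/19, and 11/10 + 1/20 = 23/20 < 19/20 *
    9/7 leaves room for both.

    The multiplier [s] determines the mass by scaling: if f has mass 1, k is its Dirichlet integral
    and c^(p-2) = p/(2s), the unfolding of c f has energy at most -(c^2/(2s)) (int f^p - s k), while
    every competitor of mass c^2 has energy at least such an expression for an admissible profile.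

    On the side of profiles no derivative occurs. Dirichlet integrals are replaced by bounds on
    partition sums, which survive pointwise limits, cutting and gluing. Derivatives enter only at
    the passage to the graph: the weak derivative of a competitor is turned into an integral formula
    and measured by level crossings, and a profile gets its derivative as a limit of dyadic slopes.
    No Euler-Lagrange equation is available, so positivity also has to come from a comparison. *)

Section psum.
Context {R : realType}.
Implicit Types (w u f : R -> R) (k l : R).

(* Degenerate cells contribute [0 / 0 = 0]. For nondecreasing [w] the bound
   [Dle w u k] below means int w |u'|^2 <= k; it passes to pointwise limits. *)
Definition psum w u (y : nat -> R) n : R :=
  \sum_(i < n) w (y i) * ((u (y i.+1) - u (y i)) ^+ 2 / (y i.+1 - y i)).

Definition Dle w u k :=
  forall y n, nondecreasing_seq y -> psum w u y n <= k.

(* 4 = 2^2: beyond [l] the profile is shared by two half-lines. *)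
Definition wt l (y : R) : R := if y < l then 1 else 4.

Lemma wt_ge1 l y : 1 <= wt l y.
Proof. by rewrite /wt; case: ifP => _; lra. Qed.

Lemma wt_ge0 l y : 0 <= wt l y.
Proof. by rewrite (le_trans _ (wt_ge1 l y)). Qed.

Lemma wt_le4 l y : wt l y <= 4.
Proof. by rewrite /wt; case: ifP => _; lra. Qed.

Lemma wt_homo l : {homo wt l : x y / x <= y}.
Proof.
move=> x y xy; rewrite /wt; case: ifPn => [_|]; first exact: wt_ge1.
rewrite -leNgt => lx; case: ifPn => // yl.
by have := lt_le_trans yl (le_trans lx xy); rewrite ltxx.
Qed.

Lemma psum_le_wt w w' u y n : (forall x, w x <= w' x) -> nondecreasing_seq y ->
  psum w u y n <= psum w' u y n.
Proof.
move=> w0 ny; apply: ler_sum => i _; rewrite ler_wpM2r// mulr_ge0 ?sqr_ge0//.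
by rewrite invr_ge0 subr_ge0 ny.
Qed.

Lemma psum_ext w u v y n : (forall i, u (y i) = v (y i)) ->
  psum w u y n = psum w v y n.
Proof. by move=> h; apply: eq_bigr => i _; rewrite !h. Qed.

Lemma psumZ w u y n a : psum w (fun x => a * u x) y n = a ^+ 2 * psum w u y n.
Proof.
by rewrite /psum mulr_sumr; apply: eq_bigr => i _; rewrite -mulrBr exprMn; ring.
Qed.

(** [z] restarts at index [n.+1], so one extra cell bridges [y n] and [z 0%N]; hence the [n.+1 + m]
    cells in [psum_cat], where the nonnegative bridge is dropped. *)
Definition cat_seq n (y z : nat -> R) : nat -> R :=
  fun i => if (i <= n)%N then y i else z (i - n.+1)%N.

Lemma cat_seq_nd n y z : nondecreasing_seq y -> nondecreasing_seq z ->
  y n <= z 0%N -> nondecreasing_seq (cat_seq n y z).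
Proof.
move=> ny nz yz; apply/nondecreasing_seqP => i; rewrite /cat_seq.
case: (ltngtP i n) => [|ni|->].
- by move=> lin; rewrite ny.
- by rewrite nz//; lia.
- by rewrite subnn.
Qed.

Lemma psum_cat w u n m y z : (forall x, 0 <= w x) -> nondecreasing_seq y ->
  nondecreasing_seq z -> y n <= z 0%N ->
  psum w u y n + psum w u z m <= psum w u (cat_seq n y z) (n.+1 + m).
Proof.
move=> w0 ny nz yz; rewrite {3}/psum big_split_ord /= big_ord_recr /=.
have -> : \sum_(i < m) w (cat_seq n y z (n.+1 + i)) *
    ((u (cat_seq n y z (n.+1 + i).+1) - u (cat_seq n y z (n.+1 + i))) ^+ 2 /
    (cat_seq n y z (n.+1 + i).+1 - cat_seq n y z (n.+1 + i))) = psum w u z m.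
  apply: eq_bigr => i _; rewrite /cat_seq.
  have -> : (n.+1 + i <= n)%N = false by lia.
  have -> : ((n.+1 + i).+1 <= n)%N = false by lia.
  have -> : (n.+1 + i - n.+1 = i)%N by lia.
  by have -> : ((n.+1 + i).+1 - n.+1 = i.+1)%N by lia.
have -> : \sum_(i < n) w (cat_seq n y z i) *
    ((u (cat_seq n y z i.+1) - u (cat_seq n y z i)) ^+ 2 /
    (cat_seq n y z i.+1 - cat_seq n y z i)) = psum w u y n.
  by apply: eq_bigr => i _; rewrite /cat_seq (ltnW (ltn_ord i)) (ltn_ord i).
rewrite lerD2r lerDl mulr_ge0// mulr_ge0 ?sqr_ge0//.
by rewrite invr_ge0 subr_ge0 (cat_seq_nd ny nz yz).
Qed.

(** Cauchy-Schwarz in Engel's form. The two implications cover degenerate cells, where division by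
    zero returns 0 and a nonzero increment would break the bound. *)
Lemma sqr_div_split (a b A B : R) : 0 <= A -> 0 <= B -> (A = 0 -> a = 0) ->
  (B = 0 -> b = 0) -> (a + b) ^+ 2 / (A + B) <= a ^+ 2 / A + b ^+ 2 / B.
Proof.
move=> A0 B0 hA hB.
have [A00|An0] := eqVneq A 0; first by rewrite hA// A00 !add0r expr0n mul0r add0r.
have [B00|Bn0] := eqVneq B 0; first by rewrite hB// B00 !addr0 expr0n mul0r addr0.
have Ap : 0 < A by rewrite lt0r An0.
have Bp : 0 < B by rewrite lt0r Bn0.
rewrite ler_pdivrMr ?addr_gt0// -subr_ge0.
have -> : (a ^+ 2 / A + b ^+ 2 / B) * (A + B) - (a + b) ^+ 2 =
   (a * B - b * A) ^+ 2 / (A * B) by field; rewrite An0 Bn0.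
by rewrite mulr_ge0 ?sqr_ge0// invr_ge0 mulr_ge0.
Qed.

Lemma psum_split w u y n c : (forall x, 0 <= w x) ->
  {homo w : x y / x <= y} -> nondecreasing_seq y ->
  psum w u y n <= psum w u (fun i => Num.min (y i) c) n +
                  psum w u (fun i => Num.max (y i) c) n.
Proof.
move=> w0 wnd ny; rewrite /psum -big_split /=; apply: ler_sum => i _.
have := ny _ _ (leqnSn i); move: (y i) (y i.+1) => a b ab.
have -> : b - a = (Num.min b c - Num.min a c) + (Num.max b c - Num.max a c).
  by rewrite /Num.min /Num.max; case: ifP => h1; case: ifP => h2; lra.
have -> : u b - u a = (u (Num.min b c) - u (Num.min a c)) +
    (u (Num.max b c) - u (Num.max a c)).
  by rewrite /Num.min /Num.max; case: ifP => h1; case: ifP => h2; ring.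
set A := Num.min b c - _; set B := Num.max b c - _.
have A0 : 0 <= A.
  by rewrite /A /Num.min; case: ifP; case: ifP; lra.
have B0 : 0 <= B.
  by rewrite /B /Num.max; case: ifP; case: ifP; lra.
have hA : A = 0 -> u (Num.min b c) - u (Num.min a c) = 0.
  by move=> /eqP; rewrite subr_eq0 => /eqP ->; rewrite subrr.
have hB : B = 0 -> u (Num.max b c) - u (Num.max a c) = 0.
  by move=> /eqP; rewrite subr_eq0 => /eqP ->; rewrite subrr.
apply: (le_trans (ler_wpM2l (w0 a) (sqr_div_split A0 B0 hA hB))).
rewrite mulrDr; apply: lerD; last first.
  rewrite ler_wpM2r//; first by rewrite mulr_ge0 ?sqr_ge0// invr_ge0.
  by apply: wnd; rewrite le_max lexx.
case: (leP a c) => ac; first by rewrite minElt; case: ltP => // h; rewrite (_ : c = a)//; lra.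
(* A cell that starts beyond [c] has an empty left piece. *)
have -> : A = 0 by rewrite /A /Num.min; case: ifP => h1; case: ifP => h2; lra.
by rewrite invr0 !mulr0.
Qed.

Lemma nd_min (y : nat -> R) c : nondecreasing_seq y -> nondecreasing_seq (fun i => Num.min (y i) c).
Proof.
move=> ny i j ij; have := ny _ _ ij; rewrite /Num.min.
by case: ifP => h1; case: ifP => h2; lra.
Qed.

Lemma nd_max (y : nat -> R) c : nondecreasing_seq y -> nondecreasing_seq (fun i => Num.max (y i) c).
Proof.
move=> ny i j ij; have := ny _ _ ij; rewrite /Num.max.
by case: ifP => h1; case: ifP => h2; lra.
Qed.

Lemma psum_rev u y n (a : R) : nondecreasing_seq y ->
  psum (cst 1) (fun x => u (a - x)) y n =
  psum (cst 1) u (fun i => a - y (n - i)%N) n.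
Proof.
move=> ny; rewrite /psum (reindex_inj rev_ord_inj) /=; apply: eq_bigr => i _.
rewrite !mul1r.
have -> : (n - i = (n - i.+1).+1)%N by have := ltn_ord i; lia.
move: (y _) (y _) => b c; congr (_ / _); last ring.
by rewrite -sqrrN opprB.
Qed.

(** The partition with the single cell from [x] to [y]: Cauchy-Schwarz for the increment. *)
Lemma Dle_holder w u k x y : (forall x, 1 <= w x) -> Dle w u k -> x <= y ->
  (u y - u x) ^+ 2 <= k * (y - x).
Proof.
move=> w1 h xy.
pose z i := if i is 0%N then x else y.
have nz : nondecreasing_seq z by apply/nondecreasing_seqP => -[|i] //=.
have [->|xny] := eqVneq x y; first by rewrite !subrr expr0n mulr0.
have := h z 1%N nz; rewrite /psum big_ord1 /= => {}h.
have yx : 0 < y - x by rewrite subr_gt0 lt_neqAle xny.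
rewrite -ler_pdivrMr//; apply: le_trans h.
rewrite -[leLHS]mul1r ler_wpM2r// mulr_ge0 ?sqr_ge0// invr_ge0; exact: ltW.
Qed.

Lemma Dle_ge0 w u k : Dle w u k -> 0 <= k.
Proof.
move=> /(_ (cst 0) 0%N); rewrite /psum big_ord0; apply.
by move=> i j _.
Qed.

Lemma Dle_le w u k k' : Dle w u k -> k <= k' -> Dle w u k'.
Proof. by move=> h kk y n ny; rewrite (le_trans (h y n ny)). Qed.

Lemma DleZ w u k a : Dle w u k -> Dle w (fun x => a * u x) (a ^+ 2 * k).
Proof. by move=> h y n ny; rewrite psumZ ler_wpM2l ?sqr_ge0// h. Qed.

Lemma Dle_continuous w u k : (forall x, 1 <= w x) -> Dle w u k -> continuous u.
Proof.
move=> w1 h x; apply/cvgrPdist_le => e e0.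
have k0 := Dle_ge0 h.
exists (e ^+ 2 / (k + 1)) => /=; first by rewrite divr_gt0 ?exprn_gt0//; lra.
move=> y /= /ltW xy.
have [le_xy|/ltW le_yx] := leP x y.
  rewrite distrC in xy *; rewrite -(@ler_sqr R) ?nnegrE ?normr_ge0 ?(ltW e0)// real_normK ?num_real//.
  rewrite -sqrrN opprB (le_trans (Dle_holder w1 h le_xy))//.
  rewrite ger0_norm ?subr_ge0// ler_pdivlMr ?ltr_wpDl// in xy.
  by rewrite (le_trans _ xy)// mulrC ler_wpM2l ?subr_ge0//; lra.
rewrite -(@ler_sqr R) ?nnegrE ?normr_ge0 ?(ltW e0)// real_normK ?num_real//.
rewrite (le_trans (Dle_holder w1 h le_yx))//.
rewrite ger0_norm ?subr_ge0// ler_pdivlMr ?ltr_wpDl// in xy.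
by rewrite (le_trans _ xy)// mulrC ler_wpM2l ?subr_ge0//; lra.
Qed.

End psum.

(** * Integrals of monotone functions *)

Section decreasing.
Context {R : realType}.
Notation mu := (@lebesgue_measure R).
Implicit Types (f g : R -> R).

Lemma itv_cell_lb g (a b m : R) : a <= b -> 0 <= m ->
  measurable_fun (`[a, b[ : set R) g -> (forall x, a <= x < b -> m <= g x) ->
  ((m * (b - a))%:E <= \int[mu]_(x in `[a, b[) (g x)%:E)%E.
Proof.
move=> ab m0 mg mle.
have -> : (m * (b - a))%:E = (\int[mu]_(x in `[a, b[) (cst m%:E x))%E.
  rewrite integral_cst//= lebesgue_measure_itv/= lte_fin.
  case: ltP => [|ba]; first by rewrite -EFinB EFinM.
  by rewrite mule0 (_ : b = a) ?subrr ?mulr0//; apply/le_anti; rewrite ab ba.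
apply: ge0_le_integral => //=.
- exact/measurable_EFinP.
Qed.

Lemma ge0_itv_split g (a b c : R) : a <= b -> b <= c ->
  measurable_fun (`[a, c[ : set R) g -> (forall x, a <= x < c -> 0 <= g x) ->
  (\int[mu]_(x in `[a, c[) (g x)%:E = \int[mu]_(x in `[a, b[) (g x)%:E +
    \int[mu]_(x in `[b, c[) (g x)%:E)%E.
Proof.
move=> ab bc mg g0.
have E : `[a, c[%classic = `[a, b[ `|` `[b, c[ :> set R.
  by rewrite -itv_bndbnd_setU//= bnd_simp.
rewrite E ge0_integral_setU//=.
- by rewrite -E; exact/measurable_EFinP.
- move=> x xab; have : `[a, c[%classic x by rewrite E.
  by rewrite /= in_itv/= lee_fin => /g0.
- apply/disj_setPRL => x /=; rewrite !in_itv/= => /andP[bx _] /andP[_ xb].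
  by move: (le_lt_trans bx xb); rewrite ltxx.
Qed.

Lemma ge0_itvy_split g (a b : R) : a <= b ->
  measurable_fun (`[a, +oo[ : set R) g -> (forall x, a <= x -> 0 <= g x) ->
  (\int[mu]_(x in `[a, +oo[) (g x)%:E = \int[mu]_(x in `[a, b[) (g x)%:E +
    \int[mu]_(x in `[b, +oo[) (g x)%:E)%E.
Proof.
move=> ab mg g0.
have E : `[a, +oo[%classic = `[a, b[ `|` `[b, +oo[ :> set R.
  by rewrite -itv_bndbnd_setU//= bnd_simp.
rewrite E ge0_integral_setU//=.
- by rewrite -E; exact/measurable_EFinP.
- move=> x xab; have : `[a, +oo[%classic x by rewrite E.
  by rewrite /= in_itv/= andbT lee_fin => /g0.
- apply/disj_setPRL => x /=; rewrite !in_itv/= andbT => bx /andP[_ xb].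
  by move: (le_lt_trans bx xb); rewrite ltxx.
Qed.

Lemma noninc_riemann g (a d : R) n : nonincreasing_fun g ->
  (forall x, 0 <= g x) -> 0 <= d ->
  ((\sum_(i < n) d * g (a + i.+1%:R * d))%:E <=
   \int[mu]_(x in `[a, (a + n%:R * d)%R[) (g x)%:E)%E.
Proof.
move=> ng g0 d0; elim: n => [|n IH].
  by rewrite big_ord0; apply: integral_ge0 => x _; rewrite lee_fin.
have mg D : measurable D -> measurable_fun D g.
  by move=> mD; exact: nonincreasing_measurable.
have n1 : n.+1%:R = n%:R + 1 :> R by rewrite -natr1.
rewrite big_ord_recr /= (@ge0_itv_split _ a (a + n%:R * d))//; last 3 first.
- by rewrite lerDl mulr_ge0.
- by rewrite n1; nra.
- by apply: mg.
rewrite EFinD leeD//.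
have -> : d * g (a + n.+1%:R * d) =
   g (a + n.+1%:R * d) * ((a + n.+1%:R * d) - (a + n%:R * d)).
  by rewrite n1; ring.
apply: itv_cell_lb => //; first by rewrite n1; nra.
  exact: mg.
by move=> x /andP[_ /ltW xle]; exact: ng.
Qed.

Lemma noninc_riemanny g (a d : R) n : nonincreasing_fun g ->
  (forall x, 0 <= g x) -> 0 <= d ->
  ((\sum_(i < n) d * g (a + i.+1%:R * d))%:E <=
   \int[mu]_(x in `[a, +oo[) (g x)%:E)%E.
Proof.
move=> ng g0 d0; apply: (le_trans (noninc_riemann a n ng g0 d0)).
apply: ge0_subset_integral => //=.
- by apply/measurable_EFinP; exact: nonincreasing_measurable.
- by move=> x _; rewrite lee_fin.
- by move=> x /=; rewrite !in_itv/= => /andP[->].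
Qed.

Lemma sqr_noninc f : nonincreasing_fun f -> (forall x, 0 <= f x) ->
  nonincreasing_fun (fun x => f x ^+ 2).
Proof. by move=> nf f0 x y xy; rewrite lerXn2r ?nnegrE//; exact: nf. Qed.

(** The Riemann bound with a single cell. This decay later provides the integrable majorant for the
    p-th powers. *)
Lemma sqr_decay f (a x : R) : nonincreasing_fun f -> (forall x, 0 <= f x) ->
  (\int[mu]_(x in `[a, +oo[) (f x ^+ 2)%:E <= 1)%E -> a <= x ->
  (x - a) * f x ^+ 2 <= 1.
Proof.
move=> nf f0 h ax; rewrite -lee_fin; apply: le_trans h.
have := @noninc_riemanny _ a (x - a) 1 (sqr_noninc nf f0) (fun x => sqr_ge0 _).
rewrite big_ord1 mul1r subr_ge0 => /(_ ax).
by rewrite (addrC a) subrK.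
Qed.

(** Discrete form of f(a)^2 = - 2 int f f' <= t int f^2 + (1/t) int |f'|^2 over the half-line from
    [a]. With N^2 cells of length 1/N the mesh shrinks while the grid reaches [a + N], where
    [sqr_decay] makes f^2 at most 1/N. *)
Lemma noninc_sup_bound f (a D t : R) : nonincreasing_fun f ->
  (forall x, 0 <= f x) ->
  (\int[mu]_(x in `[a, +oo[) (f x ^+ 2)%:E <= 1)%E ->
  (forall y n, nondecreasing_seq y -> (forall i, a <= y i) ->
    psum (cst 1) f y n <= D) ->
  0 < t -> f a ^+ 2 <= t + D / t.
Proof.
move=> nf f0 hi hD t0.
(* Both errors are of order 1/N: [t * f a ^+ 2] is the price of passing from left to right Riemann
   sums, and 1 comes from the end value [f (y n) ^+ 2]. *)
pose C := t * f a ^+ 2 + 1.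
suff H N : (0 < N)%N -> f a ^+ 2 - (t + D / t) <= C / N%:R.
  rewrite -subr_le0 leNgt; apply/negP => e0.
  set e := _ - _ in e0 H.
  have C0 : 0 < C by rewrite ltr_wpDl// mulr_ge0 ?sqr_ge0// ltW.
  have := H (Num.bound `|C / e|).+1 isT; apply/negP; rewrite -ltNge.
  rewrite ltr_pdivrMr// mulrC -ltr_pdivrMr//.
  apply: (le_lt_trans (ler_norm _)); apply: (lt_le_trans (archi_boundP _)) => //.
  by rewrite ler_nat.
move=> N0; have Np : 0 < N%:R :> R by rewrite ltr0n.
pose d := N%:R^-1 : R; pose n := (N * N)%N.
have d0 : 0 < d by rewrite invr_gt0.
have nd : n%:R * d = N%:R by rewrite /n natrM -mulrA divff ?mulr1// gt_eqF.
pose y i := a + i%:R * d.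
have y1 i : y i.+1 = y i + d by rewrite /y -natr1; ring.
have ny : nondecreasing_seq y.
  by apply/nondecreasing_seqP => i; rewrite y1 lerDl ltW.
have ay i : a <= y i by rewrite /y lerDl mulr_ge0// ltW.
have tel : f a ^+ 2 - f (y n) ^+ 2 = \sum_(i < n) (f (y i) ^+ 2 - f (y i.+1) ^+ 2).
  rewrite -(big_mkord xpredT (fun i => f (y i) ^+ 2 - f (y i.+1) ^+ 2)).
  rewrite (@telescope_sumr_eq _ _ _ (fun i => - f (y i) ^+ 2))//.
    by rewrite /y mul0r addr0; ring.
  by move=> i _; ring.
(* On each cell u^2 - v^2 = 2 u (u - v) - (u - v)^2, and the product is split by AM-GM with
   parameter [t * d]. *)
have step : f a ^+ 2 - f (y n) ^+ 2 <=
    \sum_(i < n) (t * (d * f (y i) ^+ 2) + t^-1 * (1 * ((f (y i.+1) - f (y i)) ^+ 2 / (y i.+1 - y i)))).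
  rewrite tel; apply: ler_sum => i _; rewrite y1.
  have fy : f (y i + d) <= f (y i) by apply: nf; rewrite lerDl ltW.
  move: (f0 (y i)) (f0 (y i + d)) fy; move: (f (y i)) (f (y i + d)) => u v u0 v0 vu.
  have -> : y i + d - y i = d by ring.
  rewrite -subr_ge0.
  have -> : t * (d * u ^+ 2) + t^-1 * (1 * ((v - u) ^+ 2 / d)) - (u ^+ 2 - v ^+ 2) =
    (t * d * u - (u - v)) ^+ 2 / (t * d) + (u - v) ^+ 2.
    by field; rewrite !gt_eqF.
  by rewrite addr_ge0 ?sqr_ge0// divr_ge0 ?sqr_ge0// mulr_ge0// ltW.
rewrite big_split /= -!mulr_sumr in step.
have s1 : 1 * (\sum_(i < n) (f (y i.+1) - f (y i)) ^+ 2 / (y i.+1 - y i)) <= D.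
  by rewrite mulr_sumr; exact: hD.
have s2 : d * \sum_(i < n) f (y i) ^+ 2 <= 1 + d * f a ^+ 2.
  have h1 : \sum_(i < n) d * f (y i.+1) ^+ 2 <= 1.
    rewrite -lee_fin; apply: le_trans hi.
    exact: (noninc_riemanny a n (sqr_noninc nf f0) (fun x => sqr_ge0 _) (ltW d0)).
  have h2 : \sum_(i < n.+1) d * f (y i) ^+ 2 <= 1 + d * f a ^+ 2.
    by rewrite big_ord_recl /= {1}/y mul0r addr0 addrC lerD2r.
  rewrite mulr_sumr; apply: le_trans h2; rewrite big_ord_recr /= lerDl.
  by rewrite mulr_ge0 ?sqr_ge0// ltW.
have s3 : f (y n) ^+ 2 <= d.
  have := sqr_decay nf f0 hi (ay n).
  by rewrite /y addrC addKr nd -ler_pdivlMl// mulr1.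
rewrite /C -/d.
have i1 : t^-1 * (1 * \sum_(i < n) (f (y i.+1) - f (y i)) ^+ 2 / (y i.+1 - y i)) <= D / t.
  by rewrite mulrC ler_pM2r// invr_gt0.
have i2 : t * (d * \sum_(i < n) f (y i) ^+ 2) <= t + t * d * f a ^+ 2.
  by rewrite -[X in X + _]mulr1 -mulrA -mulrDr ler_pM2l.
lra.
Qed.

(** The optimal parameter [t = Num.sqrt D] gives [f a ^+ 2 <= 2 * Num.sqrt D]. For [D = 0] it is not
    positive, and [t = f a ^+ 2 / 2] does instead. *)
Lemma noninc_sup4 f (a D : R) : nonincreasing_fun f ->
  (forall x, 0 <= f x) ->
  (\int[mu]_(x in `[a, +oo[) (f x ^+ 2)%:E <= 1)%E ->
  (forall y n, nondecreasing_seq y -> (forall i, a <= y i) ->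
    psum (cst 1) f y n <= D) ->
  f a ^+ 4 <= 4 * D.
Proof.
move=> nf f0 hi hD.
have D0 : 0 <= D.
  have := hD (cst a) 0%N; rewrite /psum big_ord0; apply => //.
have H := noninc_sup_bound nf f0 hi hD.
have -> : f a ^+ 4 = (f a ^+ 2) ^+ 2 by rewrite -exprM.
move: (f a ^+ 2) (sqr_ge0 (f a)) H => u u0 H.
have [|Dp] := eqVneq D 0.
  move=> D00; have [->|un] := eqVneq u 0; first by rewrite expr0n/= mulr_ge0.
  have up : 0 < u by rewrite lt0r un.
  have := H (u / 2); rewrite D00 mul0r addr0 => /(_ _); lra.
have {}Dp : 0 < D by rewrite lt0r Dp.
have sp : 0 < Num.sqrt D by rewrite sqrtr_gt0.
have := H _ sp.
have e : Num.sqrt D ^+ 2 = D by rewrite sqr_sqrtr.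
have -> : D / Num.sqrt D = Num.sqrt D.
  by rewrite -[X in X / _]e expr2 mulfK// gt_eqF.
by move: e; move: (Num.sqrt D) sp => s sp e hu; rewrite -e; nra.
Qed.

End decreasing.

(** * Admissible profiles and the energy gap *)

Section admissible.
Context {R : realType}.
Notation mu := (@lebesgue_measure R).
Implicit Types (f g : R -> R) (l k p s : R).

(* [k] is only an upper bound of the Dirichlet integral. *)
Definition adm l f k := [/\ nonincreasing_fun f, forall x, 0 <= f x,
  (\int[mu]_(x in `[0%R, +oo[) (f x ^+ 2)%:E <= 1)%E & Dle (wt l) f k].

Definition Pp p f : R := \int[mu]_(x in `[0, +oo[) (f x `^ p).

Lemma powR_split (a p : R) n : 0 <= a -> n%:R < p ->
  a `^ p = a `^ (p - n%:R) * a ^+ n.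
Proof.
move=> a0 np; have p0 : 0 < p by rewrite (le_lt_trans _ np).
have [->|an] := eqVneq a 0; first by rewrite !powR0 ?mul0r// gt_eqF ?subr_gt0.
by rewrite -powR_mulrn// -powRD ?subrK// an implybT.
Qed.

Lemma powR_mono (a b p : R) : 0 <= p -> 0 <= a -> a <= b -> a `^ p <= b `^ p.
Proof.
by move=> p0 a0 ab; apply: ge0_ler_powR; rewrite // nnegrE// (le_trans a0).
Qed.

Lemma powR_le_sqr (a M p : R) : 2 < p -> 0 <= a -> a <= M ->
  a `^ p <= M `^ (p - 2) * a ^+ 2.
Proof.
move=> p2 a0 aM; rewrite (@powR_split a p 2)// ler_wpM2r ?sqr_ge0//.
by apply: powR_mono => //; rewrite subr_ge0 ltW.
Qed.

(** Turns closeness of [p] to 6 into a fixed multiplicative loss [r], so that exponents [p] can be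
    compared with the critical ones. The added 1 in the witness covers [a = 1]. *)
Lemma powR_near1 (a r : R) : 0 < a -> 1 < r ->
  exists2 e : R, 0 < e & forall x, `|x| <= e -> a `^ x <= r.
Proof.
move=> a0 r1; have lr : 0 < ln r by rewrite ln_gt0.
exists (ln r / (`|ln a| + 1)); first by rewrite divr_gt0// ltr_wpDl.
move=> x; rewrite ler_pdivlMr ?ltr_wpDl// => h.
rewrite /powR gt_eqF// -[leRHS]lnK ?posrE ?(lt_trans _ r1)// ler_expR.
apply: le_trans h; apply: (le_trans (ler_norm _)); rewrite normrM.
by rewrite ler_wpM2l// lerDl.
Qed.

Lemma adm_noninc_powR l f k p : adm l f k -> 0 <= p ->
  nonincreasing_fun (fun x => f x `^ p).
Proof. by move=> [nf f0 _ _] p0 x y xy; apply: powR_mono => //; exact: nf. Qed.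

Lemma noninc_meas f (D : set R) : nonincreasing_fun f -> measurable D ->
  measurable_fun D f.
Proof. by move=> nf mD; exact: nonincreasing_measurable. Qed.

(** From [a] on, monotonicity bounds the p-th power by [f a] to the power [p - 2] times [f x ^+ 2],
    and the mass is at most 1. *)
Lemma int_powR_le l f k p (a : R) : adm l f k -> 2 < p -> 0 <= a ->
  (\int[mu]_(x in `[a, +oo[) (f x `^ p)%:E <= (f a `^ (p - 2))%:E)%E.
Proof.
move=> A p2 a0; have [nf f0 f1 _] := A.
have p0 : 0 <= p by rewrite ltW// (lt_trans _ p2).
have mf D : measurable D -> measurable_fun D (fun x => f x `^ p).
  by apply: noninc_meas; exact: (adm_noninc_powR A).
have mf2 D : measurable D -> measurable_fun D (fun x => f x ^+ 2).
  by apply: noninc_meas; exact: sqr_noninc.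
apply: (@le_trans _ _ (\int[mu]_(x in `[a, +oo[)
    ((f a `^ (p - 2))%:E * (f x ^+ 2)%:E))%E).
  apply: ge0_le_integral => //=.
  - by move=> x _; rewrite lee_fin powR_ge0.
  - by apply/measurable_EFinP; exact: mf.
  - by apply/measurable_EFinP/measurable_funM; [exact: measurable_cst|exact: mf2].
  - move=> x; rewrite in_itv/= andbT => ax; rewrite -EFinM lee_fin.
    by apply: powR_le_sqr => //; exact: nf.
rewrite ge0_integralZl_EFin//=; last 3 first.
- by move=> x _; rewrite lee_fin sqr_ge0.
- by apply/measurable_EFinP; exact: mf2.
- exact: powR_ge0.
rewrite -[leRHS]mule1 lee_pmul//.
- by rewrite lee_fin powR_ge0.
- by apply: integral_ge0 => x _; rewrite lee_fin sqr_ge0.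
apply: le_trans f1; apply: ge0_subset_integral => //=.
- by apply/measurable_EFinP; exact: mf2.
- by move=> x _; rewrite lee_fin sqr_ge0.
- by move=> x /=; rewrite !in_itv/= !andbT; exact: le_trans.
Qed.

Lemma PpE l f k p : adm l f k -> 2 < p ->
  (\int[mu]_(x in `[0%R, +oo[) (f x `^ p)%:E = (Pp p f)%:E)%E.
Proof.
move=> A p2; rewrite /Pp /Rintegral fineK// ge0_fin_numE.
  by apply: (le_lt_trans (int_powR_le A p2 (lexx 0))); rewrite ltry.
by apply: integral_ge0 => x _; rewrite lee_fin powR_ge0.
Qed.

Lemma Pp_ge0 p f : 0 <= Pp p f.
Proof. by apply: Rintegral_ge0 => x _; exact: powR_ge0. Qed.

Lemma Pp_le l f k p : adm l f k -> 2 < p -> Pp p f <= f 0 `^ (p - 2).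
Proof. by move=> A p2; rewrite -lee_fin -(PpE A p2); exact: (int_powR_le A). Qed.

Lemma adm_sup l f k : adm l f k -> f 0 ^+ 4 <= 4 * k.
Proof.
move=> [nf f0 f1 D]; apply: noninc_sup4 => // y n ny _.
apply: le_trans (D y n ny); apply: psum_le_wt => // x; exact: wt_ge1.
Qed.

(** Beyond [l] the weight is 4, so the unweighted energy there is at most [k / 4]: the constant 4 of
    [adm_sup] drops to 1. *)
Lemma adm_supl l f k : 0 <= l -> adm l f k -> f l ^+ 4 <= k.
Proof.
move=> l0 [nf f0 f1 D].
have -> : k = 4 * (k / 4) by field.
apply: noninc_sup4 => //.
  apply: le_trans f1; apply: ge0_subset_integral => //=.
  - apply/measurable_EFinP; apply: noninc_meas => //; exact: sqr_noninc.
  - by move=> x _; rewrite lee_fin sqr_ge0.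
  - by move=> x /=; rewrite !in_itv/= !andbT; exact: le_trans.
move=> y n ny ly; rewrite ler_pdivlMr//; apply: le_trans (D y n ny).
rewrite mulrC /psum mulr_sumr le_eqVlt; apply/orP; left; apply/eqP.
by apply: eq_bigr => i _; rewrite /wt ltNge ly /= mul1r.
Qed.

Lemma adm_ge0 l f k : adm l f k -> 0 <= k.
Proof. by move=> [_ _ _ /Dle_ge0]. Qed.

Lemma adm_le l f k k' : adm l f k -> k <= k' -> adm l f k'.
Proof. by move=> [a b c d] kk; split => //; exact: Dle_le kk. Qed.

Lemma Pp_tip_le l f k p : 0 <= l -> adm l f k -> 2 < p ->
  Pp p f <= l * f 0 `^ p + f l `^ (p - 2).
Proof.
move=> l0 A p2; have [nf f0 f1 _] := A.
have p0 : 0 <= p by rewrite ltW// (lt_trans _ p2).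
have mf D : measurable D -> measurable_fun D (fun x => f x `^ p).
  by apply: noninc_meas; exact: (adm_noninc_powR A).
rewrite -lee_fin -(PpE A p2) (ge0_itvy_split l0); last 2 first.
- exact: mf.
- by move=> x _; exact: powR_ge0.
rewrite EFinD leeD//; last exact: (int_powR_le A).
apply: (@le_trans _ _ (\int[mu]_(x in `[0%R, l[) (cst (f 0 `^ p)%:E x))%E).
  apply: ge0_le_integral => //=.
  - by move=> x _; rewrite lee_fin powR_ge0.
  - by apply/measurable_EFinP; exact: mf.
  - by move=> x; rewrite in_itv/= lee_fin => /andP[x0 _]; apply: powR_mono => //; exact: nf.
rewrite integral_cst//= lebesgue_measure_itv/= lte_fin.
case: ltP => _; first by rewrite oppr0 adde0 -EFinM mulrC.
by rewrite mule0 lee_fin mulr_ge0// powR_ge0.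
Qed.

(* The constant [1] in [f l ^+ 4 <= k] beats the ratio [9/7] achieved by a tent
   supported in the terminal edge; [23/20] separates the two. *)
Lemma energy_gap l : 0 < l -> exists k0 e0 : R, [/\ 0 < k0, k0 <= 4^-1, 0 < e0 &
  forall p f, 6 - e0 < p -> p < 6 -> adm l f k0 -> Pp p f <= 23 / 20 * k0].
Proof.
(* [d] will bound [f 0], since [4 * k0 = d ^+ 4]. The factor 80 makes the terminal edge contribute
   at most [l * d ^+ 5 <= d ^+ 4 / 80 = k0 / 20]. *)
move=> l0; pose d := Num.min 1 (80 * l)^-1.
have d0 : 0 < d by rewrite lt_min ltr01 invr_gt0 mulr_gt0.
have d1 : d <= 1 by rewrite ge_min lexx.
have ld : l * d <= 80^-1.
  rewrite -ler_pdivlMl//; apply: (@le_trans _ _ (80 * l)^-1).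
    by rewrite ge_min lexx orbT.
  by rewrite invfM mulrC.
pose k0 := d ^+ 4 / 4; pose t := k0 `^ (4^-1).
have k00 : 0 < k0 by rewrite divr_gt0// exprn_gt0.
have t0 : 0 < t by rewrite powR_gt0.
have t4 : t ^+ 4 = k0.
  by rewrite -powR_mulrn ?ltW// -powRrM mulVf ?powRr1// ltW.
(* The rest contributes at most [t] to the power [p - 2], within a factor 11/10 of [t ^+ 4 = k0]. *)
have [e e0 He] := @powR_near1 t (11 / 10) t0 ltac:(lra).
exists k0, (Num.min e 1); split => //.
- by rewrite /k0 -[leRHS]mul1r ler_pM2r ?invr_gt0// exprn_ile1// ltW.
- by rewrite lt_min e0 ltr01.
move=> p f pe p6 A.
have [nf f0 _ _] := A.
have p5 : 5 < p by move: pe; rewrite /Num.min; case: ifP => ? ; lra.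
have pe' : 6 - e < p by move: pe; rewrite /Num.min; case: ifP => ? ; lra.
apply: (le_trans (Pp_tip_le (ltW l0) A _)); first lra.
have fd : f 0 <= d.
  have := adm_sup A; rewrite /k0 mulrC divfK ?gt_eqF// => h.
  by rewrite -(@ler_pXn2r _ 4)//= ?nnegrE ?f0 ?ltW.
have ft : f l <= t.
  have := adm_supl (ltW l0) A; rewrite -t4 => h.
  by rewrite -(@ler_pXn2r _ 4)//= ?nnegrE ?f0 ?ltW.
have h1 : l * f 0 `^ p <= k0 / 20.
  apply: (@le_trans _ _ (l * d ^+ 5)).
    rewrite ler_pM2l//; apply: (@le_trans _ _ (d `^ p)).
      by apply: powR_mono => //; lra.
    have -> : p = (p - 5) + 5%:R by lra.
    rewrite powRD ?(gt_eqF d0) ?implybT// powR_mulrn ?(ltW d0)//.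
    rewrite -[leRHS]mul1r ler_wpM2r ?exprn_ge0 ?(ltW d0)//.
    by have := @powR_mono d 1 (p - 5) ltac:(lra) (ltW d0) d1; rewrite powR1.
  rewrite exprS mulrA; apply: (@le_trans _ _ (80^-1 * d ^+ 4)).
    by rewrite ler_wpM2r// exprn_ge0// ltW.
  by rewrite /k0; lra.
have h2 : f l `^ (p - 2) <= 11 / 10 * k0.
  apply: (@le_trans _ _ (t `^ (p - 2))).
    by apply: powR_mono => //; lra.
  have -> : p - 2 = (p - 6) + 4%:R by lra.
  rewrite powRD ?(gt_eqF t0) ?implybT// powR_mulrn ?(ltW t0)// t4 ler_pM2r//.
  by apply: He; rewrite ler_norml; lra.
by lra.
Qed.

End admissible.

(** * Test profiles *)

Section tent.
Context {R : realType}.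
Notation mu := (@lebesgue_measure R).
Implicit Types (f g : R -> R) (l k p s c w : R).

(** Constant on the negative axis, because profiles are nonincreasing on the whole line; then a
    linear descent from [c] at 0 to 0 at [w]. *)
Definition tent c w (x : R) := c * Num.max 0 (1 - Num.max x 0 / w).

Lemma tent_noninc c w : 0 <= c -> 0 < w -> nonincreasing_fun (tent c w).
Proof.
move=> c0 w0 x y xy; rewrite /tent ler_wpM2l//.
have : Num.max x 0 / w <= Num.max y 0 / w.
  by rewrite ler_pM2r ?invr_gt0//; rewrite /Num.max; do 2 case: ifP; lra.
by move: (_ / w) (_ / w) => a b ab; rewrite /Num.max; do 2 case: ifP; lra.
Qed.

Lemma tent_ge0 c w x : 0 <= c -> 0 <= tent c w x.
Proof. by move=> c0; rewrite mulr_ge0// le_max lexx. Qed.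

Lemma tent_in c w x : 0 < w -> 0 <= x <= w -> tent c w x = c * (1 - x / w).
Proof.
move=> w0 /andP[x0 xw]; rewrite /tent (max_idPl x0) (_ : Num.max 0 _ = 1 - x / w)//.
by apply/max_idPr; rewrite subr_ge0 ler_pdivrMr// mul1r.
Qed.

Lemma tent_out c w x : 0 < w -> w <= x -> tent c w x = 0.
Proof.
move=> w0 wx; rewrite /tent (_ : Num.max 0 _ = 0) ?mulr0//; apply/max_idPl.
rewrite (max_idPl _); last by rewrite (le_trans (ltW w0)).
by rewrite subr_le0 ler_pdivlMr// mul1r.
Qed.

Lemma is_derive_ramp (w : R) n (x : R) : w != 0 ->
  is_derive x (1:R) (fun x : R => - (w / n.+1%:R) * (1 - x / w) ^+ n.+1)
    ((1 - x / w) ^+ n).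
Proof.
move=> w0; have d : is_derive x (1:R) (cst (1:R) - (w^-1 \*: (@id R))) (- w^-1).
  by apply: is_derive_eq; rewrite sub0r /GRing.scale /= mulr1.
have := @is_deriveZ R R R _ (- (w / n.+1%:R)) x (1:R) _ (@is_deriveX _ _ _ n.+1 x (1:R) _ d).
rewrite (_ : _ \*: _ = (fun x : R => - (w / n.+1%:R) * (1 - x / w) ^+ n.+1)); last first.
  apply/funext => y; rewrite /GRing.scale /= /GRing.scale /=.
  by rewrite exprfctE /= [y / w]mulrC.
congr is_derive; rewrite /GRing.scale /= /GRing.scale /= [x / w]mulrC.
rewrite (_ : (cst 1 - w^-1 \*: id) x = 1 - w^-1 * x)//.
have n0 : n.+1%:R != 0 :> R by rewrite pnatr_eq0.
by field; rewrite w0 addrC natr1.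
Qed.

Lemma integral_ramp w n : 0 < w ->
  (\int[mu]_(x in `[0%R, w]) ((1 - x / w) ^+ n)%:E = (w / n.+1%:R)%:E)%E.
Proof.
move=> w0; pose F x : R := - (w / n.+1%:R) * (1 - x / w) ^+ n.+1.
have dF (x : R) : is_derive x (1:R) F ((1 - x / w) ^+ n).
  by apply: is_derive_ramp; rewrite gt_eqF.
have cF : continuous F by move=> x; apply/differentiable_continuous/derivable1_diffP.
rewrite (@continuous_FTC2 _ (fun x => (1 - x / w) ^+ n) F)//.
- rewrite /F mul0r subr0 expr1n divff ?gt_eqF// subrr expr0n/= mulr0 mulr1.
  by rewrite add0e opprK.
- apply: continuous_subspaceT => x.
  elim: n {F dF cF} => [|n IH]; first exact: cvg_cst.
  under eq_fun do rewrite exprS.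
  apply: cvgM IH; apply: cvgB; first exact: cvg_cst.
  by apply: cvgM; [exact: cvg_id|exact: cvg_cst].
- split.
  + by move=> x _.
  + by apply: cvg_at_right_filter; exact: cF.
  + by apply: cvg_at_left_filter; exact: cF.
- by move=> x _; rewrite derive1E derive_val.
Qed.

Lemma integral_tent c w n : 0 <= c -> 0 < w -> (0 < n)%N ->
  (\int[mu]_(x in `[0%R, +oo[) (tent c w x ^+ n)%:E = (c ^+ n * w / n.+1%:R)%:E)%E.
Proof.
move=> c0 w0 n0.
have mt D : measurable D -> measurable_fun D (fun x => tent c w x ^+ n).
  move=> mD; apply: measurable_funX; apply: noninc_meas => //; exact: tent_noninc.
rewrite (ge0_itvy_split (ltW w0)); last 2 first.
- exact: mt.
- by move=> x _; rewrite exprn_ge0// tent_ge0.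
rewrite [X in (_ + X)%E](_ : _ = 0%E) ?adde0; last first.
  apply: integral0_eq => x /=; rewrite in_itv/= andbT => wx.
  by rewrite tent_out// expr0n gtn_eqF.
rewrite integral_itv_bndo_bndc; last by apply/measurable_EFinP; exact: mt.
transitivity (\int[mu]_(x in `[0%R, w]) ((c ^+ n)%:E * ((1 - x / w) ^+ n)%:E))%E.
  apply: eq_integral => x; rewrite inE/= in_itv/= => xw.
  by rewrite tent_in// exprMn EFinM.
rewrite ge0_integralZl_EFin//=.
- by rewrite integral_ramp// -EFinM mulrA.
- move=> x; rewrite in_itv/= => /andP[x0 xw]; rewrite lee_fin exprn_ge0// subr_ge0.
  by rewrite ler_pdivrMr// mul1r.
- apply/measurable_EFinP; apply: measurable_funX; apply: measurable_funB => //.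
  exact: measurable_funM.
- exact: exprn_ge0.
Qed.

(** A cell costs at most [K * (c / w) ^+ 2] times the length of its overlap with [[0, w]], and these
    lengths telescope. Cells starting beyond [w] cost nothing, so [K] has to bound the weight to the
    left of [w] only. *)
Lemma tent_Dle c w l (K : R) : 0 <= c -> 0 < w -> 0 <= K -> (forall x, x < w -> wt l x <= K) ->
  Dle (wt l) (tent c w) (K * (c ^+ 2 / w)).
Proof.
move=> c0 w0 K0 Kl y n ny.
pose z i := Num.min (y i) w.
pose g i := K * (c / w) ^+ 2 * Num.max 0 (z i).
have zw i : z i <= w by rewrite ge_min lexx orbT.
have gm i : Num.max 0 (z i) <= w by rewrite ge_max zw ltW.
apply: (@le_trans _ _ (\sum_(i < n) (g i.+1 - g i))); last first.
  rewrite -(big_mkord xpredT (fun i => g i.+1 - g i)) telescope_sumr//.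
  rewrite (@le_trans _ _ (g n))//.
    by rewrite gerBl; apply: mulr_ge0; [rewrite mulr_ge0 ?sqr_ge0|rewrite le_max lexx].
  have -> : K * (c ^+ 2 / w) = K * (c / w) ^+ 2 * w by field; rewrite gt_eqF.
  by rewrite /g ler_wpM2l// mulr_ge0 ?sqr_ge0.
apply: ler_sum => i _.
have yy := ny _ _ (leqnSn i).
have [wy|yw] := leP w (y i).
  rewrite !tent_out//; last exact: le_trans yy.
  rewrite subrr expr0n mul0r mulr0 /g /z (min_idPr wy) (min_idPr (le_trans wy yy)).
  by rewrite subrr.
have [e|yne] := eqVneq (y i.+1) (y i).
  by rewrite /g /z e !subrr invr0 !mulr0.
have yp : 0 < y i.+1 - y i by rewrite subr_gt0 lt_neqAle eq_sym yne.
have tE x : tent c w x = c * (1 - Num.max 0 (Num.min x w) / w).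
  have [wx|xw] := leP w x.
    by rewrite tent_out// (max_idPr (ltW w0)) divff ?gt_eqF// subrr mulr0.
  have [x0|x0] := leP 0 x; first by rewrite tent_in ?x0 ?ltW.
  rewrite /tent (max_idPr (ltW x0)) mul0r subr0 (max_idPr ler01).
  by [].
rewrite !tE /g -/(z i) -/(z i.+1).
have zz : z i.+1 - z i <= y i.+1 - y i.
  by rewrite /z /Num.min; case: ifP; case: ifP; lra.
have zz0 : z i <= z i.+1.
  by rewrite /z /Num.min; case: ifP; case: ifP; lra.
have mm : 0 <= Num.max 0 (z i.+1) - Num.max 0 (z i) <= y i.+1 - y i.
  by apply/andP; split; rewrite /Num.max; case: ifP; case: ifP; lra.
set a := Num.max 0 (z i.+1) in mm *; set b := Num.max 0 (z i) in mm *.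
have -> : c * (1 - a / w) - c * (1 - b / w) = - (c / w) * (a - b) by ring.
rewrite exprMn sqrrN -mulrBr; have := sqr_ge0 (c / w).
move: ((c / w) ^+ 2) => t t0.
rewrite -(mulrA t) -(mulrA K t); apply: (@le_trans _ _ (K * (t * ((a - b) ^+ 2 / (y i.+1 - y i))))).
  by rewrite ler_wpM2r ?Kl// mulr_ge0// divr_ge0 ?sqr_ge0// (ltW yp).
rewrite ler_wpM2l// ler_wpM2l// ler_pdivrMr// expr2.
by case/andP: mm => m0 m1; rewrite ler_wpM2l.
Qed.

(** The mass [c ^+ 2 * w / 3] equals 1 for [c ^+ 2 = 3 / w], and the unweighted energy is then
    [c ^+ 2 / w = 3 / w ^+ 2]. *)
Lemma tent_adm l w (K : R) : 0 < w -> 0 <= K -> (forall x, x < w -> wt l x <= K) ->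
  adm l (tent (Num.sqrt (3 / w)) w) (K * (3 / w ^+ 2)).
Proof.
move=> w0 K0 Kw; have c0 : 0 <= Num.sqrt (3 / w) by rewrite sqrtr_ge0.
split.
- exact: tent_noninc.
- by move=> x; exact: tent_ge0.
- rewrite integral_tent// sqr_sqrtr ?divr_ge0 ?(ltW w0)// divfK ?gt_eqF//.
  by rewrite divff.
- have -> : 3 / w ^+ 2 = Num.sqrt (3 / w) ^+ 2 / w.
    by rewrite sqr_sqrtr ?divr_ge0 ?ltW//; field; rewrite gt_eqF.
  exact: tent_Dle.
Qed.

(* Concentrated at the tip, a tent has P_6 / K = 9/7 > 23/20. *)
Lemma concentrated_test l : 0 < l -> exists2 e0 : R, 0 < e0 &
  forall p, 6 - e0 < p -> p < 6 -> exists f k,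
    adm l f k /\ 23 / 20 * 4^-1 < Pp p f - 23 / 20 * k.
Proof.
(* [w <= l] keeps the descent where the weight is 1. [w <= 1/2] makes the energy [3 / w ^+ 2] at
   least 12, so that the surplus 19/20 * 9/7 - 23/20 per unit of energy exceeds the required
   23/80. *)
move=> l0; pose w := Num.min l 2^-1.
have w0 : 0 < w by rewrite lt_min l0 invr_gt0 ltr0n.
have wl : w <= l by rewrite ge_min lexx.
have w2 : w <= 2^-1 by rewrite ge_min lexx orbT.
pose c := Num.sqrt (3 / w).
have c2 : c ^+ 2 = 3 / w by rewrite sqr_sqrtr// divr_ge0// ltW.
have c0 : 0 < c by rewrite sqrtr_gt0 divr_gt0.
(* The tent stays below [c], so replacing the exponent 6 by [p] loses at most the factor 19/20 at
   every point. *)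
have [e e0 He] := @powR_near1 _ c (20 / 19) c0 ltac:(lra).
have A : adm l (tent c w) (1 * (3 / w ^+ 2)).
  apply: tent_adm => // x xw; rewrite /wt (lt_le_trans xw wl); lra.
rewrite mul1r in A.
exists (Num.min e 1); first by rewrite lt_min e0 ltr01.
move=> p pe p6; exists (tent c w), (3 / w ^+ 2); split => //.
have p5 : 5 < p by move: pe; rewrite /Num.min; case: ifP => ? ; lra.
have pe' : 6 - e < p by move: pe; rewrite /Num.min; case: ifP => ? ; lra.
have h : 19 / 20 * (9 / 7 * (3 / w ^+ 2)) <= Pp p (tent c w).
  rewrite -lee_fin -(PpE A); last lra.
  have -> : (19 / 20 * (9 / 7 * (3 / w ^+ 2)))%:E =
      (\int[mu]_(x in `[0%R, +oo[) ((19/20)%:E * (tent c w x ^+ 6)%:E))%E.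
    rewrite ge0_integralZl_EFin//=.
    - rewrite integral_tent//; last exact: ltW.
      rewrite -EFinM; congr (_ %:E); congr (_ * _).
      have -> : c ^+ 6 = (c ^+ 2) ^+ 3 by rewrite -exprM.
      by rewrite c2; field; rewrite gt_eqF.
    - by move=> x _; rewrite lee_fin exprn_ge0// tent_ge0// ltW.
    - apply/measurable_EFinP; apply: measurable_funX; apply: noninc_meas => //.
      by apply: tent_noninc => //; exact: ltW.
  apply: ge0_le_integral => //=.
  - move=> x _; rewrite -EFinM lee_fin mulr_ge0 ?exprn_ge0 ?tent_ge0 ?ltW//; lra.
  - apply/measurable_EFinP; apply: measurable_funM => //; apply: measurable_funX.
    by apply: noninc_meas => //; apply: tent_noninc => //; exact: ltW.
  - apply/measurable_EFinP; apply: noninc_meas => //.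
    by apply: (adm_noninc_powR A); lra.
  - move=> x; rewrite in_itv/= andbT => x0; rewrite -EFinM lee_fin.
    have t0 : 0 <= tent c w x by rewrite tent_ge0 ?ltW.
    have tc : tent c w x <= c.
      rewrite /tent -[leRHS]mulr1 ler_wpM2l ?(ltW c0)// ge_max ler01/= gerBl.
      by rewrite divr_ge0 ?(ltW w0)// le_max lexx orbT.
    move: (tent c w x) t0 tc => t; rewrite le_eqVlt => /predU1P[<- _|t0 tc].
      by rewrite expr0n/= mulr0 powR_ge0.
    have -> : p = (p - 6) + 6%:R by lra.
    rewrite powRD ?(gt_eqF t0) ?implybT// powR_mulrn ?(ltW t0)// ler_wpM2r ?exprn_ge0 ?(ltW t0)//.
    have h1 : c `^ (6 - p) <= 20 / 19 by apply: He; rewrite ler_norml; lra.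
    have h2 : t `^ (6 - p) <= 20 / 19.
      by apply: le_trans h1; apply: powR_mono => //; lra.
    have -> : p - 6 = - (6 - p) by lra.
    have c1 : (0 : R) < 20 / 19 by lra.
    by rewrite powRN -[19 / 20]invf_div lef_pV2 ?posrE ?powR_gt0.
have h4 : 4 <= (w ^+ 2)^-1.
  rewrite -(invrK 4) lef_pV2 ?posrE ?invr_gt0 ?exprn_gt0 ?ltr0n//; nra.
by lra.
Qed.

Lemma powR_half (a p : R) : 0 <= a -> a `^ p = (a ^+ 2) `^ (p / 2).
Proof.
by move=> a0; rewrite -powR_mulrn// -powRrM (_ : 2%:R * (p / 2) = p)//; field.
Qed.

Lemma powR_invl (a p : R) : 0 <= a -> a^-1 `^ p = (a `^ p)^-1.
Proof. by move=> a0; rewrite -powR_inv1// -powRrM mulN1r powRN. Qed.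

(** A tent of width w has energy of order w^(-2), while int f^p is at least of order w^(1 - p/2).
    The latter wins for large w because [p < 6]. *)
Lemma spread_test l p s : 4 < p -> p < 6 ->
  exists f k, adm l f k /\ 0 < Pp p f - s * k.
Proof.
move=> p4 p6; pose a : R := (3 / 4) `^ (p / 2).
have a0 : 0 < a by rewrite powR_gt0//; lra.
pose b := `|s| + 1; have b0 : 0 < b by rewrite ltr_wpDl.
pose T := 24 * b / a; have T0 : 0 < T by rewrite divr_gt0// mulr_gt0.
have q0 : 0 < 3 - p / 2 by lra.
(* This width makes the lower bound for [Pp], read off at the midpoint of the tent, equal to [b]
   times the energy bound [12 / w ^+ 2]; and [b > s]. *)
pose w := T `^ (3 - p / 2)^-1.
have w0 : 0 < w by rewrite powR_gt0.
have wT : w `^ (3 - p / 2) = T by rewrite -powRrM mulVf ?gt_eqF// powRr1// ltW.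
pose W := w `^ (p / 2); have W0 : 0 < W by rewrite powR_gt0.
have w3 : w ^+ 3 = W * T.
  rewrite -wT -powRD ?(gt_eqF w0) ?implybT//.
  by rewrite (_ : p / 2 + (3 - p / 2) = 3%:R) ?powR_mulrn ?(ltW w0)//; lra.
pose c := Num.sqrt (3 / w).
have c2 : c ^+ 2 = 3 / w by rewrite sqr_sqrtr// divr_ge0// ltW.
have c0 : 0 < c by rewrite sqrtr_gt0 divr_gt0.
have A : adm l (tent c w) (4 * (3 / w ^+ 2)).
  by apply: tent_adm => // x _; exact: wt_le4.
exists (tent c w), (4 * (3 / w ^+ 2)); split => //.
have P1 : (c / 2) `^ p * (w / 2) <= Pp p (tent c w).
  rewrite -lee_fin -(PpE A); last lra.
  have p0 : 0 <= p by lra.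
  have := @noninc_riemanny _ _ 0 (w / 2) 1 (adm_noninc_powR A p0)
    (fun x => powR_ge0 _ _) (_ : 0 <= w / 2).
  rewrite big_ord1 add0r mul1r [_ * (tent _ _ _ `^ _)]mulrC tent_in//; last lra.
  have -> : c * (1 - w / 2 / w) = c / 2 by field; rewrite gt_eqF.
  by apply; lra.
have cp : (c / 2) `^ p = a / W.
  rewrite powR_half; last by rewrite divr_ge0 ?(ltW c0).
  have -> : (c / 2) ^+ 2 = 3 / 4 * w^-1.
    by rewrite exprMn c2; field; rewrite gt_eqF.
  by rewrite powRM ?invr_ge0 ?(ltW w0)// ?powR_invl ?(ltW w0)//; lra.
have e1 : (c / 2) `^ p * (w / 2) = b * (4 * (3 / w ^+ 2)).
  rewrite cp.
  have -> : a / W * (w / 2) = a * w ^+ 3 / (2 * W * w ^+ 2).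
    by field; rewrite !gt_eqF.
  by rewrite w3 /T; field; rewrite !gt_eqF.
rewrite subr_gt0; apply: lt_le_trans P1; rewrite e1 ltr_pM2r.
  by rewrite (le_lt_trans (ler_norm _))// ltrDl.
by rewrite mulr_gt0// divr_gt0// exprn_gt0.
Qed.

End tent.

(** * Compactness *)

Section compactness.
Context {R : realType}.
Notation mu := (@lebesgue_measure R).
Implicit Types (l k p s B : R).

(** The condition [n <= h n] suffices for limits and is preserved by successive extractions. *)
Lemma cvg_subseq (T : topologicalType) (u : nat -> T) (a : T) (h : nat -> nat) :
  (forall n, (n <= h n)%N) -> u @ \oo --> a -> (u \o h) @ \oo --> a.
Proof.
move=> hn ua; apply: cvg_comp ua; apply/cvgnyPge => A; near=> n.
by apply: leq_trans (hn n); near: n; exact: nbhs_infty_ge.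
Unshelve. all: by end_near. Qed.

Lemma cvg_powR (T : Type) (F : set_system T) {FF : ProperFilter F} (u : T -> R) (a p : R) :
  0 < p -> (forall n, 0 <= u n) -> u @ F --> a -> (fun n => u n `^ p) @ F --> a `^ p.
Proof.
move=> p0 u0 ua.
have a0 : 0 <= a.
  rewrite leNgt; apply/negP => an; have H : \forall n \near F, u n < 0 by exact: (cvgr_lt a ua).
  have [n] := filter_ex H.
  by rewrite ltNge u0.
(* At a positive limit the power is differentiable. At 0 the estimate is made by hand, with
   threshold [e] to the power [p^-1]. *)
move: a0; rewrite le_eqVlt => /predU1P[a0|a0]; last first.
  apply: (@cvg_comp _ _ _ u (fun a : R => a `^ p) _ (nbhs a)) => //.
  have : derivable (fun b : R => b `^ p) a 1.
    by apply: derivable_powR; rewrite in_itv/= a0.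
  by move=> /derivable1_diffP/differentiable_continuous.
rewrite -a0 powR0 ?gt_eqF// in ua *.
apply/cvgr0Pnorm_le => e e0.
have e1 : 0 < e `^ p^-1 by rewrite powR_gt0.
have /cvgr0Pnorm_le/(_ _ e1) := ua; apply: filterS => n.
rewrite !ger0_norm ?powR_ge0// => h.
apply: (le_trans (powR_mono (ltW p0) (u0 n) h)).
by rewrite -powRrM mulVf ?gt_eqF// powRr1// ltW.
Qed.

(* A cluster point in the product topology is a pointwise limit along a
   subsequence on any prescribed countable set of points. *)
Lemma pointwise_cluster (u : nat -> R -> R) (C : R -> R) (q : nat -> R) :
  (forall n x, `|u n x| <= C x) ->
  exists G : R -> R, (forall x y e : R, 0 < e -> exists n, `|u n x - G x| < e /\ `|u n y - G y| < e) /\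
    exists h : nat -> nat, (forall n, (n <= h n)%N) /\
      forall j, (fun n => u (h n) (q j)) @ \oo --> G (q j).
Proof.
move=> uC.
have := @tychonoff R (fun=> R : topologicalType) (fun x => `[- C x, C x]%classic)
  (fun x => @segment_compact R _ _).
move=> /(_ (u @ \oo)) [].
  by exists 0%N => // n _ x /=; rewrite in_itv/= -ler_norml.
move=> G [_ clG]; exists G.
have near1 (x e : R) : 0 < e -> nbhs G [set g : R -> R | `|g x - G x| < e].
  move=> e0; have := @proj_continuous R (fun=> R : topologicalType) x G.
  move=> /(_ [set z | `|z - G x| < e]); apply.
  by exists e => //= z /=; rewrite distrC.
have nearn (e : R) (k : nat) : 0 < e ->
    nbhs G [set g : R -> R | forall j, (j < k)%N -> `|g (q j) - G (q j)| < e].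
  move=> e0; elim: k => [|k IH]; first by apply: filterS filterT.
  apply: filterS (filterI IH (near1 (q k) e e0)) => g [/= gk gkk] j.
  by rewrite ltnS leq_eqVlt => /predU1P[->//|/gk].
split.
  move=> x y e e0.
  have ru : (u @ \oo) (range u) by exists 0%N => // n _; exists n.
  have [g [[n _ <-] [/= gx gy]]] := clG _ _ ru (filterI (near1 x e e0) (near1 y e e0)).
  by exists n.
(* Diagonal choice: the k-th index is accurate to 1/(k+1) at the first k points. *)
have pick (k : nat) : exists n, (k <= n)%N /\ forall j, (j < k)%N -> `|u n (q j) - G (q j)| < k.+1%:R^-1.
  have e0 : 0 < k.+1%:R^-1 :> R by rewrite invr_gt0.
  have rk : (u @ \oo) [set u n | n in [set n | (k <= n)%N]].
    by exists k => // n /= kn; exists n.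
  by have [g [[n /= kn <-] H]] := clG _ _ rk (nearn _ k e0); exists n.
have /choice[h hP] := pick.
exists h; split; first by move=> n; case: (hP n).
move=> j; apply/cvgrPdist_lt => e e0; near=> n.
rewrite distrC; have [_ /(_ j)] := hP n.
have jn : (j < n)%N by near: n; exact: nbhs_infty_gt.
move=> /(_ jn) /lt_trans; apply.
by near: n; exact: near_infty_natSinv_lt (PosNum e0).
Unshelve. all: by end_near. Qed.

Lemma psum_cvg w (u : nat -> R -> R) (F : R -> R) y m :
  (forall x, (u ^~ x) @ \oo --> F x) ->
  (fun n => psum w (u n) y m) @ \oo --> psum w F y m.
Proof.
move=> uF; rewrite /psum; apply: cvg_big.
  by move=> /= x; apply: cvgD; [exact: cvg_fst|exact: cvg_snd].
move=> i _; apply: cvgM; first exact: cvg_cst.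
apply: cvgM; last exact: cvg_cst.
have h : (fun n => u n (y i.+1) - u n (y i)) @ \oo --> F (y i.+1) - F (y i).
  by apply: cvgB; exact: uF.
exact: (cvgM h h).
Qed.

Lemma holder_bound (a b c : R) : 0 <= c -> (a - b) ^+ 2 <= c -> `|a - b| <= Num.sqrt c.
Proof.
by move=> c0 h; rewrite -(@ler_pXn2r _ 2)// ?nnegrE ?sqrtr_ge0// sqr_sqrtr// real_normK ?num_real.
Qed.

Lemma adm_holder l f k x y : adm l f k -> `|f x - f y| <= Num.sqrt (k * `|x - y|).
Proof.
move=> A; have k0 := adm_ge0 A; have [_ _ _ D] := A.
have w1 := @wt_ge1 R l.
apply: holder_bound; first by rewrite mulr_ge0.
have [xy|/ltW yx] := leP x y.
  by rewrite -sqrrN opprB distrC (ger0_norm (_ : 0 <= y - x)) ?subr_ge0//; exact: (Dle_holder w1 D).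
by rewrite (ger0_norm (_ : 0 <= x - y)) ?subr_ge0//; exact: (Dle_holder w1 D).
Qed.

Lemma adm_bound l f k : adm l f k -> f 0 <= 1 + 4 * k.
Proof.
move=> A; have k0 := adm_ge0 A; have h := adm_sup A; have [_ f0 _ _] := A.
rewrite leNgt; apply/negP => fk.
have f1 : 1 <= f 0 by rewrite (le_trans _ (ltW fk))// lerDl mulr_ge0.
have := le_trans (ler_eXnr _ f1 : f 0 <= f 0 ^+ 4) h => /(_ isT) h2.
by move: (lt_le_trans fk h2); lra.
Qed.

(** Bounded energies give a common Hoelder modulus of exponent 1/2, so convergence at the rationals
    spreads to every point by a three-term estimate. *)
Lemma adm_pointwise_cvg l (f : nat -> R -> R) (k : nat -> R) B :
  (forall n, adm l (f n) (k n)) -> (forall n, k n <= B) ->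
  exists (F : R -> R) (h : nat -> nat), (forall n, (n <= h n)%N) /\
    forall x, (fun n => f (h n) x) @ \oo --> F x.
Proof.
move=> A kB; have k0 n : 0 <= k n := adm_ge0 (A n).
have B0 : 0 <= B := le_trans (k0 0%N) (kB 0%N).
have hol n x y : `|f n x - f n y| <= Num.sqrt (B * `|x - y|).
  by apply: (le_trans (adm_holder _ _ (A n))); rewrite ler_wsqrtr// ler_wpM2r.
pose C (x : R) := 1 + 4 * B + Num.sqrt (B * `|x - 0|).
have fC n x : `|f n x| <= C x.
  rewrite -[f n x](subrK (f n 0)) (le_trans (ler_normD _ _))// addrC lerD//.
  have [_ f0 _ _] := A n; rewrite ger0_norm//.
  by apply: (le_trans (adm_bound (A n))); rewrite lerD2l ler_wpM2l.
pose q j : R := ratr (odflt 0%R (unpickle j : option rat)).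
have [G [G2 [h [hn hq]]]] := pointwise_cluster q fC.
(* The cluster property approximates the limit at any two real points simultaneously, which is what
   passing the modulus to [G] takes. *)
have holG x y : `|G x - G y| <= Num.sqrt (B * `|x - y|).
  apply/ler_addgt0Pr => e e0.
  have [n [h1 h2]] := G2 x y (e / 2) (divr_gt0 e0 (ltr0Sn _ 1)).
  have -> : G x - G y = - (f n x - G x) + (f n x - f n y) + (f n y - G y) by ring.
  apply: (le_trans (ler_normD _ _)); apply: (le_trans (lerD (ler_normD _ _) (lexx _))).
  by rewrite normrN; have := hol n x y; move: h1 h2; lra.
exists G, h; split => // x; apply/cvgrPdist_le => e e0.
pose d := (e / 3) ^+ 2 / (B + 1).
have B1 : 0 < B + 1 by lra.
have d0 : 0 < d by rewrite divr_gt0// exprn_gt0// divr_gt0.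
have [r] : exists r : rat, ratr r \in `]x - d, x + d[ by apply: rat_in_itvoo; lra.
rewrite in_itv/= => /andP[r1 r2].
have [j qj] : exists j, q j = ratr r.
  by exists (pickle r); rewrite /q pickleK.
have xq : `|x - q j| <= d by rewrite qj ler_norml; lra.
have sq : Num.sqrt (B * `|x - q j|) <= e / 3.
  have e3 : 0 <= e / 3 by lra.
  rewrite (le_trans _ (_ : Num.sqrt ((e / 3) ^+ 2) <= _))//; last by rewrite sqrtr_sqr ger0_norm//; lra.
  rewrite ler_wsqrtr//; apply: (@le_trans _ _ (B * d)); first by rewrite ler_wpM2l.
  by rewrite /d mulrA ler_pdivrMr// mulrC ler_wpM2l ?sqr_ge0//; lra.
have /cvgrPdist_le/(_ (e / 3)) := hq j; rewrite divr_gt0// => /(_ isT).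
apply: filterS => n hn'.
have -> : G x - f (h n) x = (G x - G (q j)) + (G (q j) - f (h n) (q j)) - (f (h n) x - f (h n) (q j)) by ring.
apply: (le_trans (ler_normB _ _)); apply: (le_trans (lerD (ler_normD _ _) (lexx _))).
by have := hol (h n) x (q j); have := holG x (q j); move: hn' sq; lra.
Qed.

(** The mass passes to the limit by Fatou, as an inequality. This is why [adm] relaxes the
    constraint to mass at most 1; [maximizer_mass] recovers equality. *)
Lemma adm_limit l (f : nat -> R -> R) (k : nat -> R) (F : R -> R) (K : R) :
  (forall n, adm l (f n) (k n)) -> (forall x, (fun n => f n x) @ \oo --> F x) ->
  k @ \oo --> K -> adm l F K.
Proof.
move=> A fF kK.
have F0 x : 0 <= F x.
  by apply: (ler_cvg_to (cvg_cst 0) (fF x)); apply: nearW => n; case: (A n).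
have nF : nonincreasing_fun F.
  move=> x y xy; apply: (ler_cvg_to (fF y) (fF x)); apply: nearW => n.
  by case: (A n) => + _ _ _; apply.
split => //; last first.
  move=> y n ny; have h := @psum_cvg (wt l) _ _ y n fF; apply: (ler_cvg_to h kK).
  by apply: nearW => m; case: (A m) => _ _ _; apply.
have mf n : measurable_fun (`[0, +oo[ : set R) (fun x => (f n x ^+ 2)%:E).
  apply/measurable_EFinP; apply: noninc_meas => //.
  by case: (A n) => nf f0 _ _; exact: sqr_noninc.
have := @fatou _ _ _ mu `[0%R, +oo[%classic _ (fun n x => (f n x ^+ 2)%:E) mf.
move=> /(_ ltac:(by []) _) H.
apply: (@le_trans _ _ (\int[mu]_(x in `[0%R, +oo[) limn_einf (fun n => (f n x ^+ 2)%:E))%E).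
  rewrite le_eqVlt; apply/orP; left; apply/eqP; apply: eq_integral => x _.
  have c : (fun n => (f n x ^+ 2)%:E) @ \oo --> (F x ^+ 2)%:E.
    by apply: cvg_EFin; [exact: nearW|apply: cvgM; exact: fF].
  rewrite is_cvg_limn_einfE; last by apply/cvg_ex; exists (F x ^+ 2)%:E.
  by apply/esym/cvg_lim.
apply: (le_trans (H _)); first by move=> n x _; rewrite lee_fin sqr_ge0.
rewrite limn_einf_lim; apply: lime_le; first exact: is_cvg_einfs.
apply: nearW => n; apply: ereal_inf_le.
exists (\int[mu]_(x in `[0%R, +oo[) (f n x ^+ 2)%:E)%E; last by case: (A n).
by exists n => //=.
Qed.

(** Four of the powers pay for the majorant 1/(1 + x^2): [a ^+ 4] is at most [C ^+ 4], and
    [a ^+ 4 * x ^+ 2] is at most 1 by the decay hypothesis. *)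
Lemma dom_powR (a C x p : R) : 4 < p -> 0 <= a -> a <= C -> 0 <= x -> x * a ^+ 2 <= 1 ->
  a `^ p <= C `^ (p - 4) * (C ^+ 4 + 1) * (oneDsqr x)^-1.
Proof.
move=> p4 a0 aC x0 xa; rewrite (@powR_split _ a p 4)// -mulrA.
apply: ler_pM; rewrite ?powR_ge0 ?exprn_ge0//.
  by apply: powR_mono => //; lra.
rewrite ler_pdivlMr ?oneDsqr_gt0// /oneDsqr mulrDr mulr1 lerD//.
  by rewrite lerXn2r ?nnegrE// (le_trans a0).
have -> : a ^+ 4 * x ^+ 2 = (x * a ^+ 2) ^+ 2 by ring.
by rewrite exprn_ile1// mulr_ge0// sqr_ge0.
Qed.

(** Unlike the mass, this integral cannot leak to infinity: nonincreasing profiles of mass at most 1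
    share the decay x^(-1/2), and [p > 4] makes the p-th powers dominated by an integrable
    function. *)
Lemma Pp_cvg l (f : nat -> R -> R) (k : nat -> R) F K B p : 4 < p ->
  (forall n, adm l (f n) (k n)) -> (forall n, k n <= B) -> adm l F K ->
  (forall x, (fun n => f n x) @ \oo --> F x) ->
  (fun n => Pp p (f n)) @ \oo --> Pp p F.
Proof.
move=> p4 A kB AF fF.
have p0 : 0 <= p by lra.
have p2 : 2 < p by lra.
pose C := 1 + 4 * B; pose M := C `^ (p - 4) * (C ^+ 4 + 1).
have M0 : 0 <= M by rewrite mulr_ge0 ?powR_ge0// addr_ge0// exprn_even_ge0.
pose g (x : R) := (M * (oneDsqr x)^-1)%:E.
have mo : measurable_fun [set: R] (fun x : R => (oneDsqr x)^-1).
  by apply: continuous_measurable_fun; exact: continuous_oneDsqrV.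
have mo' : measurable_fun (`[0, +oo[ : set R) (fun x : R => (oneDsqr x)^-1).
  by apply: measurable_funS mo.
have o0 (x : R) : 0 <= (oneDsqr x)^-1 by rewrite invr_ge0 ltW// oneDsqr_gt0.
have ig1 : mu.-integrable `[0, +oo[ (fun x : R => ((oneDsqr x)^-1)%:E).
  apply/integrableP; split; first exact/measurable_EFinP.
  rewrite (_ : (\int[mu]_(x in `[0%R, +oo[) `|((oneDsqr x)^-1)%:E|)%E =
     (\int[mu]_(x in `[0%R, +oo[) ((oneDsqr x)^-1)%:E)%E).
    by rewrite integral0y_oneDsqr ltry.
  by apply: eq_integral => x _; rewrite gee0_abs// lee_fin.
have ig : mu.-integrable `[0, +oo[ g.
  rewrite (_ : g = (fun x => M%:E * ((oneDsqr x)^-1)%:E)%E)//.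
  exact: integrableZl.
have [] := @dominated_convergence _ _ _ mu `[0, +oo[%classic (measurable_itv _)
   (fun n x => (f n x `^ p)%:E) (fun x => (F x `^ p)%:E) g.
- move=> n; apply/measurable_EFinP; apply: noninc_meas => //.
  exact: (adm_noninc_powR (A n)).
- by apply/measurable_EFinP; apply: noninc_meas => //; exact: (adm_noninc_powR AF).
- apply: aeW => x _; apply: cvg_EFin; first exact: nearW.
  by apply: cvg_powR => //; [lra|move=> n; case: (A n)].
- exact: ig.
- apply: aeW => x n; rewrite /= in_itv/= andbT => x0.
  have [nf f0 f1 _] := A n.
  rewrite ger0_norm ?powR_ge0// /g lee_fin; apply: dom_powR => //.
    apply: (le_trans (nf _ _ x0)); apply: (le_trans (adm_bound (A n))).
    by rewrite lerD2l ler_wpM2l.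
  by have := sqr_decay nf f0 f1 x0; rewrite subr0.
move=> _ _; rewrite (PpE AF p2) => /fine_cvgP[_].
by apply: cvg_trans; apply: near_eq_cvg; apply: nearW => n.
Qed.

Lemma adm_compact l (f : nat -> R -> R) (k : nat -> R) B p : 4 < p ->
  (forall n, adm l (f n) (k n)) -> (forall n, k n <= B) ->
  exists (F : R -> R) (K : R) (h : nat -> nat), [/\ forall n, (n <= h n)%N, adm l F K,
    (fun n => k (h n)) @ \oo --> K & (fun n => Pp p (f (h n))) @ \oo --> Pp p F].
Proof.
move=> p4 A kB; have k0 n : 0 <= k n := adm_ge0 (A n).
have [|g gi gc] := @bolzano_weierstrass R k.
  exists B; split; first exact: num_real.
  by move=> x Bx n _ /=; rewrite ger0_norm// (le_trans (kB n))// ltW.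
have gn n : (n <= g n)%N.
  elim: n => // n IH; apply: (leq_ltn_trans IH).
  by have /increasing_seqP/(_ n) := gi; rewrite ltEnat.
have [F [h [hn hF]]] := adm_pointwise_cvg (fun n => A (g n)) (fun n => kB (g n)).
have kK := cvg_subseq hn gc.
have AF := adm_limit (fun n => A (g (h n))) hF kK.
exists F, (limn (k \o g)), (g \o h); split => //.
- by move=> n; apply: leq_trans (hn n) (gn _).
- exact: (Pp_cvg p4 (fun n => A (g (h n))) (fun n => kB _) AF hF).
Qed.

End compactness.

(** * Two maximizers *)

Section maximizers.
Context {R : realType}.
Notation mu := (@lebesgue_measure R).
Implicit Types (f g : R -> R) (l k p s B : R).

(** For [s > 0], optimality among the bounds [m] of [f] itself forces [k] to be the least one, so
    here [k] is the true Dirichlet integral. *)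
Definition maximizer l p s f k := adm l f k /\
  forall g m, adm l g m -> Pp p g - s * m <= Pp p f - s * k.

Lemma adm0 l : adm l (cst 0) 0.
Proof.
split => //.
- under eq_integral do rewrite expr0n /=.
  by rewrite integral0 lee_fin.
- move=> y n ny; rewrite /psum big1// => i _.
  by rewrite subrr expr0n mul0r mulr0.
Qed.

Lemma Pp0 p : p != 0 -> Pp p (cst 0) = 0 :> R.
Proof.
move=> p0; rewrite /Pp /Rintegral; under eq_integral do rewrite /= powR0//.
by rewrite integral0.
Qed.

Lemma Pp_lin l p f k : 4 < p -> p < 6 -> adm l f k -> Pp p f <= 1 + 4 * k.
Proof.
move=> p4 p6 A; have k0 := adm_ge0 A; have h := adm_sup A; have [_ f0 _ _] := A.
apply: (le_trans (Pp_le A _)); first lra.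
have [f1|/ltW f1] := leP (f 0) 1.
  apply: (@le_trans _ _ (1 `^ (p - 2))); last by rewrite powR1 /=; lra.
  by apply: powR_mono => //; lra.
apply: (@le_trans _ _ (f 0 `^ 4%:R)); first by apply: ler_powR => //; lra.
by rewrite powR_mulrn//; lra.
Qed.

(** Subcriticality: [Pp p f] grows at most like [4 * k] to the power [(p - 2) / 4 < 1], so large
    energies make the functional very negative. The threshold -1 admits near-maximizers, and [B]
    serves all [s >= s0]. *)
Lemma near_max_bound p s0 : 4 < p -> p < 6 -> 0 < s0 -> exists2 B, 0 <= B &
  forall l f k s, s0 <= s -> adm l f k -> - 1 <= Pp p f - s * k -> k <= B.
Proof.
move=> p4 p6 s00; pose t := (p - 2) / 4.
have t1 : 0 < 1 - t by rewrite /t; lra.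
(* If [4 * k >= 1], then s0 k <= 1 + (4k)^t <= 2 (4k)^t, that is, (4k)^(1-t) <= 8/s0. *)
pose B := 1 + (8 / s0) `^ (1 - t)^-1.
have B0 : 0 <= B by rewrite addr_ge0// powR_ge0.
exists B => // l f k s ss A h.
have k0 := adm_ge0 A; have h4 := adm_sup A; have [_ f0 _ _] := A.
rewrite leNgt; apply/negP => Bk.
have y1 : 1 <= 4 * k by have := powR_ge0 (8 / s0) (1 - t)^-1; move: Bk; rewrite /B; lra.
have kp : 0 < 4 * k by lra.
have P1 : Pp p f <= (4 * k) `^ t.
  apply: (le_trans (Pp_le A _)); first lra.
  have -> : f 0 `^ (p - 2) = (f 0 ^+ 4) `^ t.
    by rewrite -powR_mulrn// -powRrM; congr (_ `^ _); rewrite /t; field.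
  by apply: powR_mono => //; rewrite ?exprn_ge0//; rewrite /t; lra.
have yt : 1 <= (4 * k) `^ t.
  rewrite -[leLHS](powRr0 (4 * k)); apply: ler_powR => //; rewrite /t; lra.
have h2 : s0 * k <= 2 * (4 * k) `^ t.
  by have : s0 * k <= s * k; [rewrite ler_wpM2r|lra].
have e : 4 * k = (4 * k) `^ t * (4 * k) `^ (1 - t).
  rewrite -powRD ?(gt_eqF kp) ?implybT// (_ : t + (1 - t) = 1) ?powRr1//; lra.
have h3 : (4 * k) `^ (1 - t) <= 8 / s0.
  rewrite ler_pdivlMr//; have yp : 0 < (4 * k) `^ t by rewrite powR_gt0.
  rewrite -(ler_pM2l yp) mulrA -e; lra.
have h5 : 4 * k <= (8 / s0) `^ (1 - t)^-1.
  have -> : 4 * k = ((4 * k) `^ (1 - t)) `^ (1 - t)^-1.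
    by rewrite -powRrM divff ?gt_eqF// powRr1// ltW.
  by apply: powR_mono => //; rewrite ?powR_ge0// invr_ge0 ltW.
by move: Bk; rewrite /B; lra.
Qed.

(** The error [n.+1%:R^-1] lets one statement serve both maximizing sequences at a fixed multiplier
    and exact maximizers with varying multipliers. The last two clauses remember the side of
    [k0]. *)
Lemma maximizer_limit l p s0 s (sn : nat -> R) (f : nat -> R -> R) (k : nat -> R) :
  4 < p -> p < 6 -> 0 < s0 -> (forall n, s0 <= sn n) -> sn @ \oo --> s ->
  (forall n, adm l (f n) (k n)) ->
  (forall n g m, adm l g m ->
    Pp p g - sn n * m <= Pp p (f n) - sn n * k n + n.+1%:R^-1) ->
  exists F K, [/\ maximizer l p s F K, (forall c, (forall n, c <= k n) -> c <= K)
    & (forall c, (forall n, k n <= c) -> K <= c)].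
Proof.
move=> p4 p6 s00 ssn sns A H.
have [B B0 HB] := near_max_bound p4 p6 s00.
have kB n : k n <= B.
  apply: (HB _ _ _ _ (ssn n) (A n)).
  have := H n _ _ (adm0 l); rewrite Pp0 ?mulr0 ?subr0; last by rewrite gt_eqF//; lra.
  have : n.+1%:R^-1 <= 1 :> R by rewrite invf_le1// ler1n.
  by move: (n.+1%:R^-1) => e; lra.
have [F [K [h [hn AF kK PF]]]] := adm_compact p4 A kB.
exists F, K; split.
- split => // g m Ag.
  have sh := cvg_subseq hn sns.
  have e0 : (fun n => (h n).+1%:R^-1 : R) @ \oo --> 0.
    exact: (cvg_subseq hn (@cvg_harmonic R)).
  have lhs : (fun n => Pp p g - sn (h n) * m) @ \oo --> Pp p g - s * m.
    by apply: cvgB; [exact: cvg_cst|apply: cvgM; [exact: sh|exact: cvg_cst]].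
  have rhs : (fun n => Pp p (f (h n)) - sn (h n) * k (h n) + (h n).+1%:R^-1) @ \oo -->
      Pp p F - s * K + 0.
    by apply: cvgD; [apply: cvgB; [exact: PF|apply: cvgM; [exact: sh|exact: kK]]|].
  rewrite -[leRHS]addr0; apply: (ler_cvg_to lhs rhs).
  by apply: nearW => n; exact: H.
- by move=> c ck; apply: (ler_cvg_to (cvg_cst c) kK); apply: nearW => n; exact: ck.
- by move=> c ck; apply: (ler_cvg_to kK (cvg_cst c)); apply: nearW => n; exact: ck.
Qed.

Lemma maximizer_exists l p s : 4 < p -> p < 6 -> 0 < s ->
  exists f k, maximizer l p s f k.
Proof.
move=> p4 p6 s0.
have [B B0 HB] := near_max_bound p4 p6 s0.
pose V : set R := [set v | exists f k, adm l f k /\ v = Pp p f - s * k].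
have hV : has_sup V.
  split; first by exists (Pp p (cst 0) - s * 0), (cst 0), 0; split => //; exact: adm0.
  exists (1 + 4 * B) => _ [f [k [A ->]]].
  have [h|h] := leP (- 1) (Pp p f - s * k); last by lra.
  have kB := HB _ _ _ _ (lexx s) A h; have := Pp_lin p4 p6 A.
  have : 0 <= s * k by rewrite mulr_ge0 ?(ltW s0)// (adm_ge0 A).
  by lra.
have pick (n : nat) : exists fk : (R -> R) * R, adm l fk.1 fk.2 /\
    sup V - n.+1%:R^-1 < Pp p fk.1 - s * fk.2.
  have e0 : 0 < n.+1%:R^-1 :> R by rewrite invr_gt0.
  by have [_ [f [k [A ->]]] h] := sup_adherent e0 hV; exists (f, k).
have /choice[fk fkP] := pick.
have [||||F [K [M _ _]]] := @maximizer_limit l p s s (fun=> s) (fun n => (fk n).1) (fun n => (fk n).2) p4 p6 s0.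
- by [].
- exact: cvg_cst.
- by move=> n; case: (fkP n).
- move=> n g m Ag; have [_ h] := fkP n.
  have : Pp p g - s * m <= sup V by apply: sup_upper_bound => //; exists g, m.
  by move: h; move: (n.+1%:R^-1) => e; lra.
by exists F, K.
Qed.

Lemma maximizer_pos l p s f k : 4 < p -> p < 6 -> maximizer l p s f k ->
  0 < Pp p f - s * k.
Proof.
move=> p4 p6 [_ M]; have [g [m [Ag h]]] := spread_test l s p4 p6.
exact: (lt_le_trans h (M _ _ Ag)).
Qed.

Lemma two_maximizers l : 0 < l -> exists2 e0 : R, 0 < e0 &
  forall p, 6 - e0 < p -> p < 6 -> exists s f1 k1 f2 k2,
    [/\ 0 < s, maximizer l p s f1 k1, maximizer l p s f2 k2 & k1 < k2].
Proof.
move=> l0.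
have [k0 [e1 [k00 k04 e10 gap]]] := energy_gap l0.
have [e2 e20 test] := concentrated_test l0.
exists (Num.min 2 (Num.min e1 e2)); first by rewrite !lt_min e10 e20 !andbT.
move=> p pe p6.
have p4 : 4 < p by move: pe; rewrite /Num.min; do 2 case: ifP; lra.
have pe1 : 6 - e1 < p by move: pe; rewrite /Num.min; do 2 case: ifP; lra.
have pe2 : 6 - e2 < p by move: pe; rewrite /Num.min; do 2 case: ifP; lra.
have {}gap f : adm l f k0 -> Pp p f <= 23 / 20 * k0 by exact: gap.
have [ft [kt [At tP]]] := test p pe2 p6.
pose s1 : R := 23 / 20.
have s10 : 0 < s1 by rewrite /s1; lra.
pose S : set R := [set s | s1 <= s /\ exists f k, maximizer l p s f k /\ k0 <= k].
(* A positive value together with [Pp p f <= 1 + 4 * k] gives [s * k < 1 + 4 * k], and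
   [1 <= k0^-1 * k] above [k0]. *)
have Sub s : S s -> s <= 4 + k0^-1.
  move=> [ss [f [k [M kk]]]]; rewrite leNgt; apply/negP => sk.
  have h := maximizer_pos p4 p6 M; have [A _] := M; have := Pp_lin p4 p6 A.
  have : (4 + k0^-1) * k <= s * k by rewrite ler_wpM2r ?(ltW sk)// (adm_ge0 A).
  have : 1 <= k0^-1 * k by rewrite ler_pdivlMl// mulr1.
  by move: h; lra.
(* A maximizer below [k0] would have value at most [23 / 20 * k0], hence at most 23/80 as
   [k0 <= 4^-1]; the concentrated tent does better. *)
have S1 : S s1.
  split => //; have [f [k M]] := maximizer_exists l p4 p6 s10.
  exists f, k; split => //; rewrite leNgt; apply/negP => kk.
  have [A H] := M; have := H _ _ At; have := gap _ (adm_le A (ltW kk)).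
  have : 0 <= s1 * k by rewrite mulr_ge0 ?(ltW s10)// (adm_ge0 A).
  by rewrite /s1; lra.
have hS : has_sup S by split; [exists s1|exists (4 + k0^-1) => s /Sub].
pose s := sup S.
have ss : s1 <= s by exact: sup_upper_bound.
have nk0 f k : maximizer l p s f k -> k != k0.
  move=> M; apply/eqP => kk; have [A _] := M; rewrite kk in A M.
  have := maximizer_pos p4 p6 M; have := gap _ A.
  have : s1 * k0 <= s * k0 by rewrite ler_wpM2r// ltW.
  by rewrite /s1; lra.
have hi : exists f k, maximizer l p s f k /\ k0 <= k.
  have pick (n : nat) : exists x : R * ((R -> R) * R),
      [/\ s - n.+1%:R^-1 < x.1, x.1 <= s, s1 <= x.1, maximizer l p x.1 x.2.1 x.2.2 & k0 <= x.2.2].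
    have e0 : 0 < n.+1%:R^-1 :> R by rewrite invr_gt0.
    have [x Sx sx] := sup_adherent e0 hS; have [x1 [f [k [M kk]]]] := Sx.
    by exists (x, (f, k)); split => //=; exact: sup_upper_bound.
  have /choice[x xP] := pick.
  have [||||F [K [M lo _]]] := @maximizer_limit l p s1 s (fun n => (x n).1)
    (fun n => (x n).2.1) (fun n => (x n).2.2) p4 p6 s10.
  - by move=> n; case: (xP n).
  - apply/cvgrPdist_le => e e0; near=> n.
    have [h1 h2 _ _ _] := xP n; rewrite ger0_norm ?subr_ge0//.
    have : n.+1%:R^-1 < e :> R by near: n; exact: near_infty_natSinv_lt (PosNum e0).
    by move: h1; move: (n.+1%:R^-1) => a; lra.
  - by move=> n; case: (xP n) => _ _ _ [].
  - move=> n g m Ag; have [_ _ _ [_ H] _] := xP n.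
    by apply: (le_trans (H _ _ Ag)); rewrite lerDl invr_ge0.
  by exists F, K; split => //; apply: lo => n; case: (xP n).
(* The multipliers [s + n.+1%:R^-1] lie outside [S], so each of their maximizers, of which there is
   at least one, is below [k0]. *)
have lo : exists f k, maximizer l p s f k /\ k <= k0.
  have pick (n : nat) : exists x : (R -> R) * R,
      maximizer l p (s + n.+1%:R^-1) x.1 x.2 /\ x.2 < k0.
    have e0 : 0 < n.+1%:R^-1 :> R by rewrite invr_gt0.
    have s0 : 0 < s + n.+1%:R^-1 by rewrite addr_gt0// (lt_le_trans s10).
    have [f [k M]] := maximizer_exists l p4 p6 s0.
    exists (f, k); split => //=; rewrite ltNge; apply/negP => kk.
    have Sx : S (s + n.+1%:R^-1).
      by split; [rewrite (le_trans ss)// lerDl ltW|exists f, k].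
    by have := sup_upper_bound hS Sx; rewrite -/s leNgt ltrDl e0.
  have /choice[x xP] := pick.
  have [||||F [K [M _ hi']]] := @maximizer_limit l p s1 s (fun n => s + n.+1%:R^-1)
    (fun n => (x n).1) (fun n => (x n).2) p4 p6 s10.
  - by move=> n; rewrite (le_trans ss)// lerDl invr_ge0.
  - rewrite -[X in _ --> X]addr0; apply: cvgD; first exact: cvg_cst.
    exact: cvg_harmonic.
  - by move=> n; case: (xP n) => [] [].
  - move=> n g m Ag; have [[_ H] _] := xP n.
    by apply: (le_trans (H _ _ Ag)); rewrite lerDl invr_ge0.
  by exists F, K; split => //; apply: hi' => n; case: (xP n) => _ /ltW.
have [f2 [k2 [M2 k2k]]] := hi; have [f1 [k1 [M1 k1k]]] := lo.
exists s, f1, k1, f2, k2; split => //; first exact: lt_le_trans ss.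
have := nk0 _ _ M1; have := nk0 _ _ M2 => n2 n1.
apply: (@lt_trans _ _ k0); first by rewrite lt_neqAle n1.
by rewrite lt_neqAle eq_sym n2.
Unshelve. all: by end_near. Qed.

End maximizers.

(** * Mass and positivity of maximizers *)

Section positivity.
Context {R : realType}.
Notation mu := (@lebesgue_measure R).
Implicit Types (f g : R -> R) (l k p s B : R).

Lemma ge0_integrable (D : set R) g : measurable D -> measurable_fun D g ->
  (forall x, 0 <= g x) -> (\int[mu]_(x in D) (g x)%:E < +oo)%E ->
  mu.-integrable D (EFin \o g).
Proof.
move=> mD mg g0 gi; apply/integrableP; split; first exact/measurable_EFinP.
rewrite (_ : (\int[mu]_(x in D) `|(EFin \o g) x|)%E = (\int[mu]_(x in D) (g x)%:E)%E)//.
by apply: eq_integral => x _; rewrite gee0_abs// lee_fin.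
Qed.

Lemma adm_scale l f k (c : R) : adm l f k -> 0 <= c ->
  ((c ^+ 2)%:E * \int[mu]_(x in `[0%R, +oo[) (f x ^+ 2)%:E <= 1)%E ->
  adm l (fun x => c * f x) (c ^+ 2 * k).
Proof.
move=> [nf f0 f1 D] c0 h; split.
- by move=> x y xy; rewrite ler_wpM2l//; exact: nf.
- by move=> x; rewrite mulr_ge0.
- apply: le_trans h; rewrite -ge0_integralZl_EFin//=.
  + by under eq_integral do rewrite exprMn EFinM.
  + by move=> x _; rewrite lee_fin sqr_ge0.
  + by apply/measurable_EFinP; apply: noninc_meas => //; exact: sqr_noninc.
  + exact: sqr_ge0.
- exact: DleZ.
Qed.

Lemma PpZ l f k (c p : R) : adm l f k -> 2 < p -> 0 <= c ->
  Pp p (fun x => c * f x) = c `^ p * Pp p f.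
Proof.
move=> A p2 c0; have [nf f0 f1 D] := A; rewrite /Pp -RintegralZl//.
  by apply: eq_Rintegral => x _; rewrite powRM.
apply: ge0_integrable => //.
- by apply: noninc_meas => //; apply: (adm_noninc_powR A); lra.
- by move=> x; exact: powR_ge0.
- by rewrite (PpE A) ?ltry.
Qed.

(** If the mass were m < 1, multiplying f^2 by [t = 2 / (1 + m)] would keep it at most 1. The energy
    grows by the factor t > 1 and [Pp] by t^(p/2) >= t, so the positive value would increase. *)
Lemma maximizer_mass l p s f k : 4 < p -> p < 6 -> 0 < s -> maximizer l p s f k ->
  (\int[mu]_(x in `[0%R, +oo[) (f x ^+ 2)%:E = 1)%E.
Proof.
move=> p4 p6 s0 M; have J0 := maximizer_pos p4 p6 M; have [A H] := M.
have [nf f0 f1 D] := A.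
set I := (\int[mu]_(x in _) _)%E in f1 *.
have I0 : (0 <= I)%E by apply: integral_ge0 => x _; rewrite lee_fin sqr_ge0.
have [m Im] : exists m, I = m%:E.
  by exists (fine I); rewrite fineK// ge0_fin_numE// (le_lt_trans f1)// ltry.
rewrite Im in I0 f1 *; rewrite !lee_fin in I0 f1.
apply/eqP; rewrite eqe eq_le f1/= leNgt; apply/negP => m1.
pose t := 2 / (1 + m).
have t1 : 1 < t by rewrite ltr_pdivlMr; lra.
pose c := Num.sqrt t.
have c2 : c ^+ 2 = t by rewrite sqr_sqrtr//; lra.
have c0 : 0 <= c by rewrite sqrtr_ge0.
have Ac : adm l (fun x => c * f x) (c ^+ 2 * k).
  apply: (adm_scale A c0); rewrite -/I Im c2 -EFinM lee_fin /t.
  by rewrite mulrAC ler_pdivrMr; lra.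
have := H _ _ Ac; rewrite (PpZ A) ?c2//; last lra.
rewrite powR_half// c2.
have P0 := Pp_ge0 p f.
have k0 := adm_ge0 A.
have : t <= t `^ (p / 2).
  by rewrite -[leLHS]powRr1; [apply: ler_powR; lra|lra].
move: (t `^ _) => T tT.
have : s * (t * k) = t * (s * k) by ring.
move=> ->; move: J0; move: (s * k) => a J0.
by nra.
Qed.

(** [y] is taken within [H] of the supremum of the set where [f] is positive; clipping at 0 stays in
    that set because [f 0] is positive. *)
Lemma first_zero f : nonincreasing_fun f -> continuous f -> 0 < f 0 ->
  (exists x, f x <= 0) -> (forall x, 0 <= f x) ->
  forall H : R, 0 < H -> exists y, [/\ 0 <= y, 0 < f y & f (y + H) = 0].
Proof.
move=> nf cf f0 [x0 fx0] fge H H0.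
pose P : set R := [set x | 0 < f x].
have bP x : P x -> x <= x0.
  move=> /= fx; rewrite leNgt; apply/negP => xx.
  by have := le_lt_trans (le_trans (nf _ _ (ltW xx)) fx0) fx; rewrite ltxx.
have hP : has_sup P by split; [exists 0|exists x0 => x /bP].
have [y Py yP] := sup_adherent H0 hP.
exists (Num.max y 0); split; first by rewrite le_max lexx orbT.
  by rewrite /Num.max; case: ifP.
apply/le_anti; rewrite fge andbT leNgt; apply/negP => fy.
have : Num.max y 0 + H <= sup P by exact: sup_upper_bound.
have : y <= Num.max y 0 by rewrite le_max lexx.
by move: yP; lra.
Qed.

(** The part to the right of [y] becomes a linear ramp of length [L]. It is used with [d = f y],
    which makes the two pieces match. *)
Definition cut f (y d L x : R) := if x <= y then f x else tent d L (x - y).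

Lemma tent0 (d L : R) : 0 < L -> tent d L 0 = d.
Proof. by move=> L0; rewrite tent_in ?lexx ?ltW// mul0r subr0 mulr1. Qed.

Lemma cut_noninc f (y L : R) : nonincreasing_fun f -> 0 <= f y -> 0 < L ->
  nonincreasing_fun (cut f y (f y) L).
Proof.
move=> nf fy L0 a b ab; rewrite /cut; case: (leP b y) => by'; case: (leP a y) => ay.
- exact: nf.
- by move: (le_lt_trans (le_trans ab by') ay); rewrite ltxx.
- apply: (@le_trans _ _ (f y)); last exact: nf.
  rewrite -[leRHS](tent0 _ L0); apply: tent_noninc => //.
  by rewrite subr_ge0 ltW.
- by apply: tent_noninc => //; rewrite lerD2r.
Qed.

(** The fall of [f] from [f y] to 0 within length [H] costs at least [f y ^+ 2 / H], by the one-cell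
    partition; this is removed, and the ramp is charged with the largest weight 4. *)
Lemma cut_Dle l f k (y H L : R) : adm l f k -> 0 < H -> 0 < L -> f (y + H) = 0 ->
  Dle (wt l) (cut f y (f y) L) (k - f y ^+ 2 / H + 4 * (f y ^+ 2 / L)).
Proof.
move=> [nf f0 f1 D] H0 L0 fH z n nz.
apply: (le_trans (@psum_split _ (wt l) (cut f y (f y) L) z n y (@wt_ge0 R l) (@wt_homo R l) nz)).
apply: lerD; last first.
  apply: (@le_trans _ _ (4 * psum (wt L) (tent (f y) L) (fun i => Num.max (z i) y - y) n)).
    rewrite /psum mulr_sumr; apply: ler_sum => i _.
    have cE x : cut f y (f y) L (Num.max x y) = tent (f y) L (Num.max x y - y).
      rewrite /cut; case: leP => // h.
      have -> : Num.max x y = y by apply/le_anti; rewrite h le_max lexx orbT.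
      by rewrite subrr tent0.
    rewrite !cE opprB addrA subrK [leRHS]mulrA; apply: ler_pM => //.
    - exact: wt_ge0.
    - rewrite mulr_ge0 ?sqr_ge0// invr_ge0 subr_ge0.
      exact: (nd_max y nz (leqnSn i)).
    - by apply: (le_trans (wt_le4 _ _)); rewrite ler_peMr//; exact: wt_ge1.
  rewrite ler_pM2l//; rewrite -[leRHS]mul1r; apply: tent_Dle => //.
    by move=> x xL; rewrite /wt xL.
  by move=> i j ij; rewrite lerD2r; exact: (nd_max y nz ij).
rewrite (_ : psum _ _ _ _ = psum (wt l) f (fun i => Num.min (z i) y) n); last first.
  by apply: psum_ext => i; rewrite /cut ge_min lexx orbT.
rewrite lerBrDr.
pose w (i : nat) := if i is 0%N then y else y + H.
have nw : nondecreasing_seq w.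
  by apply/nondecreasing_seqP => -[|i] //=; rewrite lerDl ltW.
have h1 : f y ^+ 2 / H <= psum (wt l) f w 1.
  rewrite /psum big_ord1 /= fH sub0r sqrrN (addrC y) addrK.
  by rewrite ler_peMl ?wt_ge1// divr_ge0 ?sqr_ge0// ltW.
apply: (le_trans (lerD (lexx _) h1)).
have mi : Num.min (z n) y <= w 0%N by rewrite /= ge_min lexx orbT.
apply: (le_trans (@psum_cat _ (wt l) f n 1 _ w (@wt_ge0 R l) (nd_min y nz) nw mi)).
apply: D; exact: cat_seq_nd (nd_min y nz) nw mi.
Qed.

Lemma cut_sqr f (y L : R) : nonincreasing_fun f -> (forall x, 0 <= f x) ->
  (\int[mu]_(x in `[0%R, +oo[) (f x ^+ 2)%:E <= 1)%E -> 0 <= y -> 0 < L ->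
  (\int[mu]_(x in `[0%R, +oo[) (cut f y (f y) L x ^+ 2)%:E <= (1 + f y ^+ 2 * L)%:E)%E.
Proof.
move=> nf f0 f1 y0 L0.
have nc := cut_noninc nf (f0 y) L0.
have c0 x : 0 <= cut f y (f y) L x by rewrite /cut; case: ifP => // _; exact: tent_ge0.
have mc D : measurable D -> measurable_fun D (fun x => cut f y (f y) L x ^+ 2).
  by apply: noninc_meas; exact: sqr_noninc.
have mf D : measurable D -> measurable_fun D (fun x => f x ^+ 2).
  by apply: noninc_meas; exact: sqr_noninc.
rewrite (ge0_itvy_split y0); last 2 first.
- exact: mc.
- by move=> x _; exact: sqr_ge0.
rewrite EFinD; apply: leeD.
  apply: le_trans f1.
  have -> : (\int[mu]_(x in `[0%R, y[) (cut f y (f y) L x ^+ 2)%:E =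
      \int[mu]_(x in `[0%R, y[) (f x ^+ 2)%:E)%E.
    by apply: eq_integral => x; rewrite inE/= in_itv/= => /andP[_ /ltW xy]; rewrite /cut xy.
  apply: ge0_subset_integral => //=.
  - by apply/measurable_EFinP; exact: mf.
  - by move=> x _; rewrite lee_fin sqr_ge0.
  - by move=> x /=; rewrite !in_itv/= => /andP[->].
rewrite (@ge0_itvy_split _ _ y (y + L)); last 3 first.
- by rewrite lerDl ltW.
- exact: mc.
- by move=> x _; exact: sqr_ge0.
rewrite [X in (_ + X)%E](_ : _ = 0%E) ?adde0; last first.
  apply: integral0_eq => x /=; rewrite in_itv/= andbT => Lx.
  have yx : y < x by apply: lt_le_trans Lx; rewrite ltrDl.
  by rewrite /cut leNgt yx /= tent_out ?expr0n// lerBrDl.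
apply: (@le_trans _ _ (\int[mu]_(x in `[y, (y + L)%R[) (cst (f y ^+ 2)%:E x))%E).
  apply: ge0_le_integral => //=.
  - by move=> x _; rewrite lee_fin sqr_ge0.
  - by apply/measurable_EFinP; exact: mc.
  - move=> x; rewrite in_itv/= lee_fin => /andP[yx _].
    rewrite lerXn2r ?nnegrE//; have := nc _ _ yx.
    by rewrite {2}/cut lexx.
rewrite integral_cst//= lebesgue_measure_itv/= lte_fin ltrDl L0 -EFinB -EFinM.
by rewrite (addrC y) addrK.
Qed.

(** Origin of 128: at the midpoint [y + 64 * H] the ramp still has height [f y / 2], and 64 H
    (f(y)/2)^p >= H f(y)^p because 2^p <= 64. The right-hand side bounds the piece cut off. *)
Lemma cut_powR l f k (y H p : R) : adm l f k -> 4 < p -> p < 6 -> 0 <= y -> 0 < H ->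
  f (y + H) = 0 ->
  (\int[mu]_(x in `[0%R, +oo[) (f x `^ p)%:E <=
   \int[mu]_(x in `[0%R, +oo[) (cut f y (f y) (128 * H) x `^ p)%:E)%E.
Proof.
move=> A p4 p6 y0 H0 fH; have [nf f0 f1 D] := A.
have L0 : 0 < 128 * H by rewrite mulr_gt0 ?ltr0n.
have nc := cut_noninc nf (f0 y) L0.
have c0 x : 0 <= cut f y (f y) (128 * H) x.
  by rewrite /cut; case: ifP => // _; exact: tent_ge0.
have pn g : nonincreasing_fun g -> (forall x, 0 <= g x) -> nonincreasing_fun (fun x => g x `^ p).
  by move=> ng g0 a b ab; apply: powR_mono => //; [lra|exact: ng].
have mf g D' : nonincreasing_fun g -> (forall x, 0 <= g x) -> measurable D' ->
    measurable_fun D' (fun x => g x `^ p).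
  by move=> ng g0; apply: noninc_meas; exact: pn.
rewrite (ge0_itvy_split y0); last 2 first.
- exact: mf.
- by move=> x _; exact: powR_ge0.
rewrite [leRHS](ge0_itvy_split y0); last 2 first.
- exact: mf.
- by move=> x _; exact: powR_ge0.
apply: leeD.
  rewrite le_eqVlt; apply/orP; left; apply/eqP; apply: eq_integral => x.
  by rewrite inE/= in_itv/= => /andP[_ /ltW xy]; rewrite /cut xy.
apply: (@le_trans _ _ (H * f y `^ p)%:E).
  rewrite (@ge0_itvy_split _ _ y (y + H)); last 3 first.
  - by rewrite lerDl ltW.
  - exact: mf.
  - by move=> x _; exact: powR_ge0.
  rewrite [X in (_ + X)%E](_ : _ = 0%E) ?adde0; last first.
    apply: integral0_eq => x /=; rewrite in_itv/= andbT => Hx.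
    have -> : f x = 0 by apply/le_anti; rewrite f0 andbT -fH; exact: nf.
    by rewrite powR0// gt_eqF//; lra.
  apply: (@le_trans _ _ (\int[mu]_(x in `[y, (y + H)%R[) (cst (f y `^ p)%:E x))%E).
    apply: ge0_le_integral => //=.
    - by move=> x _; rewrite lee_fin powR_ge0.
    - by apply/measurable_EFinP; exact: mf.
    - move=> x; rewrite in_itv/= lee_fin => /andP[yx _].
      by apply: powR_mono => //; [lra|exact: nf].
  rewrite integral_cst//= lebesgue_measure_itv/= lte_fin ltrDl H0 -EFinB -EFinM.
  by rewrite (addrC y) addrK mulrC.
have h64 : 0 <= 64 * H by rewrite mulr_ge0// ltW.
apply: le_trans (noninc_riemanny y 1 (pn _ nc c0) (fun x => powR_ge0 _ _) h64).
rewrite big_ord1 mul1r lee_fin.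
have -> : cut f y (f y) (128 * H) (y + 64 * H) = f y / 2.
  rewrite /cut leNgt ltrDl mulr_gt0//= (addrC y) addrK tent_in//; last first.
    by rewrite h64/=; lra.
  by congr (_ * _); field; rewrite gt_eqF.
rewrite powRM ?invr_ge0// powR_invl//.
have h2 : 2 `^ p <= 64 :> R.
  apply: (@le_trans _ _ (2 `^ 6%:R)); first by apply: ler_powR; lra.
  by rewrite powR_mulrn//; lra.
have p2 : 0 < 2 `^ p :> R by rewrite powR_gt0.
have -> : 64 * H * (f y `^ p / 2 `^ p) = H * f y `^ p * (64 / 2 `^ p) by ring.
rewrite ler_peMr ?mulr_ge0 ?powR_ge0 ?(ltW H0)//.
by rewrite ler_pdivlMr// mul1r.
Qed.

(** The tangent at 1 of the convex function m^(-2). The exponent in use is [q = 1 - p / 2], above -2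
    for [p < 6]. *)
Lemma invsq_ge (m q : R) : 1 <= m -> - 2%:R <= q -> 1 - 2 * (m - 1) <= m `^ q.
Proof.
move=> m1 q2; apply: (@le_trans _ _ (m `^ (- 2%:R))); last exact: ler_powR.
have m0 : 0 < m by lra.
rewrite powRN powR_mulrn ?(ltW m0)// -subr_ge0.
have -> : (m ^+ 2)^-1 - (1 - 2 * (m - 1)) = (m - 1) ^+ 2 * (2 * m + 1) / m ^+ 2.
  by field; rewrite gt_eqF.
by rewrite divr_ge0 ?sqr_ge0// mulr_ge0 ?sqr_ge0//; lra.
Qed.

(* If [f] vanished somewhere, replacing its last piece by a long linear ramp
   would save kinetic energy of order 1/H at a mass cost of order H. *)
Lemma maximizer_gt0 l p s f k : 4 < p -> p < 6 -> 0 < s -> maximizer l p s f k ->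
  forall x, 0 < f x.
Proof.
move=> p4 p6 s0 M; have J0 := maximizer_pos p4 p6 M; have [A Mx] := M.
have [nf f0 f1 D] := A; have k0 := adm_ge0 A.
have P0 : 0 < Pp p f.
  by apply: (lt_le_trans J0); rewrite gerBl mulr_ge0// ltW.
have ff0 : 0 < f 0.
  rewrite lt0r f0 andbT; apply/eqP => e.
  have := Pp_le A (_ : 2 < p); rewrite e powR0; last by rewrite gt_eqF//; lra.
  by move=> /(_ ltac:(lra)); rewrite leNgt P0.
move=> x; rewrite ltNge; apply/negP => fx.
(* This gives [H <= 1] and [768 * Pp p f * H < s], whereas the comparison will yield
   [s <= 768 * H * H * Pp p f]. Here 768 = 2 * 3 * 128: half of the saving is kept, the mass excess
   counts three times, and the ramp has length [128 * H]. *)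
pose H := s / (768 * Pp p f + s).
have den : 0 < 768 * Pp p f + s by rewrite addr_gt0 ?mulr_gt0 ?ltr0n.
have H0 : 0 < H by rewrite divr_gt0.
have H1 : H <= 1 by rewrite ler_pdivrMr// mul1r lerDr mulr_ge0 ?ler0n ?(ltW P0).
have HP : 768 * Pp p f * H < s.
  by rewrite /H mulrA ltr_pdivrMr// mulrC ltr_pM2l// ltrDl.
have [y [y0 fy fH]] := first_zero nf (Dle_continuous (@wt_ge1 R l) D) ff0 (ex_intro _ x fx) f0 H0.
pose L := 128 * H; have L0 : 0 < L by rewrite mulr_gt0 ?ltr0n.
pose d := f y ^+ 2; have d0 : 0 < d by rewrite exprn_gt0.
pose w := cut f y (f y) L; pose m := 1 + d * L.
have m1 : 1 <= m by rewrite lerDl mulr_ge0// ltW.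
have m0 : 0 < m by lra.
(* The ramp raises the mass to at most [m], and scaling by [c] brings it back to at most 1. *)
pose c := Num.sqrt m^-1.
have c2 : c ^+ 2 = m^-1 by rewrite sqr_sqrtr// invr_ge0 ltW.
have c0 : 0 <= c by rewrite sqrtr_ge0.
have w0 z : 0 <= w z by rewrite /w /cut; case: ifP => // _; exact: tent_ge0.
have nw : nonincreasing_fun w by exact: cut_noninc.
have wm := cut_sqr nf f0 f1 y0 L0.
(* The ramp uses up only 1/32 of the energy saved. *)
have kd : 4 * (d / L) <= d / H / 2.
  have -> : 4 * (d / L) = d / H / 32 by rewrite /L; field; rewrite gt_eqF.
  by have : 0 <= d / H; [rewrite divr_ge0// ltW|lra].
have Dw : Dle (wt l) w (k - d / H / 2).
  by apply: Dle_le (cut_Dle A H0 L0 fH) _; rewrite -/d; lra.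
pose g z := c * w z.
have Ag : adm l g (m^-1 * (k - d / H / 2)).
  split.
  - by move=> a b ab; rewrite ler_wpM2l//; exact: nw.
  - by move=> z; rewrite mulr_ge0.
  - rewrite (_ : (\int[mu]_(z in _) _)%E = (m^-1%:E * \int[mu]_(z in `[0%R, +oo[) (w z ^+ 2)%:E)%E).
      rewrite -[leRHS](_ : m^-1%:E * m%:E = 1)%E; last by rewrite -EFinM mulVf// gt_eqF.
      by rewrite lee_pmul2l// lte_fin invr_gt0.
    rewrite -ge0_integralZl_EFin//=.
    + by under eq_integral do rewrite exprMn c2 EFinM.
    + by move=> z _; rewrite lee_fin sqr_ge0.
    + by apply/measurable_EFinP; apply: noninc_meas => //; exact: sqr_noninc.
    + by rewrite invr_ge0 ltW.
  - by rewrite -c2; exact: DleZ.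
have Pg : Pp p g >= m^-1 `^ (p / 2) * Pp p f.
  rewrite -lee_fin -(PpE Ag); last lra.
  rewrite EFinM -(PpE A); last lra.
  apply: (le_trans (lee_wpmul2l _ (cut_powR A p4 p6 y0 H0 fH))).
    by rewrite lee_fin powR_ge0.
  rewrite -ge0_integralZl_EFin//=; last 3 first.
  - by move=> z _; rewrite lee_fin powR_ge0.
  - apply/measurable_EFinP; apply: noninc_meas => //.
    by move=> a b ab; apply: powR_mono; [lra|exact: w0|exact: nw].
  - exact: powR_ge0.
  rewrite le_eqVlt; apply/orP; left; apply/eqP; apply: eq_integral => z _.
  by rewrite /g powRM// (powR_half p c0) c2 EFinM.
have := Mx _ _ Ag => {}Mx.
have h1 : m * (m^-1 `^ (p / 2) * Pp p f) - s * (k - d / H / 2) <= m * (Pp p f - s * k).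
  have e1 : m * (Pp p g - s * (m^-1 * (k - d / H / 2))) = m * Pp p g - s * (k - d / H / 2).
    by field; rewrite !gt_eqF.
  apply: le_trans (ler_wpM2l (ltW m0) Mx); rewrite e1 lerB// ler_wpM2l//.
  exact: ltW.
have e2 : m * (m^-1 `^ (p / 2) * Pp p f) = m `^ (1 - p / 2) * Pp p f.
  rewrite powR_invl ?(ltW m0)// -powRN mulrA -{1}[m]powRr1 ?(ltW m0)//.
  by rewrite -powRD// (gt_eqF m0) implybT.
have h2 : 1 - 2 * (m - 1) <= m `^ (1 - p / 2) by apply: invsq_ge => //; lra.
have h3 : (1 - 2 * (m - 1)) * Pp p f <= m `^ (1 - p / 2) * Pp p f by rewrite ler_pM2r.
rewrite e2 in h1.
have h4 : s * (d / H / 2) <= 3 * (m - 1) * Pp p f.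
  have : 0 <= (m - 1) * (s * k) by rewrite mulr_ge0 ?mulr_ge0 ?(ltW s0)//; lra.
  by move: h1 h3; move: (m `^ _) => T; nra.
have h5 : s * (d / H / 2) <= 384 * d * H * Pp p f.
  by apply: (le_trans h4); rewrite /m /L le_eqVlt; apply/orP; left; apply/eqP; ring.
have h6 : s <= 768 * H * H * Pp p f.
  have dH : 0 < d / H / 2 by rewrite !divr_gt0.
  rewrite -(ler_pM2r dH); apply: (le_trans h5); rewrite le_eqVlt; apply/orP; left; apply/eqP.
  by field; rewrite gt_eqF.
have h7 : 768 * H * H * Pp p f <= 768 * Pp p f * H.
  have -> : 768 * H * H * Pp p f = (768 * Pp p f * H) * H by ring.
  apply: ler_piMr H1; apply: mulr_ge0 (ltW H0); apply: mulr_ge0 (ltW P0).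
  exact: ler0n.
by move: (le_lt_trans (le_trans h6 h7) HP); rewrite ltxx.
Qed.

End positivity.

(** * Integration by parts for L^1 derivatives *)

Section weak_derivative.
Context {R : realType}.
Notation mu := (@lebesgue_measure R).
Implicit Types (f g h phi psi u v : R -> R) (a b c x y : R).

Definition prim a g x : R := \int[mu]_(t in `[a, x]) g t.

Lemma integrable_mul (D : set R) g h (M : R) : measurable D ->
  mu.-integrable D (EFin \o g) -> measurable_fun D h ->
  (forall x, D x -> `|h x| <= M) -> mu.-integrable D (EFin \o (fun x => g x * h x)).
Proof.
move=> mD ig mh hM.
have -> : EFin \o (fun x => g x * h x) = ((EFin \o h) \* (EFin \o g))%E.
  by apply/funext => x /=; rewrite -EFinM mulrC.
apply: integrableMr => //; exists M; split; first exact: num_real.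
by move=> z Mz x Dx /=; rewrite (le_trans (hM _ Dx))// ltW.
Qed.

Lemma Rintegral_mul_le (D : set R) g h (M : R) : measurable D ->
  mu.-integrable D (EFin \o g) -> measurable_fun D h ->
  (forall x, D x -> `|h x| <= M) ->
  `|\int[mu]_(x in D) (g x * h x)| <= M * \int[mu]_(x in D) `|g x|.
Proof.
move=> mD ig mh hM; have igh := integrable_mul mD ig mh hM.
have ign : mu.-integrable D (EFin \o (fun x => `|g x|)).
  exact: (integrable_norm ig).
apply: (le_trans (@le_normr_Rintegral _ _ R mu D _ mD igh)).
rewrite -RintegralZl//; apply: le_Rintegral => //.
- exact: (integrable_norm igh).
- have -> : EFin \o (fun x => M * `|g x|) = (fun x => M%:E * (`|g x|%R)%:E)%E.
    by apply/funext => x /=; rewrite EFinM.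
  exact: integrableZl.
- by move=> x Dx; rewrite normrM mulrC ler_wpM2r// hM.
Qed.

Lemma continuous_bounded f a b : a <= b -> {within `[a, b], continuous f} ->
  exists M : R, forall x, `[a, b]%classic x -> `|f x| <= M.
Proof.
move=> ab cf; have [|c _ H] := @EVT_max R (fun x => `|f x|) a b ab.
  by move=> x; apply: cvg_norm; exact: cf.
by exists `|f c|.
Qed.

Lemma continuous_meas f a b : {within `[a, b], continuous f} ->
  measurable_fun (`[a, b] : set R) f.
Proof. by move=> cf; apply: subspace_continuous_measurable_fun. Qed.

Lemma continuous_integrable f a b : {within `[a, b], continuous f} ->
  mu.-integrable `[a, b] (EFin \o f).
Proof. by move=> cf; apply: continuous_compact_integrable => //; exact: segment_compact. Qed.

Lemma integrable_subitv g a b c d : a <= c -> d <= b ->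
  mu.-integrable `[a, b] (EFin \o g) -> mu.-integrable `[c, d] (EFin \o g).
Proof.
move=> ac db; apply: integrableS => //; apply: subset_itv; by rewrite bnd_simp.
Qed.

Lemma prim_continuous g a b : a <= b -> mu.-integrable `[a, b] (EFin \o g) ->
  {within `[a, b], continuous (prim a g)}.
Proof. exact: parameterized_integral_continuous. Qed.

Lemma prim_le g a b x : mu.-integrable `[a, b] (EFin \o g) -> a <= x <= b ->
  `|prim a g x| <= \int[mu]_(t in `[a, b]) `|g t|.
Proof.
move=> ig /andP[ax xb].
have igx : mu.-integrable `[a, x] (EFin \o g) by exact: integrable_subitv ig.
have ign := integrable_norm ig.
apply: (le_trans (le_normr_Rintegral _ igx)) => //.
rewrite /Rintegral fine_le//.
- by apply: integrable_fin_num => //; exact: (integrable_norm igx).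
- exact: integrable_fin_num.
apply: ge0_subset_integral => //.
- by case/integrableP : ign.
- by apply: subset_itv; rewrite bnd_simp.
Qed.

Lemma prim_sub g h a b x : mu.-integrable `[a, b] (EFin \o g) ->
  mu.-integrable `[a, b] (EFin \o h) -> x <= b ->
  prim a (fun t => g t - h t) x = prim a g x - prim a h x.
Proof.
move=> ig ih xb; rewrite /prim RintegralB//.
  exact: integrable_subitv ig.
exact: integrable_subitv ih.
Qed.

Section by_parts.
Variables (a b : R) (phi : R -> R).
Hypotheses (ab : a < b) (dphi : forall x, derivable phi x 1)
  (cphi : continuous (derive1 phi)) (phia : phi a = 0) (phib : phi b = 0).

Let L g := \int[mu]_(x in `[a, b]) (prim a g x * derive1 phi x) +
  \int[mu]_(x in `[a, b]) (g x * phi x).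

Let phi_cont : continuous phi.
Proof.
by move=> x; apply: differentiable_continuous; apply/derivable1_diffP.
Qed.

Let w_cont f : continuous f -> {within `[a, b], continuous f}.
Proof. exact: continuous_subspaceT. Qed.

Let iprim g : mu.-integrable `[a, b] (EFin \o g) ->
  mu.-integrable `[a, b] (EFin \o (fun x => prim a g x * derive1 phi x)).
Proof.
move=> ig; apply: continuous_integrable => x.
by apply: cvgM; [exact: (prim_continuous (ltW ab) ig)|exact: w_cont].
Qed.

Let igphi g : mu.-integrable `[a, b] (EFin \o g) ->
  mu.-integrable `[a, b] (EFin \o (fun x => g x * phi x)).
Proof.
move=> ig; have [M HM] := continuous_bounded (ltW ab) (w_cont phi_cont).
by apply: (integrable_mul _ ig _ HM) => //; apply: continuous_meas; exact: w_cont.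
Qed.

Let L_cont g : continuous g -> L g = 0.
Proof.
move=> cg; have ig := continuous_integrable (w_cont cg).
have cp := prim_continuous (ltW ab) ig.
have dp x : x \in `]a, b[ -> derivable (prim a g) x 1 /\ derive1 (prim a g) x = g x.
  rewrite in_itv/= => /andP[ax xb].
  by apply: (@continuous_FTC1 _ _ (BLeft a) x b xb ig) => //; exact: cg.
have dab : derivable_oo_LRcontinuous (prim a g) a b.
  have [_ h1 h2] := (continuous_within_itvP _ ab).1 cp.
  split => //; by move=> x xab; have [] := dp _ xab.
have dphiab : derivable_oo_LRcontinuous phi a b.
  split; first by move=> x _.
    by apply: cvg_at_right_filter; exact: phi_cont.
  by apply: cvg_at_left_filter; exact: phi_cont.
have := @Rintegration_by_parts R (prim a g) phi g (derive1 phi) a b ab (w_cont cg) dab _ (w_cont cphi) dphiab _.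
rewrite phia phib !mulr0 subrr sub0r => H.
rewrite /L H ?addNr//; first by move=> x xab; have [] := dp _ xab.
Qed.

Let L_sub g h : mu.-integrable `[a, b] (EFin \o g) ->
  mu.-integrable `[a, b] (EFin \o h) -> L (fun t => g t - h t) = L g - L h.
Proof.
move=> ig ih; rewrite /L.
have -> : \int[mu]_(x in `[a, b]) (prim a (fun t => g t - h t) x * derive1 phi x) =
    \int[mu]_(x in `[a, b]) (prim a g x * derive1 phi x - prim a h x * derive1 phi x).
  apply: eq_Rintegral => x; rewrite inE/= in_itv/= => /andP[_ xb].
  by rewrite (prim_sub ig ih xb) mulrBl.
have -> : \int[mu]_(x in `[a, b]) ((g x - h x) * phi x) =
    \int[mu]_(x in `[a, b]) (g x * phi x - h x * phi x).
  by apply: eq_Rintegral => x _; rewrite mulrBl.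
rewrite !RintegralB//; [ring|exact: igphi|exact: igphi|exact: iprim|exact: iprim].
Qed.

Let L_bound : exists C, forall g, mu.-integrable `[a, b] (EFin \o g) ->
  `|L g| <= C * \int[mu]_(x in `[a, b]) `|g x|.
Proof.
have [M HM] := continuous_bounded (ltW ab) (w_cont phi_cont).
have [N HN] := continuous_bounded (ltW ab) (w_cont cphi).
exists (N * (b - a) + M) => g ig; rewrite mulrDl; apply: (le_trans (ler_normD _ _)).
apply: lerD; last first.
  by apply: Rintegral_mul_le => //; apply: continuous_meas; exact: w_cont.
have ip := continuous_integrable (prim_continuous (ltW ab) ig).
have h1 : `|\int[mu]_(x in `[a, b]) (prim a g x * derive1 phi x)| <=
    N * \int[mu]_(x in `[a, b]) `|prim a g x|.
  by apply: Rintegral_mul_le => //; apply: continuous_meas; exact: w_cont.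
apply: (le_trans h1); rewrite -mulrA ler_wpM2l//.
  have := HN a; rewrite /= in_itv/= lexx ltW//= => /(_ isT).
  exact: le_trans.
apply: (@le_trans _ _ (\int[mu]_(x in `[a, b]) (cst (\int[mu]_(x in `[a, b]) `|g x|) x))).
  apply: le_Rintegral => //.
  - exact: (integrable_norm ip).
  - by apply: continuous_integrable; apply: w_cont; exact: cst_continuous.
  - by move=> x; rewrite /= in_itv/= => xab; exact: prim_le.
rewrite Rintegral_cst//= lebesgue_measure_itv/= lte_fin ab /= mulrC.
by [].
Qed.

(* Both sides are continuous in [g] for the L^1 norm, so continuous [g] suffice. *)
Lemma by_parts_L1 g : mu.-integrable `[a, b] (EFin \o g) ->
  \int[mu]_(x in `[a, b]) (prim a g x * derive1 phi x) =
  - \int[mu]_(x in `[a, b]) (g x * phi x).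
Proof.
move=> ig; apply/eqP; rewrite -addr_eq0; apply/eqP; rewrite -/(L g).
have [C HC] := L_bound.
have fm : (mu `[a, b] < +oo)%E by rewrite lebesgue_measure_itv/=; case: ifP; rewrite -?EFinB ltry.
have [gn [cgn ign gcvg]] := @approximation_continuous_integrable R `[a, b] g (measurable_itv _) fm ig.
have Lb n : `|L g| <= C * \int[mu]_(x in `[a, b]) `|g x - gn n x|.
  have -> : L g = L (fun t => g t - gn n t).
    by rewrite (L_sub ig (ign n)) (L_cont (cgn n)) subr0.
  apply: HC.
  have -> : EFin \o (fun t => g t - gn n t) = ((EFin \o g) \- (EFin \o gn n))%E.
    by apply/funext => x.
  exact: integrableB.
have c0 : (fun n => C * \int[mu]_(x in `[a, b]) `|g x - gn n x|) @ \oo --> C * 0.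
  apply: cvgM; first exact: cvg_cst.
  by move/fine_cvgP : gcvg => [].
rewrite mulr0 in c0.
apply/eqP; rewrite -normr_eq0 eq_le normr_ge0 andbT.
by apply: (ler_cvg_to (cvg_cst _) c0); exact: nearW.
Qed.

End by_parts.

Lemma Rintegral0_continuous h a b : {within `[a, b], continuous h} ->
  (forall x, a <= x <= b -> 0 <= h x) -> \int[mu]_(x in `[a, b]) h x = 0 ->
  forall x, a < x < b -> h x = 0.
Proof.
move=> ch h0 ih x /andP[ax xb].
have ab := lt_trans ax xb.
have ig := continuous_integrable ch.
apply/eqP; rewrite eq_le h0 ?andbT; last by rewrite (ltW ax) (ltW xb).
rewrite leNgt; apply/negP => hx.
have [co _ _] := (continuous_within_itvP _ ab).1 ch.
have cx : h @ x --> h x by apply: co; rewrite in_itv/= ax.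
have hx2 : 0 < h x / 2 by rewrite divr_gt0.
have hx1 : h x / 2 < h x by lra.
have [r /= r0 Hr] := cvgr_gt _ cx (h x / 2) hx1.
pose r' := Num.min (r / 2) (Num.min ((x - a) / 2) ((b - x) / 2)).
have r'0 : 0 < r' by rewrite !lt_min !divr_gt0//= ?subr_gt0.
have rr : r' < r by rewrite gt_min; apply/orP; left; lra.
have ra : r' < x - a by rewrite !gt_min; apply/orP; right; apply/orP; left; lra.
have rb : r' < b - x by rewrite !gt_min; apply/orP; right; apply/orP; right; lra.
have sub : `[x, x + r'] `<=` `[a, b].
  by move=> y; rewrite /= !in_itv/= => /andP[y1 y2]; apply/andP; split; lra.
have : (0 < \int[mu]_(y in `[a, b]) (h y)%:E)%E.
  apply: (@lt_le_trans _ _ (\int[mu]_(y in `[x, (x + r')%R]) (cst (h x / 2)%:E y))%E).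
    rewrite integral_cst//= lebesgue_measure_itv/= lte_fin ltrDl r'0 -EFinB -EFinM lte_fin.
    by rewrite mulr_gt0// (addrC x) addrK.
  apply: (@le_trans _ _ (\int[mu]_(y in `[x, (x + r')%R]) (h y)%:E)%E).
    apply: ge0_le_integral => //=.
    - by move=> y _; rewrite lee_fin ltW.
    - apply/measurable_EFinP; apply: measurable_funS (continuous_meas ch) => //.
    - move=> y; rewrite in_itv/= => /andP[y1 y2]; rewrite lee_fin; apply/ltW/Hr.
      by rewrite /= ltr_norml; lra.
  apply: ge0_subset_integral => //=.
  - by apply/measurable_EFinP; exact: continuous_meas.
have fin : (\int[mu]_(y in `[a, b]) (h y)%:E)%E \is a fin_num by exact: integrable_fin_num.
by move: ih; rewrite /Rintegral => ih; rewrite -(fineK fin) ih ltxx.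
Qed.

End weak_derivative.

(** * Weak and integral derivatives *)

Section weak_to_classical.
Context {R : realType}.
Notation mu := (@lebesgue_measure R).
Implicit Types (f g h phi psi u v : R -> R) (a b c x y : R).

(** The complement of [I] is open, so [phi] vanishes in a neighbourhood of [x], and its derivative
    with it. *)
Lemma C1c_out (I : set R) phi x : closed I -> C1c I phi -> ~ I x ->
  phi x = 0 /\ derive1 phi x = 0.
Proof.
move=> cI [_ _ _ sI] Ix.
have nI : \forall t \near x, phi t = 0.
  have : nbhs x (~` I) by apply: open_nbhs_nbhs; split => //; exact: closed_openC.
  apply: filterS => t It; apply/eqP; apply: contra_notT It => pt.
  by apply: (@interior_subset _ I t); apply: sI; apply: subset_closure.
split; first exact: (nbhs_singleton nI).
rewrite derive1E (near_eq_derive (g := cst 0))//.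
by rewrite derive_cst.
Qed.

Lemma C1c_sub (I J : set R) phi : I `<=` J -> C1c I phi -> C1c J phi.
Proof.
move=> IJ [d1 d2 d3 d4]; split => //; apply: subset_trans d4 _.
by move=> x; exact: filterS.
Qed.

Lemma Rintegral_out (D E : set R) f : D `<=` E -> (forall x, E x -> ~ D x -> f x = 0) ->
  \int[mu]_(x in E) f x = \int[mu]_(x in D) f x.
Proof.
move=> DE f0; rewrite Rintegral_mkcond [RHS]Rintegral_mkcond; congr Rintegral.
apply/funext => x; rewrite !patchE; case: ifPn => [|nE].
  rewrite inE => Ex; case: ifPn => //; rewrite notin_setE => nD; exact: f0.
by rewrite ifF//; apply/negP; rewrite inE => /DE Ex; move: nE; rewrite notin_setE.
Qed.

(* du Bois-Reymond: [psi = (w - c) * chi], with [c] making its mean zero, has a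
   compactly supported primitive; testing against it gives int (w - c)^2 chi = 0. *)
Section bump.
Variables (a b d : R) (w : R -> R).
Hypotheses (ab : a < b) (d0 : 0 < d) (dab : a + d < b - d)
  (cw : {within `[a, b], continuous w}).

(** A truncated parabola, merely continuous: that suffices, because [phi] is C^1 as soon as [psi] is
    continuous. *)
Let chi (x : R) : R := Num.max 0 ((x - (a + d)) * ((b - d) - x)).
Let S : R := \int[mu]_(x in `[a, b]) chi x.
Let c : R := (\int[mu]_(x in `[a, b]) (w x * chi x)) / S.
Let psi (x : R) : R := (w x - c) * chi x.
Let phi x := \int[mu]_(t in `]-oo, x]) psi t.

Let chi_cont : continuous chi.
Proof.
move=> x; apply: (@continuous_max R R (fun=> 0) (fun x => (x - (a + d)) * (b - d - x)) x); first exact: cvg_cst.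
apply: cvgM.
  by apply: cvgB; [exact: cvg_id|exact: cvg_cst].
by apply: cvgB; [exact: cvg_cst|exact: cvg_id].
Qed.

Let chi_ge0 x : 0 <= chi x.
Proof. by rewrite le_max lexx. Qed.

Let chi_out x : x <= a + d \/ b - d <= x -> chi x = 0.
Proof.
move=> xx; apply/max_idPl; case: xx => xx.
  by rewrite mulr_le0_ge0//; (move: ab d0 dab => *; lra).
by rewrite mulr_ge0_le0//; (move: ab d0 dab => *; lra).
Qed.

Let chi_in x : a + d < x < b - d -> 0 < chi x.
Proof. by move=> /andP[x1 x2]; rewrite lt_max; apply/orP; right; rewrite mulr_gt0//; (move: ab d0 dab => *; lra). Qed.

Let chiw : {within `[a, b], continuous chi}.
Proof. exact: continuous_subspaceT. Qed.

Let S0 : 0 < S.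
Proof.
rewrite lt0r Rintegral_ge0 ?andbT//; apply/eqP => S00.
have := Rintegral0_continuous chiw (fun x _ => chi_ge0 x) S00.
move=> /(_ ((a + b) / 2)) H.
have := chi_in (x := (a + b) / 2); rewrite H ?ltxx; last by apply/andP; split; (move: ab d0 dab => *; lra).
by move=> /(_ _)/notF; apply; apply/andP; split; (move: ab d0 dab => *; lra).
Qed.

Let psi_cont : continuous psi.
Proof.
move=> x; have [xd|dx] := ltP x (a + d).
  have : \forall t \near x, psi t = 0.
    near=> t; rewrite /psi chi_out ?mulr0//; left; apply/ltW; near: t; exact: lt_nbhsl xd.
  by move=> n; rewrite /continuous_at (nbhs_singleton n); apply: cvg_near_cst.
have [bx|xb] := ltP (b - d) x.
  have : \forall t \near x, psi t = 0.
    near=> t; rewrite /psi chi_out ?mulr0//; right; apply/ltW; near: t; exact: lt_nbhsr bx.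
  by move=> n; rewrite /continuous_at (nbhs_singleton n); apply: cvg_near_cst.
apply: cvgM; last exact: chi_cont.
apply: cvgB; last exact: cvg_cst.
by apply: (within_continuous_continuous ab cw); rewrite in_itv/=; apply/andP; split; (move: ab d0 dab => *; lra).
Unshelve. all: by end_near. Qed.

Let psi_out x : x <= a + d \/ b - d <= x -> psi x = 0.
Proof. by move=> h; rewrite /psi chi_out// mulr0. Qed.

Let psi_outs x : ~ `[a, b]%classic x -> psi x = 0.
Proof.
rewrite /= in_itv/= => h; apply: psi_out.
have [|ax] := leP x (a + d); first by left.
by right; rewrite leNgt; apply/negP => xb; apply: h; apply/andP; split; (move: ab d0 dab => *; lra).
Qed.

Let ipsi (D : set R) : measurable D -> mu.-integrable D (EFin \o psi).
Proof.
move=> mD; apply: (@integrableS _ _ _ _ setT) => //.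
have -> : EFin \o psi = (EFin \o psi) \_ `[a, b].
  apply/funext => x; rewrite patchE; case: ifPn => //; rewrite notin_setE => h.
  by rewrite /= psi_outs.
rewrite -integrable_mkcond//; apply: continuous_integrable.
exact: continuous_subspaceT.
Qed.

Let iw : mu.-integrable `[a, b] (EFin \o (fun x => w x * chi x)).
Proof. by apply: continuous_integrable => x; apply: cvgM; [exact: cw|exact: chiw]. Qed.

Let psi_total : \int[mu]_(x in `[a, b]) psi x = 0.
Proof.
have -> : \int[mu]_(x in `[a, b]) psi x = \int[mu]_(x in `[a, b]) (w x * chi x - c * chi x).
  by apply: eq_Rintegral => x _; rewrite /psi mulrBl.
have ic : mu.-integrable `[a, b] (EFin \o chi) by exact: continuous_integrable.
rewrite RintegralB//; last first.
  by apply: continuous_integrable => x; apply: cvgM; [exact: cvg_cst|exact: chiw].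
by rewrite RintegralZl// -/S /c divfK ?subrr// gt_eqF.
Qed.

Let dphi x : derivable phi x 1 /\ derive1 phi x = psi x.
Proof.
apply: (@continuous_FTC1 _ _ -oo%O x (x + 1)); last exact: psi_cont.
- by rewrite ltrDl.
- exact: ipsi.
- by rewrite ltNyr.
Qed.

Let phi_out x : x <= a + d \/ b - d <= x -> phi x = 0.
Proof.
rewrite /phi; case=> [xa|bx].
  have -> : \int[mu]_(t in `]-oo, x]) psi t = \int[mu]_(t in `]-oo, x]) (0 : R).
    apply: eq_Rintegral => t; rewrite inE/= in_itv/= => tx.
    by apply: psi_out; left; exact: le_trans xa.
  by rewrite /Rintegral integral0.
rewrite -psi_total Rintegral_mkcond [RHS]Rintegral_mkcond; congr Rintegral.
apply/funext => t; rewrite !patchE.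
have [xt|tx] := ltP x t.
  rewrite ifF; last by apply/negP; rewrite inE/= in_itv/= leNgt xt.
  by case: ifP => // _; rewrite psi_out//; right; (move: ab d0 dab => *; lra).
rewrite ifT; last by rewrite inE/= in_itv.
by case: ifPn => //; rewrite notin_setE => /psi_outs.
Qed.

Let C1c_phi : C1c `[a, b] phi.
Proof.
have sub : closure [set x | phi x != 0] `<=` `[a + d, b - d].
  rewrite [X in _ `<=` X](closure_id _).1; last exact: itv_closed.
  apply: closure_subset => x /= px; rewrite in_itv/=; apply/andP; split.
    by rewrite leNgt; apply: contra px => h; rewrite phi_out//; left; exact: ltW.
  by rewrite leNgt; apply: contra px => h; rewrite phi_out//; right; exact: ltW.
split.
- by move=> x; case: (dphi x).
- have -> : derive1 phi = psi by apply: funext => x; case: (dphi x).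
  exact: psi_cont.
- apply: (subclosed_compact _ (@segment_compact _ (a + d) (b - d)) sub).
  exact: closed_closure.
- rewrite interior_itv => x /sub; rewrite /= !in_itv/= => /andP[x1 x2].
  by apply/andP; split; (move: ab d0 dab => *; lra).
Qed.

Lemma bump_const v g : mu.-integrable `[a, b] (EFin \o g) ->
  {within `[a, b], continuous v} ->
  (forall x, `[a, b]%classic x -> w x = v x - prim a g x) ->
  (forall phi, C1c `[a, b] phi ->
    \int[mu]_(x in `[a, b]) (v x * derive1 phi x) = - \int[mu]_(x in `[a, b]) (g x * phi x)) ->
  exists C, forall x, a + d < x < b - d -> w x = C.
Proof.
move=> ig cv wE H; exists c => x xd.
have dE : derive1 phi = psi by apply: funext => y; case: (dphi y).
have cpsi : {within `[a, b], continuous psi} by exact: continuous_subspaceT.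
have e1 : \int[mu]_(x in `[a, b]) (v x * psi x) = \int[mu]_(x in `[a, b]) (prim a g x * psi x).
  have := H _ C1c_phi; rewrite dE => ->; rewrite -dE; apply/esym.
  apply: by_parts_L1 => //.
  - by move=> y; case: (dphi y).
  - by rewrite dE.
  - by apply: phi_out; left; (move: ab d0 dab => *; lra).
  - by apply: phi_out; right; (move: ab d0 dab => *; lra).
(* This is the integral of [(w x - c) * psi x]: the part with [w] vanishes by [e1], the part with
   [c] because [psi] has mean zero. *)
have e2 : \int[mu]_(x in `[a, b]) ((w x - c) ^+ 2 * chi x) = 0.
  transitivity (\int[mu]_(x in `[a, b]) ((v x * psi x - prim a g x * psi x) - c * psi x)).
    apply: eq_Rintegral => y; rewrite inE => yab; rewrite -mulrBl -wE//.
    by rewrite /psi; ring.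
  have i1 : mu.-integrable `[a, b] (EFin \o (fun x => v x * psi x)).
    by apply: continuous_integrable => y; apply: cvgM; [exact: cv|exact: cpsi].
  have i2 : mu.-integrable `[a, b] (EFin \o (fun x => prim a g x * psi x)).
    apply: continuous_integrable => y; apply: cvgM; last exact: cpsi.
    exact: (prim_continuous (ltW ab) ig).
  have i3 : mu.-integrable `[a, b] (EFin \o (fun x => c * psi x)).
    by apply: continuous_integrable => y; apply: cvgM; [exact: cvg_cst|exact: cpsi].
  have i12 : mu.-integrable `[a, b] (EFin \o (fun x => v x * psi x - prim a g x * psi x)).
    exact: (@integrableB _ _ R mu _ (measurable_itv _) _ _ i1 i2).
  rewrite RintegralB// RintegralB// e1 subrr sub0r RintegralZl//; last exact: ipsi.
  by rewrite psi_total mulr0 oppr0.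
have cs : {within `[a, b], continuous (fun x => (w x - c) ^+ 2 * chi x)}.
  move=> y; apply: cvgM; last exact: chiw.
  have h : {within `[a, b], continuous (fun x => w x - c)}.
    by move=> z; apply: cvgB; [exact: cw|exact: cvg_cst].
  by apply: cvgM; exact: h.
have := Rintegral0_continuous cs (fun x _ => mulr_ge0 (sqr_ge0 _) (chi_ge0 x)) e2.
move=> /(_ x) => /(_ _)/eqP; rewrite mulf_eq0 sqrf_eq0 (gt_eqF (chi_in xd)) orbF subr_eq0.
by move=> h; apply/eqP/h; apply/andP; split; (case/andP: xd => ? ?; move: ab d0 dab => *; lra).
Qed.

End bump.

(** The difference of [v] and the primitive of [g] is constant in the interior by du Bois-Reymond,
    and one-sided continuity carries this to the end points. *)
Lemma weak_FTC v g a b : a < b -> {within `[a, b], continuous v} ->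
  mu.-integrable `[a, b] (EFin \o g) ->
  (forall phi, C1c `[a, b] phi ->
    \int[mu]_(x in `[a, b]) (v x * derive1 phi x) = - \int[mu]_(x in `[a, b]) (g x * phi x)) ->
  v b - v a = prim a g b.
Proof.
move=> ab cv ig H; pose w x := v x - prim a g x.
have cw : {within `[a, b], continuous w}.
  by move=> x; apply: cvgB; [exact: cv|exact: (prim_continuous (ltW ab) ig)].
have [_ wa wb] := (continuous_within_itvP _ ab).1 cw.
have const x y : a < x < b -> a < y < b -> w x = w y.
  move=> /andP[ax xb] /andP[ay yb].
  (* The margin is adapted to the pair, so that both points lie in the region where one application
     of [bump_const] gives a single constant. *)
  pose d := Num.min (Num.min ((x - a) / 2) ((b - x) / 2)) (Num.min ((y - a) / 2) ((b - y) / 2)).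
  have d0 : 0 < d by rewrite !lt_min; apply/andP; split; apply/andP; split; lra.
  have d1 : d <= (x - a) / 2 by rewrite /d !ge_min lexx.
  have d2 : d <= (b - x) / 2 by rewrite /d !ge_min lexx !orbT.
  have d3 : d <= (y - a) / 2 by rewrite /d !ge_min lexx !orbT.
  have d4 : d <= (b - y) / 2 by rewrite /d !ge_min lexx !orbT.
  have dab : a + d < b - d by lra.
  have [C HC] := bump_const ab d0 dab cw ig cv (fun _ _ => erefl) H.
  by rewrite !HC//; apply/andP; split; lra.
pose m := (a + b) / 2.
have mab : a < m < b by apply/andP; split; rewrite /m; lra.
have ea : w a = w m.
  have h : w x @[x --> a^'+] --> w m.
    apply: cvg_near_cst; near=> x; apply: const => //; apply/andP; split.
      by near: x; exact: nbhs_right_gt.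
    by near: x; exact: nbhs_right_lt.
  exact: (cvg_unique _ wa h).
have eb : w b = w m.
  have h : w x @[x --> b^'-] --> w m.
    apply: cvg_near_cst; near=> x; apply: const => //; apply/andP; split.
      by near: x; exact: nbhs_left_gt.
    by near: x; exact: nbhs_left_lt.
  exact: (cvg_unique _ wb h).
have p0 : prim a g a = 0 by rewrite /prim set_itv1 Rintegral_set1.
by have := etrans eb (esym ea); rewrite /w p0; lra.
Unshelve. all: by end_near. Qed.

(** The integral form of [g] being the derivative of [v]. It restricts to subintervals at once, and
    mediates between weak derivatives and pointwise arguments. *)
Definition has_prim (I : set R) v g := forall a b, a < b -> `[a, b] `<=` I ->
  mu.-integrable `[a, b] (EFin \o g) /\ v b - v a = prim a g b.

Lemma L2_integrable (I : set R) g a b : measurable I -> L2 I g -> `[a, b] `<=` I ->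
  mu.-integrable `[a, b] (EFin \o g).
Proof.
move=> mI [mg ig] sub.
have ig2 : mu.-integrable `[a, b] (fun x => (`|g x| ^+ 2)%:E) by apply: integrableS ig.
have i1 : mu.-integrable `[a, b] (fun x => 1%:E).
  by apply: (@continuous_integrable _ (cst 1)); exact: cst_continuous.
have isum := @integrableD _ _ R mu _ (measurable_itv _) _ _ i1 ig2.
apply: (le_integrable _ _ _ isum) => //.
  by apply/measurable_EFinP; exact: measurable_funS mg.
move=> x _ /=; rewrite lee_fin (ger0_norm (_ : 0 <= 1 + `|g x| ^+ 2)) ?addr_ge0// ?sqr_ge0//.
by move: (`|g x|) (normr_ge0 (g x)) => t t0; nra.
Qed.

Lemma H1_has_prim (I : set R) v g : measurable I -> {within I, continuous v} ->
  is_weak_deriv I v g -> has_prim I v g.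
Proof.
move=> mI cv [L2g H] a b ab sub.
have ig := L2_integrable mI L2g sub; split => //.
apply: weak_FTC => //; first exact: continuous_subspaceW cv.
move=> phi Cp; have CI := C1c_sub sub Cp.
have out := C1c_out (@itv_closed _ _ a b) Cp.
rewrite -(@Rintegral_out _ I)//; last by move=> x _ /out[_ ->]; rewrite mulr0.
rewrite -(@Rintegral_out `[a, b] I)//; last by move=> x _ /out[-> _]; rewrite mulr0.
exact: H.
Qed.

Lemma prim_split g a b x : mu.-integrable `[a, b] (EFin \o g) -> a <= x <= b ->
  prim a g b = prim a g x + prim x g b.
Proof.
move=> ig /andP[ax xb]; apply/eqP; rewrite addrC -subr_eq /prim Rintegral_itvB//.
apply/eqP; apply: Rintegral_itv_obnd_cbnd.
apply: integrableS ig => //; apply: subset_itv; by rewrite bnd_simp.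
Qed.

(** On the segment [v] is the constant [v a] plus a primitive of [g]. The constant drops out since
    [phi] vanishes at both ends, and the primitive is handled by [by_parts_L1]. *)
Lemma has_prim_weak (I : set R) v g a b : a < b -> L2 I g -> has_prim I v g ->
  `[a, b] `<=` I -> forall phi, C1c I phi -> phi a = 0 -> phi b = 0 ->
  (forall x, I x -> ~ `[a, b]%classic x -> phi x = 0 /\ derive1 phi x = 0) ->
  \int[mu]_(x in I) (v x * derive1 phi x) = - \int[mu]_(x in I) (g x * phi x).
Proof.
move=> ab L2g hp sub phi [d1 d2 _ _] pa pb out.
have [ig _] := hp _ _ ab sub.
rewrite (@Rintegral_out `[a, b] I)//; last by move=> x Ix /out - /(_ Ix)[_ ->]; rewrite mulr0.
rewrite (@Rintegral_out `[a, b] I)//; last by move=> x Ix /out - /(_ Ix)[-> _]; rewrite mulr0.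
rewrite -(by_parts_L1 ab d1 d2 pa pb ig).
have cd : {within `[a, b], continuous (derive1 phi)} by exact: continuous_subspaceT.
have ip : mu.-integrable `[a, b] (EFin \o (fun x => prim a g x * derive1 phi x)).
  apply: continuous_integrable => x; apply: cvgM; last exact: cd.
  exact: (prim_continuous (ltW ab) ig).
have id : mu.-integrable `[a, b] (EFin \o derive1 phi) by exact: continuous_integrable.
have iv : mu.-integrable `[a, b] (EFin \o (fun x => v a * derive1 phi x)).
  by apply: continuous_integrable => x; apply: cvgM; [exact: cvg_cst|exact: cd].
have -> : \int[mu]_(x in `[a, b]) (v x * derive1 phi x) =
    \int[mu]_(x in `[a, b]) (v a * derive1 phi x + prim a g x * derive1 phi x).
  apply: eq_Rintegral => x; rewrite inE/= in_itv/= => /andP[ax xb]; rewrite -mulrDl.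
  congr (_ * _); move: ax; rewrite le_eqVlt => /predU1P[<-|ax].
    by rewrite /prim set_itv1 Rintegral_set1 addr0.
  have [|_ <-] := hp _ _ ax; last ring.
  by apply: subset_trans sub; apply: subset_itv; rewrite bnd_simp.
rewrite RintegralD// RintegralZl//.
have -> : \int[mu]_(x in `[a, b]) derive1 phi x = 0.
  have cp : continuous phi.
    by move=> x; apply: differentiable_continuous; apply/derivable1_diffP.
  rewrite /Rintegral (@continuous_FTC2 _ (derive1 phi) phi)//.
    by rewrite pa pb subee.
  split; first by move=> x _.
    by apply: cvg_at_right_filter; exact: cp.
  by apply: cvg_at_left_filter; exact: cp.
by rewrite mulr0 add0r.
Qed.

(** Lebesgue differentiation. Applied to the difference of two derivatives of one function, it shows
    that they agree almost everywhere. *)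
Lemma prim0_ae h b : 0 < b -> mu.-integrable `[0, b] (EFin \o h) ->
  (forall x, 0 < x <= b -> prim 0 h x = 0) ->
  {ae mu, forall x, 0 < x < b -> h x = 0}.
Proof.
move=> b0 ih H; pose f : R -> R := h \_ `[0, b].
have iT : mu.-integrable setT (EFin \o f).
  by rewrite /f -restrict_EFin -integrable_mkcond.
have lf : locally_integrable [set: R] f.
  exact: (integrable_locally (measurable_itv _) ih).
have iy y : mu.-integrable [set` Interval (BLeft 0) (BRight y)] (EFin \o f).
  exact: integrableS iT.
have F0 x : x < b -> \int[mu]_(t in [set` Interval (BLeft 0) (BRight x)]) f t = 0.
  move=> xb; have [x0|x0] := ltP 0 x.
    transitivity (prim 0 h x); last by apply: H; rewrite x0 ltW.
    apply: eq_Rintegral => t; rewrite inE/= in_itv/= => /andP[t0 tx].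
    by rewrite /f patchE mem_set//= in_itv/= t0 (le_trans tx)// ltW.
  move: x0; rewrite le_eqVlt => /predU1P[->|x0]; first by rewrite set_itv1 Rintegral_set1.
  by rewrite set_itv_ge ?Rintegral_set0// bnd_simp -ltNge.
have := FTC1 iy lf; apply: (@filterS _ _ (ae_filter_ringOfSetsType mu)) => x Hx /andP[x0 xb].
have x0' : (BLeft (0 : R) < BRight x)%O by rewrite bnd_simp ltW.
case: Hx => [|dx]; first by [].
rewrite {2}/f patchE mem_set; last by rewrite /= in_itv/= !ltW.
move=> <-; rewrite derive1E (near_eq_derive (g := cst 0)) ?derive_cst//.
near=> t; apply: F0; near: t; exact: lt_nbhsl.
Unshelve. all: by end_near. Qed.

End weak_to_classical.

(** * Square-integrable derivatives from bounded Dirichlet energy *)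

Section riesz.
Context {R : realType}.
Notation mu := (@lebesgue_measure R).
Implicit Types (f g u : R -> R) (a b c x y : R).

Lemma bounded_itv_integrable f (M a b : R) : measurable_fun setT f ->
  (forall x, `|f x| <= M) -> mu.-integrable `[a, b] (EFin \o f).
Proof.
move=> mf fM.
have -> : EFin \o f = EFin \o (fun x => cst 1 x * f x).
  by apply/funext => x /=; rewrite mul1r.
apply: (@integrable_mul _ _ _ _ M) => //.
  by apply: continuous_integrable; apply: continuous_subspaceT; exact: cst_continuous.
exact: measurable_funTS.
Qed.

Lemma step_integral f (M d : R) (C : nat -> R) n : 0 < d -> measurable_fun setT f ->
  (forall x, `|f x| <= M) ->
  (forall (i : nat) x, i%:R * d <= x < i.+1%:R * d -> f x = C i) ->
  \int[mu]_(x in `[0, n%:R * d]) f x = \sum_(i < n) d * C i.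
Proof.
move=> d0 mf fM fC.
have ii a b : mu.-integrable `[a, b] (EFin \o f) by exact: bounded_itv_integrable fM.
elim: n => [|n IH]; first by rewrite mul0r set_itv1 Rintegral_set1 big_ord0.
rewrite big_ord_recr/= -IH; apply/eqP; rewrite addrC -subr_eq; apply/eqP.
have nd : n%:R * d <= n.+1%:R * d by rewrite ler_pM2r// ler_nat.
have n0 : 0 <= n%:R * d by rewrite mulr_ge0// ltW.
rewrite Rintegral_itvB//.
have oo : mu.-integrable `]n%:R * d, n.+1%:R * d] (EFin \o f).
  by apply: integrableS (ii (n%:R * d) (n.+1%:R * d)) => //; apply: subset_itv; rewrite bnd_simp.
have co : mu.-integrable `[n%:R * d, n.+1%:R * d[ (EFin \o f).
  by apply: integrableS (ii (n%:R * d) (n.+1%:R * d)) => //; apply: subset_itv; rewrite bnd_simp.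
rewrite Rintegral_itv_obnd_cbnd// -Rintegral_itv_bndo_bndc//.
have -> : \int[mu]_(x in `[n%:R * d, n.+1%:R * d[) f x =
    \int[mu]_(x in `[n%:R * d, n.+1%:R * d[) (C n).
  by apply: eq_Rintegral => x; rewrite inE/= in_itv/=; exact: fC.
rewrite Rintegral_cst//= lebesgue_measure_itv/= lte_fin ltr_pM2r// ltr_nat ltnSn.
by rewrite -EFinB/= -mulrBl -natr1 addrAC subrr add0r mul1r mulrC.
Qed.

(** Nesting of dyadic cells: an index at the finer level determines the one at the coarser level by
    integer division. *)
Lemma truncn_div (y : R) d : 0 <= y -> Num.truncn y = (Num.truncn (2 ^+ d * y) %/ 2 ^ d)%N.
Proof.
move=> y0; have dd : 0 <= 2 ^+ d * y by rewrite mulr_ge0// exprn_ge0.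
apply/eqP; rewrite truncn_eq//; have := truncn_itv dd.
move: (Num.truncn _) => k /andP[k1 k2].
have d0 : (0 : R) < (2 ^ d)%:R by rewrite ltr0n expn_gt0.
rewrite -(ler_pM2l d0) -(ltr_pM2l d0) -!natrM.
have e : 2 ^+ d = (2 ^ d)%:R :> R by rewrite natrX.
rewrite e in k1 k2; apply/andP; split.
  by apply: le_trans k1; rewrite ler_nat mulnC leq_divM.
by apply: (lt_le_trans k2); rewrite ler_nat mulnC ltn_ceil// expn_gt0.
Qed.

(** * Dyadic slopes and their orthogonality *)

Section dyadic.
Variables (u : R -> R) (c : R).
Hypothesis uc : Dle (cst 1) u c.

Let slope n (i : nat) : R := (u (i.+1%:R / 2 ^+ n) - u (i%:R / 2 ^+ n)) * 2 ^+ n.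
Let g n (x : R) : R := slope n (Num.truncn (2 ^+ n * x)).
(** The energy at level [n] on [[0, N]]: a partition sum of [u] by [A_psum], and the squared L^2
    norm of [g n] by [g_sqr]. *)
Let A n N : R := \sum_(i < N * 2 ^ n) slope n i ^+ 2 / 2 ^+ n.

Let pow2 n : (0 : R) < 2 ^+ n. Proof. by rewrite exprn_gt0. Qed.

Let u_cont : continuous u.
Proof. by apply: (@Dle_continuous _ (cst 1) _ c) => // x; rewrite lexx. Qed.

Let grid_nd n : nondecreasing_seq (fun i : nat => i%:R / 2 ^+ n : R).
Proof. by move=> i j ij; rewrite ler_pM2r ?invr_gt0// ler_nat. Qed.

Let grid_step n (i : nat) : i.+1%:R / 2 ^+ n - i%:R / 2 ^+ n = 2 ^- n :> R.
Proof. by rewrite -mulrBl -(natr1 i) addrAC subrr add0r mul1r. Qed.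

Let A_psum n N : A n N = psum (cst 1) u (fun i => i%:R / 2 ^+ n) (N * 2 ^ n).
Proof.
apply: eq_bigr => i _; rewrite /= mul1r grid_step invrK.
by rewrite /slope exprMn -mulrA (expr2 (2 ^+ n)) mulfK// gt_eqF.
Qed.

Let A_le n N c' : Dle (cst 1) u c' -> A n N <= c'.
Proof. by move=> H; rewrite A_psum; apply: H; exact: grid_nd. Qed.

Let slope_bound n i : `|slope n i| <= 1 + 2 ^+ n * c.
Proof.
have : slope n i ^+ 2 / 2 ^+ n <= c.
  have nd : nondecreasing_seq (fun j : nat => (i + j)%:R / 2 ^+ n : R).
    by move=> j k jk; apply: grid_nd; rewrite leq_add2l.
  have := uc 1 nd; rewrite /psum big_ord1/= mul1r addn0 addn1 grid_step invrK.
  by rewrite /slope exprMn (expr2 (2 ^+ n)) mulrA mulfK// gt_eqF.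
rewrite ler_pdivrMr// mulrC => h.
have : `|slope n i| ^+ 2 <= 2 ^+ n * c by rewrite real_normK ?num_real.
by move: (`|_|) => t ht; have := sqr_ge0 (t - 1); nra.
Qed.

Let g_meas n : measurable_fun setT (g n).
Proof.
have mst : measurable_fun setT (fun x : R => (Num.truncn (2 ^+ n * x))%:R / 2 ^+ n : R).
  apply: nondecreasing_measurable => // x y xy; rewrite ler_pM2r ?invr_gt0// ler_nat.
  by apply: le_truncn; rewrite ler_pM2l.
have mu_ := continuous_measurable_fun u_cont.
have -> : g n = (fun x => (u ((Num.truncn (2 ^+ n * x))%:R / 2 ^+ n + 2 ^- n) -
    u ((Num.truncn (2 ^+ n * x))%:R / 2 ^+ n)) * 2 ^+ n).
  by apply/funext => x; rewrite /g /slope; congr ((u _ - u _) * _); move: (grid_step n (Num.truncn (2 ^+ n * x))); lra.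
apply: measurable_funM => //; apply: measurable_funB.
  apply: (measurableT_comp mu_); apply: measurable_funD => //.
exact: (measurableT_comp mu_).
Qed.

Let g_cell n (k : nat) x : k%:R * 2 ^- n <= x < k.+1%:R * 2 ^- n -> g n x = slope n k.
Proof.
move=> /andP[h1 h2]; rewrite /g (@truncn_def _ _ k)//.
by rewrite mulrC -ler_pdivrMr// -ltr_pdivlMr// h1 h2.
Qed.

Let g_cell_div n d (k : nat) x : k%:R * 2 ^- (n + d) <= x < k.+1%:R * 2 ^- (n + d) ->
  g n x = slope n (k %/ 2 ^ d).
Proof.
move=> h; have x0 : 0 <= x by case/andP: h => h _; apply: le_trans h; rewrite divr_ge0// exprn_ge0.
rewrite /g (@truncn_div _ d) ?mulr_ge0 ?exprn_ge0// mulrA -exprD addnC.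
rewrite (@truncn_def _ _ k)//; case/andP: h => h1 h2.
by rewrite mulrC -ler_pdivrMr// -ltr_pdivlMr// h1 h2.
Qed.

(** The martingale property: a coarse slope is the mean of the [2 ^ d] finer slopes inside its
    cell. *)
Let slope_tel n d i : \sum_(i * 2 ^ d <= k < i.+1 * 2 ^ d) slope (n + d) k = 2 ^+ d * slope n i.
Proof.
under eq_bigr do rewrite /slope.
rewrite -mulr_suml telescope_sumr ?leq_mul2r ?leqnSn ?orbT//.
have e j : (j * 2 ^ d)%:R / 2 ^+ (n + d) = j%:R / 2 ^+ n :> R.
  by rewrite natrM natrX exprD invfM mulrACA divff ?mulr1// gt_eqF.
rewrite !e /slope exprD; ring.
Qed.

Let sum_refine n d N (F : R -> R) :
  \sum_(i < N * 2 ^ n) F (slope n i) * 2 ^+ d = \sum_(k < N * 2 ^ (n + d)) F (slope n (k %/ 2 ^ d)).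
Proof.
rewrite -(big_mkord xpredT (fun i => F (slope n i) * 2 ^+ d)).
rewrite -(big_mkord xpredT (fun k => F (slope n (k %/ 2 ^ d)))) expnD mulnA [RHS]big_nat_mul.
apply: eq_bigr => i _.
transitivity (\sum_(i * 2 ^ d <= k < i.+1 * 2 ^ d) F (slope n i)).
  rewrite big_const_nat iter_addr_0 -mulnBl subSn// subnn mul1n -[RHS]mulr_natr natrX.
  by [].
apply: eq_big_nat => k /andP[k1 k2]; congr (F (slope n _)); apply/esym/eqP.
by rewrite eqn_leq -ltnS ltn_divLR ?expn_gt0// k2 leq_divRL ?expn_gt0.
Qed.

(** By the mean value property the cross terms add up to the coarse squares, so the expanded square
    collapses as in Pythagoras. *)
Let A_refine n d N :
  \sum_(k < N * 2 ^ (n + d)) (2 ^- (n + d)) * (slope (n + d) k - slope n (k %/ 2 ^ d)) ^+ 2 =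
  A (n + d) N - A n N.
Proof.
have cross : \sum_(k < N * 2 ^ (n + d)) slope (n + d) k * slope n (k %/ 2 ^ d) =
    \sum_(k < N * 2 ^ (n + d)) slope n (k %/ 2 ^ d) ^+ 2.
  rewrite -(sum_refine n d N (fun t => t ^+ 2)).
  rewrite -(big_mkord xpredT (fun i => slope n i ^+ 2 * 2 ^+ d)).
  rewrite -(big_mkord xpredT (fun k => slope (n + d) k * slope n (k %/ 2 ^ d))) expnD mulnA big_nat_mul.
  apply: eq_bigr => i _.
  transitivity (\sum_(i * 2 ^ d <= k < i.+1 * 2 ^ d) slope (n + d) k * slope n i).
    apply: eq_big_nat => k /andP[k1 k2]; congr (_ * slope n _); apply/eqP.
    by rewrite eqn_leq -ltnS ltn_divLR ?expn_gt0// k2 leq_divRL ?expn_gt0.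
  by rewrite -mulr_suml slope_tel; ring.
have eA : A n N = 2 ^- (n + d) * \sum_(k < N * 2 ^ (n + d)) slope n (k %/ 2 ^ d) ^+ 2.
  rewrite -(sum_refine n d N (fun t => t ^+ 2)) -mulr_suml /A -mulr_suml exprD.
  by field; rewrite !gt_eqF.
rewrite -mulr_sumr eA /A -mulr_suml.
have -> : \sum_(k < N * 2 ^ (n + d)) (slope (n + d) k - slope n (k %/ 2 ^ d)) ^+ 2 =
  \sum_(k < N * 2 ^ (n + d)) slope (n + d) k ^+ 2
  - 2 * \sum_(k < N * 2 ^ (n + d)) slope (n + d) k * slope n (k %/ 2 ^ d)
  + \sum_(k < N * 2 ^ (n + d)) slope n (k %/ 2 ^ d) ^+ 2.
  rewrite mulr_sumr -sumrB -big_split/=; apply: eq_bigr => k _; ring.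
rewrite cross; ring.
Qed.

Let A_homo n m N : (n <= m)%N -> A n N <= A m N.
Proof.
move=> /subnKC <-; rewrite -subr_ge0 -A_refine; apply: sumr_ge0 => k _.
by rewrite mulr_ge0 ?sqr_ge0// ltW// invr_gt0.
Qed.

Let A_homoN n N M : (N <= M)%N -> A n N <= A n M.
Proof.
move=> NM; rewrite /A -(subnKC (leq_mul NM (leqnn (2 ^ n)))).
rewrite big_split_ord/= lerDl; apply: sumr_ge0 => k _.
by rewrite mulr_ge0 ?sqr_ge0// ltW// invr_gt0.
Qed.

(** The gain between two levels is a sum of squares over cells, so a longer interval only adds to
    it. This makes the choice of levels in [fast] uniform in [N]. *)
Let A_diff_homo n m N M : (N <= M)%N -> (n <= m)%N -> A m N - A n N <= A m M - A n M.
Proof.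
move=> NM /subnKC <-; rewrite -!A_refine -(subnKC (leq_mul NM (leqnn (2 ^ (n + (m - n)))))).
rewrite big_split_ord/= lerDl; apply: sumr_ge0 => k _.
by rewrite mulr_ge0 ?sqr_ge0// ltW// invr_gt0.
Qed.

Let g_bound n x : `|g n x| <= 1 + 2 ^+ n * c. Proof. exact: slope_bound. Qed.

Let g_diff n m N : (n <= m)%N ->
  \int[mu]_(x in `[0, N%:R]) ((g m x - g n x) ^+ 2) = A m N - A n N.
Proof.
move=> /subnKC <-; move: (m - n)%N => d; rewrite -A_refine.
have -> : N%:R = (N * 2 ^ (n + d))%:R * 2 ^- (n + d) :> R.
  by rewrite natrM natrX mulfK// gt_eqF.
pose K := (2 + 2 ^+ (n + d) * c + 2 ^+ n * c).
apply: (@step_integral _ (K ^+ 2) _ (fun k => (slope (n + d) k - slope n (k %/ 2 ^ d)) ^+ 2)).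
- by rewrite invr_gt0.
- have m1 : measurable_fun setT (fun x => g (n + d) x - g n x) by exact: measurable_funB.
  exact: (measurable_funX 2 m1).
- move=> x; rewrite normrX lerXn2r// ?nnegrE//.
    rewrite /K; apply: le_trans (normr_ge0 (g (n + d) x)) _.
    have := g_bound (n + d) x; have := le_trans (normr_ge0 _) (g_bound n x); lra.
  apply: (le_trans (ler_normB _ _)); rewrite /K.
  have := g_bound (n + d) x; have := g_bound n x; lra.
- by move=> k x kx; rewrite (g_cell kx) (g_cell_div kx).
Qed.

Let g_sqr n N : \int[mu]_(x in `[0, N%:R]) (g n x ^+ 2) = A n N.
Proof.
have -> : N%:R = (N * 2 ^ n)%:R * 2 ^- n :> R by rewrite natrM natrX mulfK// gt_eqF.
rewrite (@step_integral _ ((1 + 2 ^+ n * c) ^+ 2) _ (fun k => slope n k ^+ 2)).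
- by apply: eq_bigr => i _; rewrite mulrC.
- by rewrite invr_gt0.
- exact: (measurable_funX 2 (g_meas n)).
- move=> x; rewrite normrX lerXn2r// ?nnegrE//; exact: le_trans (normr_ge0 _) (g_bound n x).
- by move=> k x kx; rewrite (g_cell kx).
Qed.

Let g_int n m (j : nat) : (n <= m)%N ->
  \int[mu]_(x in `[0, j%:R / 2 ^+ n]) g m x = u (j%:R / 2 ^+ n) - u 0.
Proof.
move=> /subnKC <-; move: (m - n)%N => d.
have e (i : nat) : i%:R / 2 ^+ n = (i * 2 ^ d)%:R * 2 ^- (n + d) :> R.
  by rewrite natrM natrX exprD invfM mulrACA divff ?mulr1// gt_eqF.
rewrite e (@step_integral _ (1 + 2 ^+ (n + d) * c) _ (slope (n + d))).
- rewrite -mulr_sumr.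
  transitivity (2 ^- (n + d) * (\sum_(0 <= k < j * 2 ^ d)
     (u (k.+1%:R / 2 ^+ (n + d)) - u (k%:R / 2 ^+ (n + d))) * 2 ^+ (n + d))).
    by rewrite big_mkord.
  by rewrite -mulr_suml telescope_sumr// mul0r mulrC mulfK// gt_eqF.
- by rewrite invr_gt0.
- exact: g_meas.
- exact: g_bound.
- exact: g_cell.
Qed.

(* The dyadic slopes [g n] form an L^2-bounded martingale: by orthogonality
   int (g m - g n)^2 = A m - A n, and the energies [A n] increase to their supremum. *)
Let fast : exists s : nat -> nat, (forall k, (k <= s k)%N /\ (s k <= s k.+1)%N) /\
  forall N k, \int[mu]_(x in `[0, N%:R]) ((g (s k.+1) x - g (s k) x) ^+ 2) <= 4 ^- k.
Proof.
pose Q := [set A p.1 p.2 | p in [set: nat * nat]].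
have hQ : has_sup Q.
  split; first by exists (A 0 0), (0%N, 0%N).
  by exists c => _ [p _ <-]; exact: A_le.
have ex k : exists p, sup Q - 4 ^- k < A p.1 p.2.
  have [|_ [p _ <-] hp] := @sup_adherent _ Q (4 ^- k) _ hQ.
    by rewrite invr_gt0 exprn_gt0.
  by exists p.
have [p hp] := choice ex.
(* A running sum of the near-optimal levels: it is nondecreasing and dominates both [k] and
   [(p k).1]. *)
pose s k := (\sum_(j < k.+1) (p j).1.+1)%N.
have sS k : (s k <= s k.+1)%N by rewrite {2}/s big_ord_recr/= leq_addr.
exists s; split.
  move=> k; split => //; rewrite /s.
  apply: (@leq_trans (\sum_(j < k.+1) 1)%N); first by rewrite sum1_card card_ord.
  by apply: leq_sum.
move=> N k; rewrite g_diff//.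
have ub n M : A n M <= sup Q by apply: sup_ubound; [case: hQ|exists (n, M)].
have sp : ((p k).1 <= s k)%N by rewrite /s big_ord_recr/= (leq_trans (leqnSn _))// leq_addl.
(* On [[0, M]] the energy at level [s k] is already within [4 ^- k] of the supremum; this bounds the
   gain there, hence also on [[0, N]]. *)
pose M := maxn N (p k).2.
have := A_diff_homo (leq_maxl N (p k).2) (sS k); rewrite -/M.
have := ub (s k.+1) M; have := A_homo M sp.
have := A_homoN (p k).1 (leq_maxr N (p k).2); rewrite -/M.
have := hp k; move: (4 ^- k) => e; lra.
Qed.

Lemma dyadic_limit : exists f : nat -> R -> R, [/\ forall k, measurable_fun setT (f k),
  forall k, exists M : R, forall x, `|f k x| <= M,
  forall N k c', Dle (cst 1) u c' -> \int[mu]_(x in `[0, N%:R]) (f k x ^+ 2) <= c',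
  forall N k, \int[mu]_(x in `[0, N%:R]) ((f k.+1 x - f k x) ^+ 2) <= 4 ^- k &
  forall n j m, (n <= m)%N ->
    \int[mu]_(x in `[0, j%:R / 2 ^+ n]) f m x = u (j%:R / 2 ^+ n) - u 0].
Proof.
have [s [s1 s2]] := fast; exists (fun k => g (s k)); split => //.
- by move=> k; exists (1 + 2 ^+ s k * c) => x; exact: g_bound.
- by move=> N k c' H; rewrite g_sqr; exact: A_le.
- by move=> n j m nm; apply: g_int; apply: leq_trans nm _; case: (s1 m).
Qed.

End dyadic.

(** * Almost everywhere limit of a fast Cauchy sequence in L^2 *)

Section fast_cauchy.
Variable f : nat -> R -> R.
Hypotheses (mf : forall k, measurable_fun setT (f k))
  (bf : forall k, exists M : R, forall x, `|f k x| <= M)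
  (df : forall N k, \int[mu]_(x in `[0, N%:R]) ((f k.+1 x - f k x) ^+ 2) <= 4 ^- k).

Let d k x : R := `|f k.+1 x - f k x|.

Let md k : measurable_fun setT (d k).
Proof.
have m1 : measurable_fun setT (fun x => f k.+1 x - f k x) by exact: measurable_funB.
exact: (measurableT_comp (@normr_measurable R setT) m1).
Qed.

Let bd k : exists M : R, forall x, `|d k x| <= M.
Proof.
have [M HM] := bf k; have [M' HM'] := bf k.+1; exists (M + M') => x.
rewrite /d normr_id; apply: (le_trans (ler_normB _ _)); rewrite addrC; exact: lerD.
Qed.

Let id N k : mu.-integrable `[0, N%:R] (EFin \o d k).
Proof. by have [M HM] := bd k; exact: bounded_itv_integrable HM. Qed.

(** In place of Cauchy-Schwarz, the pointwise bound [t <= 2 ^- k + 2 ^+ k * t ^+ 2] is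
    integrated. *)
Let d_int (N k : nat) : \int[mu]_(x in `[0, N%:R]) d k x <= N.+1%:R * 2 ^- k.
Proof.
have [M HM] := bd k.
have md2 : measurable_fun setT (fun x => d k x ^+ 2) := measurable_funX 2 (md k).
have id2 : mu.-integrable `[0, N%:R] (EFin \o (fun x => d k x ^+ 2)).
  apply: (@bounded_itv_integrable _ (M ^+ 2)) => // x.
  by rewrite normrX lerXn2r ?nnegrE//; exact: le_trans (normr_ge0 _) (HM x).
have id2' : mu.-integrable `[0, N%:R] (EFin \o (fun x => 2 ^+ k * d k x ^+ 2)).
  apply: (@bounded_itv_integrable _ (2 ^+ k * M ^+ 2)) => //.
    exact: (measurable_funM (@measurable_cst _ _ _ _ setT (2 ^+ k : R)) md2).
  move=> x; rewrite normrM ger0_norm ?exprn_ge0// ler_wpM2l ?exprn_ge0//.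
  by rewrite normrX lerXn2r ?nnegrE//; exact: le_trans (normr_ge0 _) (HM x).
have i1 : mu.-integrable `[0, N%:R] (EFin \o (cst (2 ^- k : R))).
  by apply: continuous_integrable; apply: continuous_subspaceT; exact: cst_continuous.
apply: (@le_trans _ _ (\int[mu]_(x in `[0, N%:R]) (cst (2 ^- k) x + 2 ^+ k * d k x ^+ 2))).
  apply: le_Rintegral => //.
    exact: (@integrableD _ _ R mu _ (measurable_itv _) _ _ i1 id2').
  move=> x _ /=; have : 0 <= d k x by exact: normr_ge0.
  have : 0 < (2 : R) ^+ k by rewrite exprn_gt0.
  have : (2 : R) ^+ k * 2 ^- k = 1 by rewrite divff// gt_eqF// exprn_gt0.
  move: (2 ^+ k) (2 ^- k) (d k x) => a b t ab a0 t0.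
  have b0 : 0 < b by rewrite -(pmulr_rgt0 _ a0) ab.
  have [bt|tb] := leP t b; first by rewrite -[leLHS]addr0 lerD// mulr_ge0 ?sqr_ge0// ltW.
  have : t <= a * t ^+ 2 by rewrite -[leLHS]mul1r -ab expr2 mulrA ler_wpM2r// ler_wpM2l// ltW.
  by lra.
rewrite RintegralD// RintegralZl// Rintegral_cst//.
have -> : fine (mu `[0, N%:R]) = N%:R.
  rewrite lebesgue_measure_itv/= lte_fin; case: ltP => [|]; first by rewrite -EFinB subr0.
  by rewrite lern0 => /eqP ->.
have -> : \int[mu]_(x in `[0, N%:R]) (d k x ^+ 2) = \int[mu]_(x in `[0, N%:R]) ((f k.+1 x - f k x) ^+ 2).
  by apply: eq_Rintegral => x _; rewrite /d real_normK ?num_real.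
rewrite -(natr1 N) mulrDl mul1r (mulrC N%:R) lerD2l.
apply: (@le_trans _ _ (2 ^+ k * 4 ^- k)); first by rewrite ler_wpM2l ?exprn_ge0.
have -> : (4 : R) = 2 * 2 by rewrite -natrM.
by rewrite exprMn invfM mulrA divff ?mul1r// gt_eqF// exprn_gt0.
Qed.

(** Where this sum is finite the sequence converges; added to [f 0%N] in absolute value, it also
    dominates every [f n]. *)
Let S x := (\sum_(k <oo) (d k x)%:E)%E.

Let mS : measurable_fun setT S.
Proof.
apply: ge0_emeasurable_sum => [k x _ _|k _]; first by rewrite lee_fin normr_ge0.
exact/measurable_EFinP.
Qed.

Let iS N : mu.-integrable `[0, N%:R] S.
Proof.
have S0 x : (0 <= S x)%E by apply: nneseries_ge0 => k _ _; rewrite lee_fin normr_ge0.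
apply/integrableP; split; first exact: measurable_funTS.
have -> : (\int[mu]_(x in `[0%R, N%:R]) `|S x| = \int[mu]_(x in `[0%R, N%:R]) S x)%E.
  by apply: eq_integral => x _; rewrite gee0_abs.
rewrite integral_nneseries//; last 2 first.
- by move=> k; apply/measurable_EFinP; exact: (measurable_funTS (md k)).
- by move=> k x _; rewrite lee_fin normr_ge0.
apply: (@le_lt_trans _ _ (N.+1%:R * 2)%:E); last exact: ltry.
apply: lime_le.
  apply: is_cvg_nneseries => k _ _; apply: integral_ge0 => x _; by rewrite lee_fin normr_ge0.
apply: nearW => n; apply: (@le_trans _ _ (N.+1%:R * (2 - 2 * 2 ^- n))%:E).
  elim: n => [|n IH]; first by rewrite big_geq// expr0 invr1 mulr1 subrr mulr0.
  rewrite big_nat_recr//=; apply: (le_trans (leeD IH (lexx _))).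
  have -> : (\int[mu]_(x in `[0%R, N%:R]) (d n x)%:E = (\int[mu]_(x in `[0%R, N%:R]) d n x)%:E)%E.
    by rewrite /Rintegral fineK//; exact: (@integrable_fin_num _ _ R mu _ (measurable_itv _) _ (id N n)).
  rewrite -EFinD lee_fin; apply: (le_trans (lerD (lexx _) (d_int N n))).
  rewrite -mulrDr ler_wpM2l// exprS invfM; move: (2 ^- n) => e; lra.
rewrite lee_fin ler_wpM2l// lerBlDr lerDl mulr_ge0// invr_ge0 exprn_ge0//.
Qed.

(** An upper limit is measurable without discarding a null set, and it is the true limit almost
    everywhere on each [[0, N]]. *)
Definition fast_lim x : R := fine (limn_esup (fun k => (f k x)%:E)).

Lemma fast_lim_meas : measurable_fun setT fast_lim.
Proof.
apply: (measurableT_comp (@fine_measurable R setT measurableT)).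
by apply: measurable_fun_limn_esup => k; exact/measurable_EFinP.
Qed.

Let partial_le n x : ((\sum_(0 <= k < n) d k x)%:E <= S x)%E.
Proof.
rewrite -sumEFin; apply: nneseries_lim_ge => k _ _; by rewrite lee_fin normr_ge0.
Qed.

Lemma fast_lim_ae (N : nat) : {ae mu, forall x, `[0, N%:R]%classic x -> f ^~ x @ \oo --> fast_lim x}.
Proof.
have := @integrable_ae _ _ R mu _ (measurable_itv _) _ (iS N).
apply: (@filterS _ _ (ae_filter_ringOfSetsType mu)) => x /[apply] Sx.
have c1 : cvgn [normed series (fun k => f k.+1 x - f k x)].
  apply: nondecreasing_is_cvgn.
    by apply: nondecreasing_series => n _ _; exact: normr_ge0.
  exists (fine (S x)) => _ [n _ <-]; rewrite /series/= -lee_fin fineK//; exact: partial_le.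
have c2 := normed_cvg c1.
have c3 : cvgn (f ^~ x).
  have -> : f ^~ x = (fun n => f 0%N x + series (fun k => f k.+1 x - f k x) n).
    apply/funext => n; rewrite /series/= telescope_sumr//; ring.
  exact: is_cvgD (is_cvg_cst _) c2.
have c4 : (fun k => (f k x)%:E) @ \oo --> (limn (f ^~ x))%:E by apply: cvg_EFin => //; exact: nearW.
by rewrite /fast_lim (cvg_limn_einf_sup c4).2.
Qed.

Lemma fast_lim_integral (N : nat) b : 0 <= b <= N%:R ->
  mu.-integrable `[0, b] (EFin \o fast_lim) /\
  (fun k => \int[mu]_(x in `[0, b]) f k x) @ \oo --> \int[mu]_(x in `[0, b]) fast_lim x.
Proof.
move=> /andP[b0 bN].
have sub : `[0, b] `<=` `[0, N%:R : R] by apply: subset_itv; rewrite bnd_simp.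
pose G x := (`|f 0%N x|%:E + S x)%E.
have if_ k : mu.-integrable `[0, b] (EFin \o f k).
  by have [M HM] := bf k; exact: bounded_itv_integrable HM.
have iG : mu.-integrable `[0, b] G.
  apply: (@integrableD _ _ R mu _ (measurable_itv _)); first exact: (integrable_norm (if_ 0%N)).
  exact: integrableS (iS N).
have [||||i1 _ c1] := @dominated_convergence _ _ R mu `[0, b] (measurable_itv _)
  (fun k => EFin \o f k) (EFin \o fast_lim) G _ _ _ iG.
- by move=> k; apply/measurable_EFinP; exact: (measurable_funTS (mf k)).
- by apply/measurable_EFinP; apply: measurable_funTS; exact: fast_lim_meas.
- have := fast_lim_ae N; apply: (@filterS _ _ (ae_filter_ringOfSetsType mu)) => x H xb.
  by apply: cvg_EFin; [exact: nearW|apply: H; exact: sub].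
- apply: aeW => x n _ /=; apply: (@le_trans _ _ (`|f 0%N x| + \sum_(0 <= k < n) d k x)%:E).
    rewrite lee_fin; have -> : f n x = f 0%N x + \sum_(0 <= k < n) (f k.+1 x - f k x).
      by rewrite telescope_sumr//; ring.
    by apply: (le_trans (ler_normD _ _)); rewrite lerD2l; exact: ler_norm_sum.
  by rewrite EFinD leeD2l// partial_le.
split => //; have i1' : (\int[mu]_(x in `[0%R, b]) (fast_lim x)%:E)%E \is a fin_num by exact: integrable_fin_num.
by rewrite -(fineK i1') in c1; move/fine_cvgP : c1 => [_].
Qed.

Lemma fast_lim_sqr (N : nat) c : (forall k, \int[mu]_(x in `[0, N%:R]) (f k x ^+ 2) <= c) ->
  (\int[mu]_(x in `[0%R, N%:R]) (fast_lim x ^+ 2)%:E <= c%:E)%E.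
Proof.
move=> Hc.
have if2 k : mu.-integrable `[0, N%:R] (EFin \o (fun x => f k x ^+ 2)).
  have [M HM] := bf k; apply: (@bounded_itv_integrable _ (M ^+ 2)); first exact: (measurable_funX 2 (mf k)).
  move=> x; by rewrite normrX lerXn2r ?nnegrE//; exact: le_trans (normr_ge0 _) (HM x).
have mf2 k : measurable_fun (`[0, N%:R] : set R) (fun x => (f k x ^+ 2)%:E).
  by case/integrableP : (if2 k).
have -> : (\int[mu]_(x in `[0%R, N%:R]) (fast_lim x ^+ 2)%:E =
    \int[mu]_(x in `[0%R, N%:R]) limn_einf (fun k => (f k x ^+ 2)%:E))%E.
  apply: ae_eq_integral => //.
  - apply/measurable_EFinP; apply: measurable_funTS; exact: (measurable_funX 2 fast_lim_meas).
  - have -> : (fun x => limn_einf (fun k => (f k x ^+ 2)%:E)) =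
        (fun x => - limn_esup (fun k => - (f k x ^+ 2)%:E))%E.
      by apply/funext => x; rewrite -[in RHS]limn_einfN; congr limn_einf; apply/funext => k /=; rewrite opprK.
    apply: measurableT_comp => //; apply: measurable_fun_limn_esup => k.
    by apply: measurableT_comp => //; exact: mf2.
  have := fast_lim_ae N; apply: (@filterS _ _ (ae_filter_ringOfSetsType mu)) => x H xN.
  have c2 : (fun k => (f k x ^+ 2)%:E) @ \oo --> (fast_lim x ^+ 2)%:E.
    apply: cvg_EFin; first exact: nearW.
    by rewrite expr2; under eq_fun do rewrite expr2; apply: cvgM; exact: H.
  by rewrite (cvg_limn_einf_sup c2).1.
apply: (le_trans (@fatou _ _ R mu `[0, N%:R] (measurable_itv _) (fun k x => (f k x ^+ 2)%:E) mf2 _)).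
  by move=> k x _; rewrite lee_fin sqr_ge0.
apply: (@le_trans _ _ (limn_einf (fun _ : nat => c%:E))).
  rewrite !limn_einf_lim; apply: lee_lim; [exact: is_cvg_einfs|exact: is_cvg_einfs|].
  apply: nearW => n; apply: (@le_trans _ _ (\int[mu]_(x in `[0%R, N%:R]) (f n x ^+ 2)%:E)%E).
    by apply: ereal_inf_lbound; exists n => //=.
  apply: le_ereal_inf_tmp => _ [k _ <-].
  have -> : (\int[mu]_(x in `[0%R, N%:R]) (f n x ^+ 2)%:E = (\int[mu]_(x in `[0%R, N%:R]) (f n x ^+ 2))%:E)%E.
    by rewrite /Rintegral fineK//; exact: (@integrable_fin_num _ _ R mu _ (measurable_itv _) _ (if2 n)).
  by rewrite lee_fin.
by rewrite (cvg_limn_einf_sup (cvg_cst _)).1.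
Qed.

End fast_cauchy.

(** Riesz's characterization of functions with square-integrable derivative. A single [g] obeys the
    norm bound for every [c]. *)
Lemma Dle_derivative u c0 : Dle (cst 1) u c0 -> exists g, [/\ measurable_fun setT g,
  forall b, 0 <= b -> mu.-integrable `[0, b] (EFin \o g) /\ u b - u 0 = prim 0 g b &
  forall c, Dle (cst 1) u c -> (\int[mu]_(x in `[0%R, +oo[) (g x ^+ 2)%:E <= c%:E)%E].
Proof.
move=> uc; have [f [mf bf Af df fi]] := dyadic_limit uc.
have u_cont : continuous u by apply: (@Dle_continuous _ (cst 1) _ c0) => // x; rewrite lexx.
exists (fast_lim f); split; first exact: fast_lim_meas.
- move=> b b0.
  pose N := (Num.truncn b).+1.
  have bN : b <= N%:R by rewrite ltW// truncnS_gt.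
  have [|ib _] := @fast_lim_integral f mf bf df N b; first by rewrite b0.
  split; first exact: ib.
  (* The largest dyadic point of level [n] not beyond [b]. The integral formula is exact at such
     points and reaches [b] by continuity of both sides. *)
  pose t n : R := (Num.truncn (2 ^+ n * b))%:R / 2 ^+ n.
  have p2 n : (0 : R) < 2 ^+ n by rewrite exprn_gt0.
  have tb n : 0 <= t n <= b /\ b <= t n + 2 ^- n.
    have := truncn_itv (mulr_ge0 (ltW (p2 n)) b0) => /andP[h1 h2]; split.
      have h0 : 0 <= t n by apply: divr_ge0; [exact: ler0n|exact: ltW (p2 n)].
      have h3 : t n <= b by rewrite /t ler_pdivrMr// [leRHS]mulrC; exact: h1.
      by rewrite h0 h3.
    rewrite /t -[X in _ + X]mul1r -mulrDl ler_pdivlMr// mulrC natr1; exact: ltW.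
  have eqt n : u (t n) - u 0 = prim 0 (fast_lim f) (t n).
    have [/andP[t0 tb'] _] := tb n.
    have [|_ c1] := @fast_lim_integral f mf bf df N (t n); first by rewrite t0 (le_trans tb').
    apply: (cvg_unique _ _ c1) => //.
    apply: cvg_near_cst; exists n => // m nm; exact: fi.
  have tcv : t @ \oo --> b.
    apply: (@squeeze_cvgr _ _ _ _ (fun n => b - 2 ^- n) (cst b)).
    - by apply: nearW => n; have [/andP[_ ->] h] := tb n; rewrite andbT lerBlDr.
    - rewrite -[X in _ --> X]subr0; apply: cvgB; first exact: cvg_cst.
      have -> : (fun n => 2 ^- n) = (fun n => (2^-1 : R) ^+ n) by apply/funext => n; rewrite exprVn.
      by apply: cvg_expr; rewrite ger0_norm ?invr_ge0//; lra.
    - exact: cvg_cst.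
  move: b0; rewrite le_eqVlt => /predU1P[<-|b_gt0]; first by rewrite subrr /prim set_itv1 Rintegral_set1.
  (* The larger interval makes [b] an interior point, where the primitive is continuous from both
     sides. *)
  have [|ib1 _] := @fast_lim_integral f mf bf df N.+1 (b + 1).
    by rewrite addr_ge0 ?(ltW b_gt0)//= -natr1 lerD2r.
  have bb1 : 0 < b + 1 by rewrite addr_gt0.
  have [H _ _] := (continuous_within_itvP _ bb1).1 (prim_continuous (ltW bb1) ib1).
  have cb : prim 0 (fast_lim f) x @[x --> b] --> prim 0 (fast_lim f) b.
    by apply: H; rewrite in_itv/= b_gt0/= ltrDl ltr01.
  have c1 := cvg_comp _ _ tcv cb.
  have c2 : (fun n => u (t n) - u 0) @ \oo --> u b - u 0.
    by apply: cvgB; [exact: (cvg_comp _ _ tcv (u_cont b))|exact: cvg_cst].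
  have e : (fun n => u (t n) - u 0) = prim 0 (fast_lim f) \o t.
    by apply/funext => n; rewrite /= eqt.
  by rewrite e in c2; exact: (cvg_unique _ c2 c1).
- move=> c Hc.
  have H N := fast_lim_sqr mf bf df (fun k => Af N k c Hc).
  rewrite ge0_integral_ereal_sup.
  - by apply: ge_ereal_sup => _ [n _ <-]; exact: H.
  - by move=> x; rewrite sqr_ge0.
  - exact: (measurable_funX 2 (fast_lim_meas mf)).
Qed.

End riesz.

(** * From profiles to H^1 *)

Section sobolev_of_energy.
Context {R : realType}.
Notation mu := (@lebesgue_measure R).
Implicit Types (f g u phi : R -> R) (a b c x y l : R).

(* What the interval [I] is used for: it starts at 0, test functions live on a
   segment [[0, b]], and up to two points it is exhausted by such segments. *)
Definition ray_like (I : set R) := [/\ measurable I, forall x, I x -> 0 <= x,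
  forall phi, C1c I phi -> exists b, [/\ 0 < b, `[0, b] `<=` I, phi 0 = 0, phi b = 0 &
    forall x, I x -> ~ `[0, b]%classic x -> phi x = 0 /\ derive1 phi x = 0] &
  exists (b : nat -> R) (e : R), (forall n, 0 < b n /\ `[0, b n] `<=` I) /\
    forall x, I x -> x != 0 -> x != e -> exists n, x < b n].

Lemma ray_like_segment l : 0 < l -> ray_like `[0, l].
Proof.
move=> l0; split.
- exact: measurable_itv.
- by move=> x; rewrite /= in_itv/= => /andP[].
- move=> phi Cp; exists l; split => //.
  + apply/eqP/negP => /negP p0; case: Cp => _ _ _ sI.
    have := sI 0 (@subset_closure _ [set x | phi x != 0] _ p0); rewrite interior_itv/= in_itv/= ltxx//.
  + apply/eqP/negP => /negP p0; case: Cp => _ _ _ sI.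
    have := sI l (@subset_closure _ [set x | phi x != 0] _ p0); rewrite interior_itv/= in_itv/= ltxx andbF//.
(* The exceptional point is the right end, which the strict inequality [x < l] misses. *)
- exists (fun=> l), l; split; first by move=> _; split.
  move=> x /itvP xl _ nl.
  by exists 0%N; rewrite lt_neqAle nl xl.
Qed.

Lemma ray_like_ray : ray_like `[0, +oo[.
Proof.
split.
- exact: measurable_itv.
- by move=> x; rewrite /= in_itv/= andbT.
- move=> phi Cp.
  have [_ _ cS sI] := Cp.
  have [M [_ HM]] := compact_bounded cS.
  pose b := Num.max 1 (M + 1).
  have b0 : 0 < b by rewrite lt_max ltr01.
  have nS x : b < x -> ~ closure [set x | phi x != 0] x.
    move=> bx Sx; have MM : M < M + 1 by rewrite ltrDl.
    have := HM _ MM _ Sx; apply/negP; rewrite -ltNge; apply: (lt_le_trans _ (ler_norm x)).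
    by apply: le_lt_trans bx; rewrite le_max lexx orbT.
  exists (b + 1); split => //.
  + by rewrite addr_gt0.
  + by move=> x; rewrite /= !in_itv/= andbT => /andP[].
  + apply/eqP/negP => /negP p0.
    have := sI 0 (@subset_closure _ [set x | phi x != 0] _ p0); rewrite interior_itv/= in_itv/= ltxx//.
  + by apply/eqP/negP => /negP p0; apply: (nS (b + 1)); [rewrite ltrDl|exact: subset_closure].
  + move=> x; rewrite /= !in_itv/= andbT => x0; rewrite x0/= => /negP; rewrite -ltNge => bx.
    have bx' : b < x by apply: lt_trans bx; rewrite ltrDl.
    have nx : \forall t \near x, phi t = 0.
      near=> t; apply/eqP/negP => /negP pt; apply: (nS t); last exact: subset_closure.
      by near: t; exact: lt_nbhsr.
    split; first exact: (nbhs_singleton nx).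
    by rewrite derive1E (near_eq_derive (g := cst 0))// derive_cst.
- exists (fun n => n.+1%:R), 0; split.
    by move=> n; split => // x; rewrite /= !in_itv/= andbT => /andP[].
  by move=> x _ _ _; exists (Num.truncn x); exact: truncnS_gt.
Unshelve. all: by end_near. Qed.

(** [weak_deriv] is an arbitrary choice, so its norm must be compared with that of the explicit [g]:
    both have [u] as primitive, hence agree almost everywhere on [I]. *)
Lemma Dle_H1 (I : set R) u c0 : ray_like I -> Dle (cst 1) u c0 -> L2 I u ->
  H1 I u /\ forall c, Dle (cst 1) u c ->
    \int[mu]_(x in I) (`|weak_deriv I u x| ^+ 2) <= c.
Proof.
move=> [mI I0 hI [b [e [hb he]]]] uc L2u.
have [g [mg pg gc]] := Dle_derivative uc.
have u_cont : continuous u by apply: (@Dle_continuous _ (cst 1) _ c0) => // x; rewrite lexx.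
have mg2 : measurable_fun setT (fun x => g x ^+ 2) := measurable_funX 2 mg.
have subI : I `<=` `[0, +oo[ by move=> x /I0; rewrite /= in_itv/= andbT.
have gI c : Dle (cst 1) u c -> (\int[mu]_(x in I) (g x ^+ 2)%:E <= c%:E)%E.
  move=> /gc; apply: le_trans; apply: ge0_subset_integral => //.
  - by apply/measurable_EFinP; exact: (measurable_funTS mg2).
  - by move=> x _; rewrite lee_fin sqr_ge0.
have L2g : L2 I g.
  split; first exact: measurable_funTS.
  have -> : (fun x => (`|g x| ^+ 2)%:E) = EFin \o (fun x => g x ^+ 2).
    by apply/funext => x /=; rewrite real_normK ?num_real.
  apply: ge0_integrable => //.
  - exact: (measurable_funTS mg2).
  - by move=> x; rewrite sqr_ge0.
  - by apply: le_lt_trans (gI _ uc) _; exact: ltry.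
have hp : has_prim I u g.
  move=> x y xy sub.
  have x0 : 0 <= x by apply/I0/sub; rewrite /= in_itv/= lexx ltW.
  have y0 : 0 <= y := le_trans x0 (ltW xy).
  have [iy ey] := pg _ y0; have [_ ex] := pg _ x0; split.
    by apply: integrableS iy => //; apply: subset_itv; rewrite bnd_simp.
  have := prim_split iy (x := x); rewrite x0 (ltW xy) => /(_ isT) h.
  by move: ey ex; rewrite h; move: (prim _ _ _) (prim _ _ _) => A B; lra.
have wg : is_weak_deriv I u g.
  split => // phi Cp; have [B [B0 sB p0 pB out]] := hI _ Cp.
  exact: (has_prim_weak B0 L2g hp sB Cp).
have HI : H1 I u by split => //; [exact: continuous_subspaceT|exists g].
split => // c /gI cg.
have [L2w ww] : is_weak_deriv I u (weak_deriv I u).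
  by rewrite /weak_deriv; apply: (@xgetPex _ (cst 0) [set g | is_weak_deriv I u g]); exists g.
set w := weak_deriv I u in L2w ww *.
have hw : has_prim I u w by apply: H1_has_prim => //; exact: continuous_subspaceT.
have aen n : {ae mu, forall x, 0 < x < b n -> w x - g x = 0}.
  have [bn sb] := hb n; have [iw _] := hw _ _ bn sb; have [ig _] := hp _ _ bn sb.
  apply: prim0_ae => //.
    exact: (@integrableB _ _ R mu _ (measurable_itv _) _ _ iw ig).
  move=> x /andP[x0 xb]; rewrite (prim_sub iw ig xb).
  have sx : `[0, x] `<=` I by apply: subset_trans sb; apply: subset_itv; rewrite bnd_simp.
  by have [_ <-] := hw _ _ x0 sx; have [_ <-] := hp _ _ x0 sx; rewrite subrr.
have ne (z : R) : {ae mu, forall x : R, x != z}.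
  exists [set z]; split => //; first by rewrite lebesgue_measure_set1.
  by move=> x /= /negP; rewrite negbK => /eqP.
have ae : ae_eq mu I (fun x => (`|w x| ^+ 2)%:E) (fun x => (g x ^+ 2)%:E).
  apply: (@filterS3 _ _ (ae_filter_ringOfSetsType mu) _ _ _ _ _ (ne 0) (ne e) (ae_foralln aen)).
  move=> x x0 xe H Ix; have [n xn] := he _ Ix x0 xe.
  have x_gt0 : 0 < x by rewrite lt_neqAle eq_sym x0 I0.
  have := H n; rewrite x_gt0 xn => /(_ isT); rewrite real_normK ?num_real// => h.
  by congr (_ ^+ 2)%:E; move: h; lra.
have mw : measurable_fun I (fun x => (`|w x| ^+ 2)%:E).
  by case: L2w => _ /integrableP[].
have e1 : (\int[mu]_(x in I) (`|w x| ^+ 2)%:E = \int[mu]_(x in I) (g x ^+ 2)%:E)%E.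
  apply: ae_eq_integral => //.
  by apply/measurable_EFinP; exact: (measurable_funTS mg2).
have fin : (\int[mu]_(x in I) (g x ^+ 2)%:E)%E \is a fin_num.
  rewrite ge0_fin_numE; first exact: le_lt_trans cg (ltry _).
  by apply: integral_ge0 => x _; rewrite lee_fin sqr_ge0.
by rewrite /Rintegral e1 -lee_fin fineK.
Qed.

End sobolev_of_energy.

(** * Crossings of level bands *)

Section crossings.
Context {R : realType}.
Notation mu := (@lebesgue_measure R).
Implicit Types (h g v : R -> R) (a b p q x y : R).

Definition cont_on a b h := forall x, a <= x <= b -> forall e, 0 < e ->
  exists2 d : R, 0 < d & forall y, a <= y <= b -> `|x - y| < d -> `|h x - h y| < e.

Lemma within_cont_on a b h : {within `[a, b], continuous h} -> cont_on a b h.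
Proof.
move=> /subspace_continuousP ch x xab e e0.
have Ix : `[a, b]%classic x by rewrite /= in_itv.
have := @cvgr_dist_lt _ _ _ _ _ _ _ (ch x Ix) e e0.
rewrite near_withinE => -[d /= d0 H]; exists d => // y yab xy.
by apply: H; rewrite //= in_itv.
Qed.

Lemma cont_onN a b h : cont_on a b h -> cont_on a b (fun x => - h x).
Proof.
move=> ch x xab e e0; have [d d0 H] := ch x xab e e0; exists d => // y yab xy.
by rewrite -opprD normrN; exact: H.
Qed.

Lemma cont_on_rev a b h : cont_on a b h -> cont_on (- b) (- a) (fun x => h (- x)).
Proof.
move=> ch x xab e e0; have [|d d0 H] := ch (- x) _ e e0; first by lra.
exists d => // y yab xy; apply: H; first by lra.
by rewrite -opprD normrN.
Qed.

(** The supremum of the points where [h] is at most [p]; continuity puts it into that set. *)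
Lemma last_below a b h p : a <= b -> cont_on a b h -> h a <= p -> p < h b ->
  exists s, [/\ a <= s < b, h s <= p & forall x, s < x <= b -> p < h x].
Proof.
move=> ab ch ha hb; pose S := [set x | a <= x <= b /\ h x <= p].
have Sa : S a by rewrite /S/= lexx ab.
have hS : has_sup S by split; [exists a|exists b => x [/andP[]]].
have sb : sup S <= b by apply: ge_sup; [exists a|move=> x [/andP[]]].
have sa : a <= sup S by exact: sup_ubound hS.2 _ Sa.
have hs : h (sup S) <= p.
  rewrite leNgt; apply/negP => hs.
  have e0 : 0 < h (sup S) - p by lra.
  have sab : a <= sup S <= b by rewrite sa sb.
  have [d d0 H] := ch _ sab _ e0.
  have [x [xab hx] xs] := sup_adherent d0 hS.
  have xS : x <= sup S by exact: sup_ubound hS.2 _ (conj xab hx).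
  have := H x xab; rewrite ger0_norm ?subr_ge0// => /(_ _).
  rewrite ltrBlDr -ltrBlDl xs => /(_ isT); rewrite ltr_norml => /andP[_]; lra.
exists (sup S); split => //.
  rewrite sa/= lt_neqAle sb andbT; apply: contraTneq hs => ->; by rewrite -ltNge.
move=> x /andP[sx xb]; rewrite ltNge; apply/negP => hx.
have : x <= sup S by apply: sup_ubound hS.2 _ _; split => //; rewrite xb (le_trans sa)// ltW.
by rewrite leNgt sx.
Qed.

(** [last_below] for the reflected function [- h (- x)]. *)
Lemma first_above a b h q : a <= b -> cont_on a b h -> h a < q -> q <= h b ->
  exists t, [/\ a < t <= b, q <= h t & forall x, a <= x < t -> h x < q].
Proof.
move=> ab ch ha hb.
have [|||s [sab hs Hs]] := last_below (a := - b) (b := - a) (p := - q) _ (cont_onN (cont_on_rev ch)).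
- by rewrite lerN2.
- by rewrite opprK lerN2.
- by rewrite opprK ltrN2.
exists (- s); split; first by lra.
  by rewrite -lerN2.
move=> x xs; have := Hs (- x); rewrite opprK ltrN2; apply; lra.
Qed.

(** From the last point at or below [p] to the first later one at or above [q], the values stay
    strictly inside the band. *)
Lemma crossing a b h p q : a <= b -> p < q -> cont_on a b h -> h a <= p -> q <= h b ->
  exists s t, [/\ a <= s, s < t, t <= b, h s <= p & q <= h t /\ forall x, s < x < t -> p < h x < q].
Proof.
move=> ab pq ch ha hb.
have [s [/andP[as_ sb] hs Hs]] := last_below ab ch ha (lt_le_trans pq hb).
have chs : cont_on s b h.
  move=> x xsb e e0; have [|d d0 H] := ch x _ e e0; first by lra.
  by exists d => // y ysb; apply: H; lra.
have [t [/andP[st tb] ht Ht]] := first_above (ltW sb) chs (le_lt_trans hs pq) hb.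
exists s, t; split => //; split => // x /andP[sx xt].
by rewrite Hs ?sx ?(le_trans (ltW xt))//= Ht// xt ltW.
Qed.

Lemma crossing_sym a b h p q : a <= b -> p < q -> cont_on a b h ->
  (h a <= p /\ q <= h b) \/ (h b <= p /\ q <= h a) ->
  exists s t, [/\ a <= s, s < t, t <= b, q - p <= `|h t - h s| & forall x, s < x < t -> p < h x < q].
Proof.
move=> ab pq ch [[ha hb]|[hb ha]].
  have [s [t [as_ st tb hs [ht H]]]] := crossing ab pq ch ha hb.
  by exists s, t; split => //; apply: le_trans (ler_norm _); lra.
have [|||s [t [as_ st tb hs [ht H]]]] := crossing (p := - q) (q := - p) ab _ (cont_onN ch).
- by rewrite ltrN2.
- by rewrite lerN2.
- by rewrite lerN2.
exists s, t; split => //; first by rewrite distrC; apply: le_trans (ler_norm _); lra.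
by move=> x /H; lra.
Qed.

Lemma prim_norm_le (E : set R) v g a b : measurable E -> has_prim E v g -> a < b -> `[a, b] `<=` E ->
  (`|v b - v a|%:E <= \int[mu]_(x in `]a, b[) `|g x|%:E)%E.
Proof.
move=> mE hp ab sub; have [ig ->] := hp _ _ ab sub.
have -> : (\int[mu]_(x in `]a, b[) `|g x|%:E = \int[mu]_(x in `[a, b]) `|g x|%:E)%E.
  apply/esym/integral_itv_bndoo; apply/measurable_EFinP; apply: measurableT_comp => //.
  case/integrableP : ig => /measurable_EFinP mg _; apply: measurable_funS mg => //.
  by apply: subset_itv; rewrite bnd_simp.
apply: (@le_trans _ _ (\int[mu]_(x in `[a, b]) `|g x|)%:E).
  by rewrite lee_fin; exact: le_normr_Rintegral.
have ign := integrable_norm ig.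
by rewrite /Rintegral fineK//; exact: (@integrable_fin_num _ _ R mu _ (measurable_itv _) _ ign).
Qed.

Definition clamp p q y : R := Num.min (Num.max y p) q.

Lemma clamp_lt p q x y : p < q -> clamp p q x < clamp p q y ->
  [/\ x <= clamp p q x, clamp p q y <= y, p <= clamp p q x & clamp p q y <= q].
Proof.
rewrite /clamp => pq.
case: (leP x p) => ?; case: (leP y p) => ?; case: (leP x q) => ?; case: (leP y q) => ?;
  case: (leP p q) => ? ?; split; lra.
Qed.

(** Clamping measures the part of the band traversed between [a] and [b], whatever the end values,
    and a traverse is paid for by [g] inside the band only. The band is half-open to be a difference
    of two superlevel sets. *)
Lemma clamp_cross (E : set R) v g a b p q : measurable E -> has_prim E v g ->
  {within E, continuous v} -> measurable_fun E g ->
  a <= b -> `[a, b] `<=` E -> p < q ->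
  (`|clamp p q `|v b| - clamp p q `|v a| |%:E <=
   \int[mu]_(x in `]a, b[ `&` [set x | (p < `|v x| <= q)%R]) `|g x|%:E)%E.
Proof.
move=> mE hp cv mg ab sub pq.
have ch : cont_on a b (fun x => `|v x|).
  apply: within_cont_on => x; apply: cvg_norm; exact: (continuous_subspaceW sub cv).
have [le_qp|] := leP (`|clamp p q `|v b| - clamp p q `|v a| |) 0.
  have -> : `|clamp p q `|v b| - clamp p q `|v a| | = 0 by apply/eqP; rewrite eq_le le_qp normr_ge0.
  by apply: integral_ge0 => x _; rewrite lee_fin.
rewrite normr_gt0 subr_eq0 => ne.
have mv : measurable_fun E v by exact: subspace_continuous_measurable_fun.
have mVE : measurable_fun E (fun x => `|v x|) by exact: measurableT_comp.
have mA : measurable (`]a, b[ `&` [set x | (p < `|v x| <= q)%R]).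
  have -> : `]a, b[ `&` [set x | (p < `|v x| <= q)%R] =
      `]a, b[ `&` (E `&` (fun x => `|v x|) @^-1` `]p, q]).
    apply/seteqP; split => x /=; rewrite !in_itv/=; last by move=> [xab [_ h]].
    by move=> [xab h]; split => //; split => //; apply: sub; rewrite /= in_itv/=; lra.
  by apply: measurableI => //; exact: mVE.
have AE : `]a, b[ `&` [set x | (p < `|v x| <= q)%R] `<=` E.
  by move=> x [xab _]; apply: sub; move: xab; rewrite /= !in_itv/=; lra.
have mgA : measurable_fun (`]a, b[ `&` [set x | (p < `|v x| <= q)%R]) (fun x => `|g x|%:E).
  by apply/measurable_EFinP; apply: measurableT_comp => //; exact: measurable_funS mg.
have key (P Q : R) : P < Q -> p <= P -> Q <= q ->
    (`|v a| <= P /\ Q <= `|v b|) \/ (`|v b| <= P /\ Q <= `|v a|) ->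
    ((Q - P)%:E <= \int[mu]_(x in `]a, b[ `&` [set x | (p < `|v x| <= q)%R]) `|g x|%:E)%E.
  move=> PQ pP Qq H.
  have [s [t [as_ st tb hst Hst]]] := crossing_sym ab PQ ch H.
  have sub' : `[s, t] `<=` E by apply: subset_trans sub; apply: subset_itv; rewrite bnd_simp.
  apply: (@le_trans _ _ `|v t - v s|%:E).
    by rewrite lee_fin (le_trans hst)// ler_dist_dist.
  apply: (le_trans (prim_norm_le mE hp st sub')).
  apply: ge0_subset_integral => //.
  move=> x /=; rewrite !in_itv/= => xst; split; first lra.
  by have := Hst _ xst; lra.
have [l1|l2] := ltP (clamp p q `|v a|) (clamp p q `|v b|).
  have [h1 h2 h3 h4] := clamp_lt pq l1.
  by rewrite gtr0_norm ?subr_gt0//; apply: key => //; left.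
have l3 : clamp p q `|v b| < clamp p q `|v a| by rewrite lt_neqAle ne.
have [h1 h2 h3 h4] := clamp_lt pq l3.
by rewrite distrC gtr0_norm ?subr_gt0//; apply: key => //; right.
Qed.

End crossings.

(** * Layer cake *)

Section layer_cake.
Context {R : realType}.
Notation mu := (@lebesgue_measure R).
Implicit Types (W F : R -> R) (q s t : R).

Let GR := measurableTypeR R.

Let under_graph W : measurable_fun setT W ->
  measurable [set p : GR * GR | (p.2 < W p.1)%R].
Proof.
move=> mW.
pose f21 (p : GR * GR) := (p.2 < W p.1)%R.
have mW1 : measurable_fun setT (fun p : GR * GR => W p.1).
  exact: (@measurableT_comp _ _ _ _ _ _ W _ fst mW measurable_fst).
have : measurable_fun setT f21 by exact: measurable_fun_ltr.
move=> /(_ measurableT [set true]); rewrite setTI => H.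
rewrite (_ : [set p | _] = f21 @^-1` [set true]); first exact: H.
by apply/seteqP; split => p.
Qed.

Lemma distribution_measurable W : measurable_fun setT W ->
  measurable_fun setT (fun s => mu [set x | s < W x]).
Proof.
move=> mW; have := @measurable_fun_ysection _ _ GR GR R mu _ (under_graph mW).
congr measurable_fun; apply/funext => s; congr (mu _); apply/seteqP; split => x.
  by rewrite /ysection/= inE.
by rewrite /ysection/= inE.
Qed.

(** Tonelli for the region under the graph of [W]. *)
Lemma layer_cake W : measurable_fun setT W -> (forall x, 0 <= W x) ->
  (\int[mu]_x (W x)%:E = \int[mu]_(s in `[0%R, +oo[) mu [set x | (s < W x)%R])%E.
Proof.
move=> mW W0.
transitivity (\int[mu]_x (\int[mu]_s (\1_`[0, W x[ s)%:E))%E.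
  apply: eq_integral => x _; transitivity (mu `[0, W x[); last by rewrite integral_indic// setIT.
  rewrite lebesgue_measure_itv/= lte_fin.
  case: ltP => [_|]; first by rewrite oppr0 adde0.
  by move=> Wx; congr EFin; apply/eqP; rewrite eq_le Wx W0.
transitivity (\int[mu]_s (\int[mu]_x (\1_`[0, W x[ s)%:E))%E.
  rewrite (fubini_tonelli (fun p : GR * GR => (\1_`[0, W p.1[ p.2)%:E))//=.
  apply/measurable_EFinP/measurable_indic => /=.
  rewrite [X in measurable X](_ : _ = (fun p : GR * GR => 0 <= p.2)%R @^-1` [set true] `&` [set p : GR * GR | (p.2 < W p.1)%R]).
    apply: measurableI; last exact: under_graph.
    have : measurable_fun setT (fun p : GR * GR => 0 <= p.2)%R by exact: measurable_fun_ler.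
    by move=> /(_ measurableT [set true]); rewrite setTI; exact.
  by apply/seteqP; split => p; rewrite /= in_itv/= => /andP.
rewrite [RHS]integral_mkcond; apply: eq_integral => s _; rewrite patchE.
have mset : measurable [set x : GR | s < W x].
  have : measurable_fun setT (fun x : GR => s < W x) by exact: measurable_fun_ltr.
  by move=> /(_ measurableT [set true]); rewrite setTI; exact.
have [s0|s0] := leP 0 s.
  rewrite mem_set/= ?in_itv/= ?s0//.
  transitivity (\int[mu]_x (\1_[set x : GR | s < W x] x)%:E)%E; last by rewrite integral_indic// setIT.
  apply: eq_integral => x _; congr EFin; rewrite !indicE; congr (nat_of_bool _)%:R.
  by apply/idP/idP; rewrite !inE/= in_itv/= s0.
rewrite memNset/= ?in_itv/= ?leNgt ?s0//; apply: integral0_eq => x _.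
by rewrite indicE memNset//= in_itv/= leNgt s0.
Qed.

Lemma powR_lt_inv q s t : 0 < q -> 0 <= s -> 0 <= t -> (s < t `^ q) = (s `^ q^-1 < t).
Proof.
move=> q0 s0 t0; have {1}-> : s = (s `^ q^-1) `^ q by rewrite -powRrM mulVf ?gt_eqF// powRr1.
have [h|h] := ltP (s `^ q^-1) t.
  by rewrite gt0_ltr_powR ?nnegrE ?powR_ge0.
by rewrite ltNge ge0_ler_powR ?nnegrE ?powR_ge0// ltW.
Qed.

(** Layer cake on both sides, the level [s] of the q-th power being the level [s] to the power
    [q^-1] of the function itself. *)
Lemma equimeas_powR (n : nat) (V : 'I_n -> R -> R) F q : 0 < q ->
  (forall i, measurable_fun setT (V i)) -> (forall i x, 0 <= V i x) ->
  measurable_fun setT F -> (forall x, 0 <= F x) ->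
  (forall t, 0 <= t -> (mu [set x | (t < F x)%R] = \sum_(i < n) mu [set x | (t < V i x)%R])%E) ->
  (\int[mu]_x (F x `^ q)%:E = \sum_(i < n) \int[mu]_x (V i x `^ q)%:E)%E.
Proof.
move=> q0 mV V0 mF F0 H.
have mp (W : R -> R) : measurable_fun setT W -> measurable_fun setT (fun x => W x `^ q).
  by move=> mW; exact: (measurableT_comp (measurable_powR q) mW).
rewrite layer_cake; [|exact: mp|by move=> x; exact: powR_ge0].
transitivity (\sum_(i < n) \int[mu]_(s in `[0%R, +oo[) mu [set x | (s < V i x `^ q)%R])%E; last first.
  apply: eq_bigr => i _; rewrite layer_cake//; [exact: mp|by move=> x; exact: powR_ge0].
rewrite -ge0_integral_sum//; last first.
  by move=> i; apply: measurable_funTS; apply: distribution_measurable; exact: mp.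
apply: eq_integral => s; rewrite inE/= in_itv/= andbT => s0.
have e (W : R -> R) : (forall x, 0 <= W x) -> [set x | s < W x `^ q] = [set x | s `^ q^-1 < W x].
  by move=> W0; apply/seteqP; split => x /=; rewrite powR_lt_inv.
by rewrite e// H ?powR_ge0//; apply: eq_bigr => i _; rewrite e.
Qed.

End layer_cake.

(** * Rearrangement *)

Section rearrangement.
Context {R : realType}.
Notation mu := (@lebesgue_measure R).
Implicit Types (p q s t y z : R).

Lemma measurable_gt (W : R -> R) t : measurable_fun setT W -> measurable [set x | t < W x].
Proof.
move=> mW; have : measurable_fun setT (fun x => t < W x) by exact: measurable_fun_ltr.
by move=> /(_ measurableT [set true]); rewrite setTI; exact.
Qed.

Lemma measurable_le (W : R -> R) t : measurable_fun setT W -> measurable [set x | W x <= t].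
Proof.
move=> mW; have : measurable_fun setT (fun x => W x <= t) by exact: measurable_fun_ler.
by move=> /(_ measurableT [set true]); rewrite setTI; exact.
Qed.

(** Lets [r] tend to [D]: the estimate on level bands reaches only drops [r] strictly smaller than
    the full one. *)
Lemma lim_sqr_le (W D X : R) : 0 < W -> 0 < D ->
  (forall r, 0 < r -> r < D -> W * r ^+ 2 <= X) -> W * D ^+ 2 <= X.
Proof.
move=> W0 D0 St; rewrite leNgt; apply/negP => h.
pose e := Num.min (D / 2) ((W * D ^+ 2 - X) / (4 * W * D)).
have WD : 0 < 4 * W * D by rewrite !mulr_gt0.
have e0 : 0 < e by rewrite lt_min !divr_gt0// subr_gt0.
have e1 : e <= D / 2 by rewrite ge_min lexx.
have e2 : e * (4 * W * D) <= W * D ^+ 2 - X by rewrite -ler_pdivlMr// ge_min lexx orbT.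
have eD : e < D by lra.
have := St (D - e); rewrite subr_gt0 gtrBl e0 eD => /(_ isT isT).
have : 0 <= W * e ^+ 2 by rewrite mulr_ge0 ?sqr_ge0// ltW.
by move: e2 h; nra.
Qed.

Let step_arith (X a b a' b' u : R) : 2 * X <= u + (a - b) -> u = X -> a <= a' -> b' <= b ->
  X <= a' - b'.
Proof. by lra. Qed.

Variables (V : 'I_3 -> R -> R) (B : R).
Hypotheses (mV : forall i, measurable_fun setT (V i)) (V0 : forall i x, 0 <= V i x)
  (VB : forall i x, V i x <= B)
  (V2 : forall i, (\int[mu]_x (V i x ^+ 2)%:E < +oo)%E).

Definition dist t : \bar R := (\sum_(i < 3) mu [set x | (t < V i x)%R])%E.

Lemma dist_homo s t : s <= t -> (dist t <= dist s)%E.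
Proof.
move=> st; apply: lee_sum => i _; apply: le_measure; rewrite ?inE; try exact: measurable_gt.
by move=> x /=; exact: le_lt_trans.
Qed.

(** Chebyshev's inequality. *)
Lemma level_fin i t : 0 < t -> (mu [set x | (t < V i x)%R] < +oo)%E.
Proof.
move=> t0; have mS := measurable_gt t (mV i).
have : ((t ^+ 2)%:E * mu [set x | (t < V i x)%R] <= \int[mu]_x (V i x ^+ 2)%:E)%E.
  rewrite -(integral_cst mu mS (t ^+ 2)%:E).
  apply: (@le_trans _ _ (\int[mu]_(x in [set x | (t < V i x)%R]) (V i x ^+ 2)%:E)%E).
    apply: ge0_le_integral => //.
    - by move=> x _; rewrite lee_fin sqr_ge0.
    - by apply/measurable_EFinP; apply: measurable_funTS; exact: (measurable_funX 2 (mV i)).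
    - by move=> x /= tx; rewrite lee_fin lerXn2r// ?nnegrE// ltW.
  apply: ge0_subset_integral => //.
  - by apply/measurable_EFinP; exact: (measurable_funX 2 (mV i)).
  - by move=> x _; rewrite lee_fin sqr_ge0.
move=> h; have := le_lt_trans h (V2 i); case: (mu _) => [r _|  |//]; first exact: ltry.
by rewrite gt0_muley// lte_fin exprn_gt0.
Qed.

(** As the level decreases to [t], superlevel sets increase to the one at [t], so their measures
    converge from below. *)
Lemma dist_rcont y t : (y%:E < dist t)%E -> exists2 s, t < s & (y%:E < dist s)%E.
Proof.
move=> yt.
have cv : (fun n : nat => dist (t + n.+1%:R^-1)) @ \oo --> dist t.
  apply: cvg_nnesum => [i _|i _]; first by apply: nearW => n.
  have -> : [set x | t < V i x] = \bigcup_n [set x | t + n.+1%:R^-1 < V i x].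
    apply/seteqP; split => x /=.
      move=> tx; have /ltr_add_invr [n] := tx; by exists n.
    by move=> [n _ /=]; apply: lt_trans; rewrite ltrDl invr_gt0.
  apply: (@nondecreasing_cvg_mu _ _ R mu).
  - by move=> n; exact: measurable_gt.
  - by apply: bigcup_measurable => n _; exact: measurable_gt.
  - move=> n m nm; apply/subsetPset => x /=; apply: le_lt_trans.
    by rewrite lerD2l lef_pV2 ?posrE// ler_nat.
have [//|H] := pselect (exists2 s, t < s & (y%:E < dist s)%E).
suff : (dist t <= y%:E)%E by rewrite leNgt yt.
rewrite -(cvg_lim _ cv)//; apply: lime_le; first by apply/cvg_ex; exists (dist t).
apply: nearW => n; rewrite leNgt; apply/negP => h; apply: H.
by exists (t + n.+1%:R^-1) => //; rewrite ltrDl invr_gt0.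
Qed.

(** [Num.max y 0] freezes the rearrangement on the negative axis at its value at 0, so that it is
    nonincreasing on the whole line. Where the set is empty, [sup] returns the desired 0. *)
Let S y := [set t : R | 0 <= t /\ ((Num.max y 0)%:E < dist t)%E].

Definition rearr y : R := sup (S y).

Let S_ub y : has_ubound (S y).
Proof.
exists B => t [t0 yt]; rewrite leNgt; apply/negP => Bt.
have d0 : dist t = 0%E.
  rewrite /dist big1// => i _; rewrite (_ : [set x | _] = set0) ?measure0//.
  by apply/seteqP; split => x //=; rewrite ltNge (le_trans (VB i x))// ltW.
by move: yt; rewrite d0 lte_fin ltNge le_max lexx orbT.
Qed.

(** The rearrangement is the generalized inverse of [dist]. Both inequalities can be strict thanks
    to [dist_rcont]; monotonicity and equimeasurability follow from this equivalence. *)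
Lemma rearr_gt y t : 0 <= t -> (t < rearr y) <-> ((Num.max y 0)%:E < dist t)%E.
Proof.
move=> t0; split => [tf|yt].
  have S0 : S y !=set0.
    apply/set0P/eqP => S0; move: tf; rewrite /rearr S0 sup0 => /(le_lt_trans t0); by rewrite ltxx.
  have d0 : 0 < rearr y - t by rewrite subr_gt0.
  have [s [s0 ys]] := sup_adherent d0 (conj S0 (S_ub y)).
  rewrite subKr => ts; apply: (lt_le_trans ys); apply: dist_homo; exact: ltW.
have [s ts ys] := dist_rcont yt; apply: (lt_le_trans ts).
by apply: sup_ubound (S_ub y) _ _; split => //; exact: le_trans (ltW ts).
Qed.

Lemma rearr_ge0 y : 0 <= rearr y.
Proof.
have [e|/set0P[t [t0 ty]]] := eqVneq (S y) set0; first by rewrite /rearr -/(S y) e sup0.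
by apply: (le_trans t0); apply: sup_ubound (S_ub y) _ _; split.
Qed.

Lemma rearr_noninc : nonincreasing_fun rearr.
Proof.
move=> y z yz; rewrite leNgt; apply/negP => h.
have [H _] := rearr_gt z (rearr_ge0 y); have := H h => {H}.
move=> H; have : rearr y < rearr y; last by rewrite ltxx.
apply/(rearr_gt y (rearr_ge0 y)); apply: le_lt_trans H; rewrite lee_fin.
by rewrite ge_max !le_max yz lexx orbT.
Qed.

Lemma rearr_max y : rearr (Num.max y 0) = rearr y.
Proof. by rewrite /rearr /S -maxA maxxx. Qed.

Lemma rearr_powR q : 0 < q ->
  (\int[mu]_(x in `[0%R, +oo[) (rearr x `^ q)%:E = \sum_(i < 3) \int[mu]_x (V i x `^ q)%:E)%E.
Proof.
move=> q0; pose F : R -> R := rearr \_ `[0, +oo[.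
have FE x : F x = if 0 <= x then rearr x else 0.
  rewrite /F patchE; case: ifPn; rewrite ?inE ?notin_setE /= in_itv/= andbT.
    by move=> ->.
  by case: ifP.
have mf : measurable_fun setT F.
  have mr : measurable_fun (`[0, +oo[ : set R) rearr by exact: nonincreasing_measurable rearr_noninc.
  by apply: (measurable_restrictT _ (measurable_itv `[0, +oo[)).1.
have F0 x : 0 <= F x by rewrite FE; case: ifP => // _; exact: rearr_ge0.
rewrite -(equimeas_powR q0 mV V0 mf F0); last first.
  move=> t t0; rewrite -/(dist t).
  have -> : [set x | t < F x] = [set x | 0 <= x /\ (x%:E < dist t)%E].
    apply/seteqP; split => x /=; rewrite FE.
      case: ifP => x0; last by rewrite ltNge t0.
      by move=> /(rearr_gt _ t0); rewrite (max_idPl x0).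
    by move=> [x0]; rewrite x0 => h; apply/(rearr_gt _ t0); rewrite (max_idPl x0).
  have d0 : (0 <= dist t)%E by apply: sume_ge0.
  case: (dist t) d0 => [r|_|//].
    rewrite lee_fin => r0.
    rewrite (_ : [set x | _] = `[0, r[%classic); last first.
      by apply/seteqP; split => x /=; rewrite in_itv/= lte_fin; [case=> -> ->|move/andP].
    rewrite lebesgue_measure_itv/= lte_fin; case: ltP => [_|h]; first by rewrite oppr0 adde0.
    by congr EFin; apply/eqP; rewrite eq_le h r0.
  rewrite (_ : [set x | _] = `[0, +oo[%classic); first by rewrite lebesgue_measure_itv/= ltry.
  by apply/seteqP; split => x /=; rewrite in_itv/= andbT ?ltry; [case|].
rewrite integral_mkcond; apply: eq_integral => x _; rewrite patchE FE.
case: (leP 0 x) => x0; first by rewrite mem_set//= in_itv/= x0.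
rewrite memNset/=; last by rewrite in_itv/= leNgt x0.
by rewrite powR0// gt_eqF.
Qed.

(** * Polya-Szego inequality with the weight [wt] *)

Section polya_szego.
Variables (l : R) (g : 'I_3 -> R -> R) (k : R).
Hypotheses (l0 : 0 < l) (mg : forall i, measurable_fun setT (g i))
  (gk : (\sum_(i < 3) \int[mu]_x (g i x ^+ 2)%:E <= k%:E)%E)
  (cross : forall p q y, 0 < p -> p < q -> 0 <= y -> (y%:E < dist q)%E ->
    ((if y < l then q - p else 2 * (q - p))%:E <=
      \sum_(i < 3) \int[mu]_(x in [set x | (p < V i x <= q)%R]) `|g i x|%:E)%E).

(** The energy carried above the level [t]. Cells of a partition correspond to disjoint level bands,
    so their costs are differences of [K] and telescope. *)
Let K t : \bar R := (\sum_(i < 3) \int[mu]_(x in [set x | (t < V i x)%R]) (g i x ^+ 2)%:E)%E.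

Let mg2 i (D : set R) : measurable_fun D (fun x => (g i x ^+ 2)%:E).
Proof. by apply/measurable_EFinP; apply: measurable_funTS; exact: (measurable_funX 2 (mg i)). Qed.

Let K_ge0 t : (0 <= K t)%E.
Proof. by apply: sume_ge0 => i _; apply: integral_ge0 => x _; rewrite lee_fin sqr_ge0. Qed.

Let K_homo s t : s <= t -> (K t <= K s)%E.
Proof.
move=> st; apply: lee_sum => i _; apply: ge0_subset_integral; try exact: measurable_gt.
- exact: mg2.
- by move=> x _; rewrite lee_fin sqr_ge0.
- by move=> x /=; exact: le_lt_trans.
Qed.

Let K_le t : (K t <= k%:E)%E.
Proof.
apply: le_trans gk; apply: lee_sum => i _; apply: ge0_subset_integral => //; try exact: measurable_gt.
- exact: mg2.
- by move=> x _; rewrite lee_fin sqr_ge0.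
Qed.

Let K_fin t : K t \is a fin_num.
Proof. by rewrite ge0_fin_numE//; exact: le_lt_trans (K_le t) (ltry _). Qed.

Let rK t : R := fine (K t).

Let band p q i := [set x | p < V i x <= q].

Let m_band p q i : measurable (band p q i).
Proof.
rewrite (_ : band p q i = [set x | p < V i x] `&` [set x | V i x <= q]).
  by apply: measurableI; [exact: measurable_gt|exact: measurable_le].
by apply/seteqP; split => x /= /andP.
Qed.

Let band_split p q i : p < q -> [set x | p < V i x] = band p q i `|` [set x | q < V i x].
Proof.
move=> pq; apply/seteqP; split => x /=.
  by move=> px; have [qx|xq] := ltP q (V i x); [by right|left; rewrite /band/= px].
by case=> [/andP[]//|]; exact: lt_trans.
Qed.

Let band_disj p q i : [disjoint band p q i & [set x | q < V i x]].
Proof. by apply/disj_setPS => x [/= /andP[_ h]]; rewrite ltNge h. Qed.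

(* AM-GM [2 c |g| <= c^2 + g^2] on the band [p < V <= q], whose total measure is
   at most [z - y]; [c] is the slope of the profile times the number of crossings. *)
Let step y z r : 0 <= y -> y < z -> 0 < r -> r < rearr y - rearr z ->
  wt l y * (r ^+ 2 / (z - y)) <= rK (rearr z) - rK (rearr y).
Proof.
move=> y0 yz r0 rlt.
(* A margin at both ends of the band makes the levels strict: [p > rearr z] gives [dist p <= z], and
   [q < rearr y] gives [dist q > y]. *)
pose d := (rearr y - rearr z - r) / 2.
have d0 : 0 < d by rewrite /d divr_gt0// subr_gt0.
pose p := rearr z + d; pose q := rearr y - d.
have pq : q - p = r by rewrite /q /p /d; lra.
have p0 : 0 < p by rewrite /p ltr_wpDl// rearr_ge0.
have plq : p < q by rewrite -subr_gt0 pq.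
have q0 : 0 <= q by rewrite ltW// (lt_trans p0).
have yq : (y%:E < dist q)%E.
  by have [H _] := rearr_gt y q0; rewrite -(max_idPl y0); apply: H; rewrite /q gtrBl.
have pz : (dist p <= z%:E)%E.
  rewrite leNgt; apply/negP => h.
  have [_ H] := rearr_gt z (ltW p0); rewrite (max_idPl _) in H; last by rewrite (le_trans y0)// ltW.
  by have := H h; rewrite /p gtrDl ltNge (ltW d0).
have d_split : dist p = (\sum_(i < 3) mu (band p q i) + dist q)%E.
  rewrite /dist -big_split/=; apply: eq_bigr => i _; rewrite (band_split i plq) measureU//.
  - exact: m_band.
  - exact: measurable_gt.
  - exact/disj_set2P/band_disj.
have K_split : K p = (\sum_(i < 3) \int[mu]_(x in band p q i) (g i x ^+ 2)%:E + K q)%E.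
  rewrite /K -big_split/=; apply: eq_bigr => i _; rewrite (band_split i plq) ge0_integral_setU//.
  - exact: m_band.
  - exact: measurable_gt.
  - exact: mg2.
  - by move=> x _; rewrite lee_fin sqr_ge0.
have zy0 : 0 < z - y by rewrite subr_gt0.
have LA : (\sum_(i < 3) mu (band p q i) <= (z - y)%:E)%E.
  have sy : (\sum_(i < 3) mu (band p q i) + y%:E <= z%:E)%E.
    by apply: le_trans pz; rewrite d_split leeD2l// ltW.
  by rewrite EFinB leeBrDr.
pose N : R := if y < l then 1 else 2.
have N2 : wt l y = N ^+ 2 by rewrite /wt /N; case: ifP => _; ring.
have Nr : ((N * r)%:E <= \sum_(i < 3) \int[mu]_(x in band p q i) `|g i x|%:E)%E.
  by have := cross p0 plq y0 yq; rewrite pq /N; case: ifP => // _; rewrite mul1r.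
pose c := N * r / (z - y).
have N0 : 0 < N by rewrite /N; case: ifP.
have c0 : 0 <= c by rewrite /c divr_ge0 ?mulr_ge0// ltW.
have am i : ((2 * c)%:E * \int[mu]_(x in band p q i) `|g i x|%:E <=
    (c ^+ 2)%:E * mu (band p q i) + \int[mu]_(x in band p q i) (g i x ^+ 2)%:E)%E.
  have mgn : measurable_fun (band p q i) (fun x => `|g i x|%:E).
    by apply/measurable_EFinP; apply: measurableT_comp => //; exact: (measurable_funTS (mg i)).
  rewrite -ge0_integralZl; [|exact: m_band|exact: mgn|by []|by rewrite lee_fin mulr_ge0].
  rewrite -(integral_cst mu (m_band p q i) (c ^+ 2)%:E) -ge0_integralD; [|exact: m_band|
    by move=> x _; rewrite /= lee_fin sqr_ge0|exact: measurable_cst|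
    by move=> x _; rewrite lee_fin sqr_ge0|exact: mg2].
  apply: ge0_le_integral => //.
  - exact: m_band.
  - by move=> x _; apply: mule_ge0; rewrite lee_fin// mulr_ge0.
  - by apply: measurable_funeM.
  - by apply: emeasurable_funD => //; exact: mg2.
  - move=> x _; rewrite /= -EFinM -EFinD lee_fin -(real_normK (num_real (g i x))).
    by have := sqr_ge0 (c - `|g i x|); lra.
have tot : ((2 * c)%:E * (N * r)%:E <= (c ^+ 2)%:E * (z - y)%:E +
    \sum_(i < 3) \int[mu]_(x in band p q i) (g i x ^+ 2)%:E)%E.
  apply: (@le_trans _ _ ((2 * c)%:E * \sum_(i < 3) \int[mu]_(x in band p q i) `|g i x|%:E)%E).
    by apply: lee_wpmul2l => //; rewrite lee_fin mulr_ge0.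
  rewrite ge0_sume_distrr//; last by move=> i _; apply: integral_ge0 => x _; rewrite lee_fin.
  apply: (@le_trans _ _ (\sum_(i < 3) ((c ^+ 2)%:E * mu (band p q i) + \int[mu]_(x in band p q i) (g i x ^+ 2)%:E))%E).
    by apply: lee_sum => i _; exact: am.
  rewrite big_split/= leeD2r// -ge0_sume_distrr//.
  by apply: lee_wpmul2l => //; rewrite lee_fin sqr_ge0.
have : (\sum_(i < 3) \int[mu]_(x in band p q i) (g i x ^+ 2)%:E = (rK p - rK q)%:E)%E.
  by rewrite EFinB !fineK// K_split addeK.
move=> e; move: tot; rewrite e -!EFinM -EFinD lee_fin => tot.
have e1 : c * (z - y) = N * r by rewrite /c divfK// gt_eqF.
have e2 : N ^+ 2 * (r ^+ 2 / (z - y)) = c * (N * r) by rewrite /c; field; rewrite gt_eqF.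
have h1 : rK p <= rK (rearr z) by rewrite fine_le//; apply: K_homo; rewrite /p lerDl ltW.
have h2 : rK (rearr y) <= rK q by rewrite fine_le//; apply: K_homo; rewrite /q gerBl ltW.
have h3 : c ^+ 2 * (z - y) = c * (N * r) by rewrite expr2 -mulrA e1.
rewrite -mulrA in tot; rewrite N2 e2; exact: step_arith tot h3 h1 h2.
Qed.

(** Negative end points are moved to 0, where the rearrangement has the same value and, as [0 < l],
    the weight is the same; the cell only gets shorter. *)
Let term y z : y <= z ->
  wt l y * ((rearr z - rearr y) ^+ 2 / (z - y)) <= rK (rearr z) - rK (rearr y).
Proof.
move=> yz; pose y' := Num.max y 0; pose z' := Num.max z 0.
have [e|ne] := eqVneq (rearr z) (rearr y).
  by rewrite e !subrr expr0n/= mul0r mulr0.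
have fzy : rearr z < rearr y by rewrite lt_neqAle ne rearr_noninc.
have y'z' : y' < z'.
  rewrite ltNge; apply/negP => h; have := rearr_noninc h.
  by rewrite !rearr_max leNgt fzy.
have wy : wt l y = wt l y'.
  by rewrite /wt /y' gt_max l0 andbT.
have zy' : z' - y' <= z - y.
  move: y'z'; rewrite /z' /y'; case: (leP z 0) => ?; case: (leP y 0) => ? ?; lra.
pose D := rearr y - rearr z.
have D0 : 0 < D by rewrite subr_gt0.
set X := rK _ - rK _.
have w0 : 0 < wt l y' by apply: lt_le_trans (wt_ge1 _ _).
have zy0 : 0 < z' - y' by rewrite subr_gt0.
apply: (@le_trans _ _ (wt l y' / (z' - y') * D ^+ 2)).
  rewrite wy -mulrA ler_pM2l// -[rearr z - rearr y]opprB sqrrN -/D mulrC ler_wpM2r ?sqr_ge0//.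
  by rewrite lef_pV2// posrE// (lt_le_trans zy0).
have W0 : 0 < wt l y' / (z' - y') by rewrite divr_gt0.
have St r : 0 < r -> r < D -> wt l y' / (z' - y') * r ^+ 2 <= X.
  move=> r0 rD; rewrite -mulrA [_^-1 * _]mulrC.
  have y'0 : 0 <= y' by rewrite le_max lexx orbT.
  have := step y'0 y'z' r0; rewrite !rearr_max; exact.
exact: lim_sqr_le.
Qed.

Lemma rearr_Dle : Dle (wt l) rearr k.
Proof.
move=> y n ndy; apply: (@le_trans _ _ (rK (rearr (y n)) - rK (rearr (y 0%N)))).
  rewrite /psum; elim: n => [|n IH]; first by rewrite big_ord0 subrr.
  rewrite big_ord_recr/=; apply: (le_trans (lerD IH (term (ndy n n.+1 (leqnSn n))))).
  move: (rK (rearr (y n))) (rK (rearr (y n.+1))) (rK (rearr (y 0%N))) => A C D.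
  by rewrite addrC addrA subrK.
have h1 : rK (rearr (y n)) <= k by rewrite -lee_fin fineK.
by rewrite lerBlDr (le_trans h1)// lerDl fine_ge0.
Qed.

End polya_szego.
End rearrangement.

(** * Rearrangement on the graph *)

Section edges.
Context {R : realType}.
Notation mu := (@lebesgue_measure R).
Implicit Types (v w : R -> R) (p q a b c x y l t : R).

(** * A single edge: extension by zero and crossings *)

Section one_edge.
Variables (E : set R) (v : R -> R).
Hypotheses (mE : measurable E) (HE : H1 E v).

Let w := weak_deriv E v.
Let V : R -> R := (fun x => `|v x|) \_ E.
Let G : R -> R := w \_ E.

Lemma weak_derivP : is_weak_deriv E v w.
Proof. by case: HE => _ _ [g Hg]; apply: (@xgetPex _ (cst 0) [set g | is_weak_deriv E v g]); exists g. Qed.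

Lemma weak_deriv_prim : has_prim E v w.
Proof. by case: HE => cv _ _; apply: H1_has_prim => //; exact: weak_derivP. Qed.

Lemma edge_cont : {within E, continuous v}.
Proof. by case: HE. Qed.

Lemma edge_meas : measurable_fun E v.
Proof. exact: subspace_continuous_measurable_fun edge_cont. Qed.

Lemma edgeV_meas : measurable_fun setT V.
Proof.
have h : measurable_fun E (fun x => `|v x|) by apply: measurableT_comp => //; exact: edge_meas.
by apply: (measurable_restrictT _ mE).1.
Qed.

Lemma edgeG_meas : measurable_fun setT G.
Proof. by apply: (measurable_restrictT _ mE).1 => //; case: weak_derivP => -[]. Qed.

Lemma edgeV_in x : E x -> V x = `|v x|.
Proof. by move=> Ex; rewrite /V patchE mem_set. Qed.

Lemma edgeV_out x : ~ E x -> V x = 0.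
Proof. by move=> Ex; rewrite /V patchE memNset. Qed.

Lemma edgeG_in x : E x -> G x = w x.
Proof. by move=> Ex; rewrite /G patchE mem_set. Qed.

Lemma edgeV_ge0 x : 0 <= V x.
Proof. by rewrite /V patchE; case: ifP. Qed.

Lemma edgeV_gt t x : 0 <= t -> t < V x -> E x.
Proof. by move=> t0; have [//|/edgeV_out ->] := pselect (E x); rewrite ltNge t0. Qed.

Lemma edgeV_powR q : 0 < q ->
  (\int[mu]_x (V x `^ q)%:E = \int[mu]_(x in E) (`|v x| `^ q)%:E)%E.
Proof.
move=> q0; rewrite [RHS]integral_mkcond; apply: eq_integral => x _; rewrite patchE.
have [Ex|Ex] := pselect (E x); first by rewrite mem_set// edgeV_in.
by rewrite memNset// edgeV_out// powR0// gt_eqF.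
Qed.

Lemma edgeV_sqr : (\int[mu]_x (V x ^+ 2)%:E = \int[mu]_(x in E) (`|v x| ^+ 2)%:E)%E.
Proof.
rewrite [RHS]integral_mkcond; apply: eq_integral => x _; rewrite patchE.
have [Ex|Ex] := pselect (E x); first by rewrite mem_set// edgeV_in.
by rewrite memNset// edgeV_out// expr0n.
Qed.

Lemma edgeG_sqr : (\int[mu]_x (G x ^+ 2)%:E = \int[mu]_(x in E) (`|w x| ^+ 2)%:E)%E.
Proof.
rewrite [RHS]integral_mkcond; apply: eq_integral => x _; rewrite /G !patchE.
by case: ifP => _; rewrite ?real_normK ?num_real// expr0n.
Qed.

Lemma edgeV_fin : (\int[mu]_x (V x ^+ 2)%:E < +oo)%E.
Proof.
rewrite edgeV_sqr; case: HE => _ [_ iv] _; exact: integrable_lty.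
Qed.

Lemma edgeG_fin : (\int[mu]_x (G x ^+ 2)%:E)%E =
  (\int[mu]_(x in E) (`|w x| ^+ 2))%:E.
Proof.
rewrite edgeG_sqr /Rintegral fineK//; case: weak_derivP => -[_ ig] _.
exact: integrable_fin_num.
Qed.

Let band p q := [set x | p < V x <= q].

Let m_band p q : measurable (band p q).
Proof.
rewrite (_ : band p q = [set x | p < V x] `&` [set x | V x <= q]).
  by apply: measurableI; [apply: measurable_gt|apply: measurable_le]; exact: edgeV_meas.
by apply/seteqP; split => x /= /andP.
Qed.

Let mGn (D : set R) : measurable_fun D (fun x => `|G x|%:E).
Proof.
by apply/measurable_EFinP; apply: measurableT_comp => //; apply: measurable_funTS; exact: edgeG_meas.
Qed.

Let cross1 p q a b : p < q -> a <= b -> `[a, b] `<=` E ->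
  (`|clamp p q `|v b| - clamp p q `|v a| |%:E <=
   \int[mu]_(x in `]a, b[ `&` band p q) `|G x|%:E)%E.
Proof.
move=> pq ab sub; have := clamp_cross mE weak_deriv_prim edge_cont weak_derivP.1.1 ab sub pq.
have sE x : `]a, b[%classic x -> E x.
  by move=> xab; apply: sub; move: xab; rewrite /= !in_itv/=; lra.
congr (_ <= _)%E.
have -> : `]a, b[ `&` [set x | (p < `|v x| <= q)%R] = `]a, b[ `&` band p q.
  by apply/seteqP; split => x /= [xab]; have Ex := sE x xab; rewrite /band/= edgeV_in.
by apply: eq_integral => x; rewrite inE => -[xab _]; rewrite edgeG_in//; exact: sE.
Qed.

Lemma edge_cross p q a b : p < q -> a <= b -> `[a, b] `<=` E ->
  (`|clamp p q `|v b| - clamp p q `|v a| |%:E <= \int[mu]_(x in band p q) `|G x|%:E)%E.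
Proof.
move=> pq ab sub; apply: (le_trans (cross1 pq ab sub)); apply: ge0_subset_integral => //.
- by apply: measurableI; [exact: measurable_itv|exact: m_band].
- exact: m_band.
- exact: mGn.
Qed.

(** The two open intervals are disjoint, so the ascent to a peak and the descent from it are charged
    separately. *)
Lemma edge_cross2 p q a b c : p < q -> a <= b -> b <= c -> `[a, c] `<=` E ->
  (`|clamp p q `|v b| - clamp p q `|v a| |%:E + `|clamp p q `|v c| - clamp p q `|v b| |%:E <=
    \int[mu]_(x in band p q) `|G x|%:E)%E.
Proof.
move=> pq ab bc sub.
have sab : `[a, b] `<=` E by apply: subset_trans sub; apply: subset_itv; rewrite bnd_simp.
have sbc : `[b, c] `<=` E by apply: subset_trans sub; apply: subset_itv; rewrite bnd_simp.
apply: (le_trans (leeD (cross1 pq ab sab) (cross1 pq bc sbc))).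
rewrite -ge0_integral_setU; first last.
- apply/disj_setPS => x [/= [+ _] [+ _]]; rewrite !in_itv/= => h1 h2; lra.
- by move=> x _; rewrite lee_fin.
- exact: mGn.
- by apply: measurableI; [exact: measurable_itv|exact: m_band].
- by apply: measurableI; [exact: measurable_itv|exact: m_band].
apply: ge0_subset_integral => //.
- by apply: measurableU; apply: measurableI; try exact: measurable_itv; exact: m_band.
- exact: m_band.
- exact: mGn.
- by move=> x [[]|[]].
Qed.

Lemma edge_level_fin t : 0 < t -> (mu [set x | (t < V x)%R] < +oo)%E.
Proof.
by move=> t0; apply: (@level_fin R (fun _ => V) _ _ _ ord0) => // _; [exact: edgeV_meas|exact: edgeV_ge0|exact: edgeV_fin].
Qed.

(** A superlevel set of finite measure cannot contain a half-line. *)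
Lemma edge_tail t x : 0 < t -> E = `[0, +oo[%classic -> 0 <= x ->
  exists2 y, x <= y & `|v y| <= t.
Proof.
move=> t0 EE x0.
have [//|H] := pselect (exists2 y, x <= y & `|v y| <= t).
have := edge_level_fin t0.
have : (mu `[x, +oo[ <= mu [set y | (t < V y)%R])%E.
  apply: le_measure; rewrite ?inE//; first by apply: measurable_gt; exact: edgeV_meas.
  move=> y; rewrite /= in_itv/= andbT => xy; rewrite edgeV_in; last first.
    by rewrite EE /= in_itv/= andbT (le_trans x0).
  by rewrite ltNge; apply/negP => h; apply: H; exists y.
by rewrite lebesgue_measure_itv/= ltry => /le_lt_trans /[apply].
Qed.

(** A value above 1 must come down to 1 further out. The drop is at most the integral of the
    derivative over a part of the set where [V] exceeds 1, and there its absolute value is at most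
    [1 + G x ^+ 2]. *)
Lemma ray_bounded : E = `[0, +oo[%classic -> exists B, forall x, V x <= B.
Proof.
move=> EE.
pose D := (mu [set x | (1 < V x)%R] + \int[mu]_x (G x ^+ 2)%:E)%E.
have D0 : (0 <= D)%E by apply: adde_ge0 => //; apply: integral_ge0 => x _; rewrite lee_fin sqr_ge0.
have Df : D \is a fin_num.
  rewrite ge0_fin_numE// /D lte_add_pinfty//; first exact: edge_level_fin.
  by rewrite edgeG_fin ltry.
exists (1 + fine D) => x.
have [x1|x1] := leP (V x) 1; first by rewrite (le_trans x1)// lerDl fine_ge0.
have Ex := edgeV_gt ler01 x1.
have x0 : 0 <= x by move: Ex; rewrite EE /= in_itv/= andbT.
have [y xy vy] := edge_tail ltr01 EE x0.
have sub : `[x, y] `<=` E by rewrite EE => z; rewrite /= !in_itv/= andbT => /andP[+ _]; exact: le_trans.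
have := edge_cross x1 xy sub; rewrite -(edgeV_in Ex).
have -> : clamp 1 (V x) `|v y| = 1 by rewrite /clamp (max_idPr vy) (min_idPl (ltW x1)).
have -> : clamp 1 (V x) (V x) = V x by rewrite /clamp (max_idPl (ltW x1)) minxx.
rewrite distrC ger0_norm ?subr_ge0 ?(ltW x1)// => h.
rewrite -lerBlDl -lee_fin fineK//; apply: (le_trans h).
apply: (@le_trans _ _ (\int[mu]_(z in band 1 (V x)) ((cst 1%:E z) + (G z ^+ 2)%:E))%E).
  apply: ge0_le_integral => //.
  - exact: m_band.
  - exact: mGn.
  - apply: emeasurable_funD => //; apply/measurable_EFinP; apply: measurable_funTS.
    exact: (measurable_funX 2 edgeG_meas).
  - move=> z _; rewrite /= -EFinD lee_fin -(real_normK (num_real (G z))).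
    by move: (`|G z|) => s; have := sqr_ge0 (s - 1); have := sqr_ge0 s; nra.
rewrite ge0_integralD//; first last.
- by apply/measurable_EFinP; apply: measurable_funTS; exact: (measurable_funX 2 edgeG_meas).
- by move=> z _; rewrite lee_fin sqr_ge0.
- exact: m_band.
rewrite integral_cst; last exact: m_band.
rewrite mul1e; apply: leeD.
  apply: le_measure; rewrite ?inE; [exact: m_band|by apply: measurable_gt; exact: edgeV_meas|].
  by move=> z /= /andP[].
apply: ge0_subset_integral => //.
- exact: m_band.
- by apply/measurable_EFinP; exact: (measurable_funX 2 edgeG_meas).
- by move=> z _; rewrite lee_fin sqr_ge0.
Qed.

Lemma segment_bounded l : 0 < l -> E = `[0, l]%classic -> exists B, forall x, V x <= B.
Proof.
move=> l0 EE; have cv := edge_cont; rewrite EE in cv.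
have [M HM] := continuous_bounded (ltW l0) cv; exists M => x.
have [Ex|Ex] := pselect (E x); first by rewrite edgeV_in//; apply: HM; rewrite -EE.
rewrite edgeV_out//; have := HM 0; rewrite /= in_itv/= lexx ltW//= => /(_ isT).
exact: le_trans.
Qed.

End one_edge.

(** * The three edges together *)

Section graph.
Variables (l : R) (u : graph_fun R).
Hypotheses (l0 : 0 < l) (Hu : graph_H1 l u).

Let mE i : measurable (edge l i).
Proof. by rewrite /edge; case: ifP. Qed.

Let HE i : H1 (edge l i) (u i). Proof. by case: Hu. Qed.

Let V i : R -> R := (fun x => `|u i x|) \_ (edge l i).
Let G i : R -> R := weak_deriv (edge l i) (u i) \_ (edge l i).

Let edge2 : edge l ord_max = `[0, l]%classic.
Proof. by rewrite /edge eqxx. Qed.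

Let edge_ray i : i != ord_max -> edge l i = `[0, +oo[%classic.
Proof. by rewrite /edge => /negPf ->. Qed.

Let bounded : exists B, forall i x, V i x <= B.
Proof.
have ex i : exists B, forall x, V i x <= B.
  have [->|i2] := eqVneq i ord_max.
    exact: (segment_bounded (HE ord_max) l0 edge2).
  exact: (ray_bounded (mE i) (HE i) (edge_ray i2)).
have [B HB] := choice ex.
exists (\sum_(i < 3) `|B i|) => i x; apply: (le_trans (HB i x)).
by rewrite (bigD1 i)//= (le_trans (ler_norm _))// lerDl sumr_ge0.
Qed.

Definition dirichlet : R :=
  \sum_(i < 3) \int[mu]_(x in edge l i) (`|weak_deriv (edge l i) (u i) x| ^+ 2).

Let G_total : (\sum_(i < 3) \int[mu]_x (G i x ^+ 2)%:E = dirichlet%:E)%E.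
Proof. by rewrite /dirichlet -sumEFin; apply: eq_bigr => i _; exact: edgeG_fin. Qed.

(** Let c be the vertex value cut to [[p, q]]. Every half-line descends from c to p. If one of them
    exceeds q somewhere, it pays q - c up and q - p down, and with c - p on the other half-line the
    total is 2 (q - p). A peak on the terminal edge pays q - c, and one half-line supplies the
    missing c - p. *)
Let cross p q y : 0 < p -> p < q -> 0 <= y -> (y%:E < dist V q)%E ->
  ((if y < l then q - p else 2 * (q - p))%:E <=
    \sum_(i < 3) \int[mu]_(x in [set x | (p < V i x <= q)%R]) `|G i x|%:E)%E.
Proof.
move=> p0 pq y0 yq.
pose c := clamp p q `|u ord0 0|.
have c_i i : clamp p q `|u i 0| = c by rewrite /c; case: Hu => _ /(_ i ord0) ->.
have pc : p <= c by rewrite /c /clamp le_min (ltW pq) le_max lexx orbT.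
have cq : c <= q by rewrite /c /clamp ge_min lexx orbT.
have clamp_low x : x <= p -> clamp p q x = p.
  by move=> xp; rewrite /clamp (max_idPr xp) (min_idPl (ltW pq)).
have clamp_high x : q < x -> clamp p q x = q.
  move=> qx; rewrite /clamp (max_idPl _) ?(ltW (lt_trans pq qx))//.
  by rewrite (min_idPr (ltW qx)).
pose J i := (\int[mu]_(x in [set x | (p < V i x <= q)%R]) `|G i x|%:E)%E.
have J0 i : (0 <= J i)%E by apply: integral_ge0.
have Jray i : i != ord_max -> ((c - p)%:E <= J i)%E.
  move=> i2; have [x x0 ux] := edge_tail (mE i) (HE i) p0 (edge_ray i2) (lexx 0).
  have sub : `[0, x] `<=` edge l i.
    by rewrite (edge_ray i2) => z; rewrite /= !in_itv/= andbT => /andP[].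
  have := edge_cross (mE i) (HE i) pq x0 sub.
  by rewrite c_i clamp_low// distrC ger0_norm ?subr_ge0.
have Jpeak i x : i != ord_max -> q < V i x -> ((q - c + (q - p))%:E <= J i)%E.
  move=> i2 qx; have Ex := edgeV_gt (ltW (lt_trans p0 pq)) qx.
  have x0 : 0 <= x by move: Ex; rewrite (edge_ray i2)/= in_itv/= andbT.
  have [z xz uz] := edge_tail (mE i) (HE i) p0 (edge_ray i2) x0.
  have sub : `[0, z] `<=` edge l i.
    by rewrite (edge_ray i2) => t; rewrite /= !in_itv/= andbT => /andP[].
  have := edge_cross2 (mE i) (HE i) pq x0 xz sub.
  rewrite c_i (clamp_low _ uz) (clamp_high `|u i x|); last by rewrite -(edgeV_in _ Ex).
  by rewrite ger0_norm ?subr_ge0// distrC ger0_norm ?subr_ge0// ltW.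
have Jtip x : q < V ord_max x -> ((q - c)%:E <= J ord_max)%E.
  move=> qx; have Ex := edgeV_gt (ltW (lt_trans p0 pq)) qx.
  have /andP[x0 xl] : 0 <= x <= l by move: Ex; rewrite edge2 /= in_itv.
  have sub : `[0, x] `<=` edge l ord_max.
    by rewrite edge2; apply: subset_itv; rewrite bnd_simp.
  have := edge_cross (mE ord_max) (HE ord_max) pq x0 sub.
  rewrite c_i (clamp_high `|u ord_max x|); last by rewrite -(edgeV_in _ Ex).
  by rewrite ger0_norm ?subr_ge0.
have sumJ i j : i != ord_max -> j != ord_max -> i != j ->
    (\sum_(i < 3) J i = J i + J j + J ord_max)%E.
  move=> i2 j2 ij; rewrite (bigD1 i)//= (bigD1 j)/=; last by rewrite eq_sym.
  rewrite (bigD1 ord_max)/=; last by rewrite !(eq_sym ord_max) i2 j2.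
  rewrite big1 ?adde0 ?addeA// => k /andP[/andP[ki kj] k2].
  by move: i j k i2 j2 ij ki kj k2 => [[|[|[|//]]] ?] [[|[|[|//]]] ?] [[|[|[|//]]] ?].
pose i0 : 'I_3 := ord0; pose i1 : 'I_3 := lift ord0 ord0.
have peak_case : (exists2 i, i != ord_max & exists x, q < V i x) ->
    ((2 * (q - p))%:E <= \sum_(i < 3) J i)%E.
  move=> [i i2 [x qx]].
  have [j j2 ij] : exists2 j, j != ord_max & i != j.
    by move: i i2 {qx} => [[|[|[|//]]] ?]// _; [exists i1|exists i0].
  rewrite (sumJ i j)//; apply: (@le_trans _ _ (J i + J j)%E); last by rewrite leeDl.
  apply: le_trans (leeD (Jpeak _ _ i2 qx) (Jray _ j2)).
  by rewrite -EFinD lee_fin; lra.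
case: ifPn => yl; last first.
  apply: peak_case; have [//|H] := pselect (exists2 i, i != ord_max & exists x, q < V i x).
  have z i : i != ord_max -> [set x | q < V i x] = set0.
    by move=> i2; apply/seteqP; split => x //= qx; apply: H; exists i => //; exists x.
  move: yq; rewrite /dist (bigD1 ord_max)//= big1 => [|i i2]; last by rewrite z// measure0.
  rewrite adde0 => yq.
  have : (mu [set x | (q < V ord_max x)%R] <= mu `[0%R, l])%E.
    apply: le_measure; rewrite ?inE//.
      by apply: measurable_gt; exact: edgeV_meas.
    by move=> x /= /(edgeV_gt (ltW (lt_trans p0 pq))); rewrite edge2.
  move=> /(lt_le_trans yq); rewrite lebesgue_measure_itv/= lte_fin l0 oppr0 adde0 lte_fin.
  by rewrite (negPf yl).
have [i [x qx]] : exists i, exists x, q < V i x.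
  have [//|H] := pselect (exists i, exists x, q < V i x).
  move: yq; rewrite /dist big1 ?lte_fin ?ltNge ?y0// => i _.
  rewrite (_ : [set x | _] = set0) ?measure0//.
  by apply/seteqP; split => z //= qz; apply: H; exists i, z.
have [i2|i2] := eqVneq i ord_max.
  rewrite i2 in qx; rewrite (sumJ i0 i1)//.
  apply: (@le_trans _ _ (J i0 + J ord_max)%E); last first.
    by rewrite leeD2r// leeDl.
  apply: le_trans (leeD (Jray i0 isT) (Jtip _ qx)).
  by rewrite -EFinD lee_fin; lra.
apply: le_trans (peak_case _); last by exists i => //; exists x.
by rewrite lee_fin; lra.
Qed.

(** All exponents at once: [q = 2] will transport the mass and [q = p] the other term of the
    energy. *)
Lemma graph_rearr : exists f, [/\ nonincreasing_fun f, forall x, 0 <= f x, Dle (wt l) f dirichlet &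
  forall q, 0 < q -> (\int[mu]_(x in `[0%R, +oo[) (f x `^ q)%:E =
    \sum_(i < 3) \int[mu]_(x in edge l i) (`|u i x| `^ q)%:E)%E].
Proof.
have [B HB] := bounded.
have mV i : measurable_fun setT (V i) by exact: edgeV_meas.
have V0 i x : 0 <= V i x by exact: edgeV_ge0.
have V2 i : (\int[mu]_x (V i x ^+ 2)%:E < +oo)%E by exact: edgeV_fin.
exists (rearr V); split.
- exact: rearr_noninc HB.
- exact: rearr_ge0 HB.
- have mG i : measurable_fun setT (G i) by exact: edgeG_meas.
  have gk : (\sum_(i < 3) \int[mu]_x (G i x ^+ 2)%:E <= dirichlet%:E)%E by rewrite G_total.
  exact: (rearr_Dle mV HB l0 mG gk cross).
- move=> q q0; rewrite (rearr_powR mV V0 HB q0); apply: eq_bigr => i _.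
  exact: edgeV_powR.
Qed.

End graph.
End edges.

(** * Unfolding a profile *)

Section unfolding.
Context {R : realType}.
Notation mu := (@lebesgue_measure R).
Implicit Types (f g : R -> R) (l k c p q s x y : R).

(* The monotone profile [f] on the half-line is spread over the graph: the
   part of [f] on [[0, l]] fills the terminal edge from its tip to the vertex,
   the part on [[l, +oo[] is shared equally by the two half-lines. *)
Definition unfold l f : graph_fun R := fun i x =>
  if i == ord_max then f (l - Num.max x 0) else f (l + 2 * Num.max x 0).

(** Clamping the partition leaves the increments unchanged and can only shorten the cells. *)
Lemma psum_clamp (w : R) f (y : nat -> R) n : 0 <= w -> nondecreasing_seq y ->
  psum (cst w) (fun x => f (Num.max x 0)) y n <= psum (cst w) f (fun i => Num.max (y i) 0) n.
Proof.
move=> w0 ny; apply: ler_sum => i _ /=.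
have yS := ny i i.+1 (leqnSn i).
have [e|ne] := eqVneq (Num.max (y i.+1) 0) (Num.max (y i) 0).
  by rewrite e !subrr expr0n/= !mul0r.
rewrite ler_wpM2l// ler_wpM2l ?sqr_ge0//.
have d0 : 0 < Num.max (y i.+1) 0 - Num.max (y i) 0.
  by rewrite subr_gt0 lt_neqAle eq_sym ne/= (nd_max 0 ny).
have d1 : Num.max (y i.+1) 0 - Num.max (y i) 0 <= y i.+1 - y i.
  by move: yS d0; case: (leP (y i.+1) 0) => ?; case: (leP (y i) 0) => ?; lra.
by rewrite lef_pV2// posrE// (lt_le_trans d0).
Qed.

(** Each half-line runs through the tail at double speed, which doubles its energy; two copies give
    the weight 4. The reversed partition of the tip followed by the stretched one of the half-line
    is one partition for the profile. *)
Lemma unfold_psum l f k (y : nat -> R) n (z : nat -> R) m : 0 < l -> Dle (wt l) f k ->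
  nondecreasing_seq y -> nondecreasing_seq z ->
  psum (cst 1) (unfold l f ord_max) y n + 2 * psum (cst 1) (unfold l f ord0) z m <= k.
Proof.
move=> l0 D ny nz.
pose Y i := l - Num.max (y (n - i)%N) 0; pose Z i := l + 2 * Num.max (z i) 0.
have nY : nondecreasing_seq Y.
  by move=> i j ij; rewrite /Y lerD2l lerN2; apply: (nd_max 0 ny); rewrite leq_sub2l.
have nZ : nondecreasing_seq Z.
  by move=> i j ij; rewrite /Z lerD2l ler_pM2l//; exact: (nd_max 0 nz).
have YZ : Y n <= Z 0%N.
  rewrite /Y /Z; have : 0 <= Num.max (y (n - n)%N) 0 by rewrite le_max lexx orbT.
  have : 0 <= Num.max (z 0%N) 0 by rewrite le_max lexx orbT.
  lra.
have h1 : psum (cst 1) (unfold l f ord_max) y n <= psum (wt l) f Y n.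
  apply: (@le_trans _ _ (psum (cst 1) (fun x => f (l - x)) (fun i => Num.max (y i) 0) n)).
    rewrite /unfold eqxx; exact: (psum_clamp (fun x => f (l - x)) n ler01).
  rewrite psum_rev; last exact: (nd_max 0 ny).
  by apply: psum_le_wt => // x; rewrite wt_ge1.
have h2 : 2 * psum (cst 1) (unfold l f ord0) z m <= psum (wt l) f Z m.
  apply: (@le_trans _ _ (2 * psum (cst 1) (fun x => f (l + 2 * x)) (fun i => Num.max (z i) 0) m)).
    rewrite ler_pM2l// /unfold/=; exact: (psum_clamp (fun x => f (l + 2 * x)) m ler01).
  rewrite /psum mulr_sumr; apply: ler_sum => i _; rewrite /= mul1r.
  have -> : wt l (Z i) = 4.
    by rewrite /wt /Z ltNge lerDl mulr_ge0// le_max lexx orbT.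
  have -> : Z i.+1 - Z i = 2 * (Num.max (z i.+1) 0 - Num.max (z i) 0) by rewrite /Z; ring.
  rewrite invfM !mulrA; apply: ler_wpM2r.
    by rewrite invr_ge0 subr_ge0; exact: (nd_max 0 nz).
  by rewrite -/(Z i) -/(Z i.+1); move: ((f (Z i.+1) - f (Z i)) ^+ 2) => X; lra.
apply: (le_trans (lerD h1 h2)).
have w0 x : 0 <= wt l x by exact: wt_ge0.
apply: (le_trans (psum_cat f m w0 nY nZ YZ)).
by apply: D; exact: cat_seq_nd.
Qed.

(** [Dle_H1] works edge by edge, so the joint bound has to be distributed: [c] is the supremum over
    a half-line, and the terminal edge gets the rest. *)
Lemma unfold_Dle l f k : 0 < l -> Dle (wt l) f k -> exists c : R,
  Dle (cst 1) (unfold l f ord_max) (k - 2 * c) /\ Dle (cst 1) (unfold l f ord0) c.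
Proof.
move=> l0 D.
pose S := [set r | exists z m, nondecreasing_seq z /\ r = psum (cst 1) (unfold l f ord0) z m].
have ub : has_ubound S.
  exists (k / 2) => _ [z [m [nz ->]]].
  have := unfold_psum 0 m l0 D (fun i j _ => lexx (0 : R)) nz.
  by rewrite {1}/psum big_ord0; lra.
have S0 : S !=set0.
  by exists (psum (cst 1) (unfold l f ord0) (fun=> 0) 0), (fun=> 0), 0%N; split => // i j _.
exists (sup S); split => y n ny; last by apply: sup_ubound ub _ _; exists y, n.
rewrite lerBrDl -lerBrDr -ler_pdivlMl//; apply: ge_sup S0 _ => _ [z [m [nz ->]]].
have := unfold_psum n m l0 D ny nz; lra.
Qed.

(** Reflection on the tip and the substitution [l + 2 * x] on the tail, whose Jacobian 2 accounts
    for the two half-lines. *)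
Lemma unfold_integral l (G : R -> R) : 0 < l -> continuous G -> (forall x, 0 <= G x) ->
  (\int[mu]_(x in `[0%R, +oo[) (G x)%:E =
   \sum_(i < 3) \int[mu]_(x in edge l i) (unfold l G i x)%:E)%E.
Proof.
move=> l0 cG G0.
have mG (D : set R) : measurable D -> measurable_fun D G.
  by move=> mD; apply: measurable_funTS; exact: continuous_measurable_fun.
rewrite (@ge0_itvy_split _ _ 0 l (ltW l0))//; last exact: mG.
rewrite integral_itv_bndo_bndc; last by apply/measurable_EFinP; exact: mG.
have tip : (\int[mu]_(x in `[0%R, l]) (G x)%:E = \int[mu]_(x in `[0%R, l]) (G (l - x)%R)%:E)%E.
  have dF : (fun x : R => l - x)^`()%classic = cst (-1).
    by apply/funext => x; rewrite derive1E deriveB// derive_cst derive_id sub0r.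
  have := @integration_by_substitution_decreasing R (fun x => l - x) G 0 l (ltW l0).
  rewrite subrr subr0 dF => ->.
  - by apply: eq_integral => x _; rewrite !fctE opprK mulr1.
  - by move=> x y _ _ xy; rewrite ltrD2l ltrN2.
  - by move=> x _; exact: cvg_cst.
  - exact: is_cvg_cst.
  - exact: is_cvg_cst.
  - have cF : continuous (fun x : R => l - x).
      by move=> x; apply: cvgB; [exact: cvg_cst|exact: cvg_id].
    split; first by move=> x _.
      by apply: cvg_at_right_filter; exact: cF.
    by apply: cvg_at_left_filter; exact: cF.
  - exact: continuous_subspaceT.
have tail : (\int[mu]_(x in `[l, +oo[) (G x)%:E =
    2%:E * \int[mu]_(x in `[0%R, +oo[) (G (l + 2 * x)%R)%:E)%E.
  have cF : continuous (fun x : R => l + 2 * x).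
    by move=> x; apply: cvgD; [exact: cvg_cst|apply: cvgM; [exact: cvg_cst|exact: cvg_id]].
  have dF : (fun x : R => l + 2 * x)^`()%classic = cst 2.
    apply/funext => x; rewrite derive1E deriveD// deriveZ//= derive_id derive_cst.
    by rewrite add0r /GRing.scale/= mulr1.
  have := @increasing_ge0_integration_by_substitutiony R (fun x => l + 2 * x) G 0.
  rewrite mulr0 addr0 dF => ->.
  - rewrite -ge0_integralZl//.
    + by apply: eq_integral => x _; rewrite !fctE EFinM muleC.
    + by apply/measurable_EFinP; apply: measurable_funTS; apply: continuous_measurable_fun => x; apply: continuous_comp; [exact: cF|exact: cG].
    + by move=> x _; rewrite lee_fin.
  - by move=> x y _ _ xy; rewrite ltrD2l ltr_pM2l.
  - by move=> x _; exact: cvg_cst.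
  - exact: is_cvg_cst.
  - exact: is_cvg_cst.
  - split; first by move=> x _.
    by apply: cvg_at_right_filter; exact: cF.
  - apply/cvgryPge => A; near=> x.
    have : (A - l) / 2 <= x by near: x; apply: nbhs_pinfty_ge; exact: num_real.
    by lra.
  - exact: continuous_subspaceT.
  - by move=> x _.
rewrite tip tail !big_ord_recl big_ord0 /edge /unfold/= adde0.
have -> : (\int[mu]_(x in `[0%R, +oo[) (G (l + 2 * Num.max x 0)%R)%:E =
    \int[mu]_(x in `[0%R, +oo[) (G (l + 2 * x)%R)%:E)%E.
  by apply: eq_integral => x; rewrite inE/= in_itv/= andbT => x0; rewrite (max_idPl x0).
have -> : (\int[mu]_(x in `[0%R, l]) (G (l - Num.max x 0)%R)%:E =
    \int[mu]_(x in `[0%R, l]) (G (l - x)%R)%:E)%E.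
  by apply: eq_integral => x; rewrite inE/= in_itv/= => /andP[x0 _]; rewrite (max_idPl x0).
have e2 (z : \bar R) : (2%:E * z = z + z)%E.
  by rewrite -[2]/(1 + 1) EFinD ge0_muleDl ?lee_fin// !mul1e.
rewrite e2 [LHS]addeC; exact/esym/addeA.
Unshelve. all: by end_near. Qed.


Lemma sum_Rintegral (n : nat) (E : 'I_n -> set R) (F : 'I_n -> R -> R) (c : R) :
  (forall i x, 0 <= F i x) -> (\sum_(i < n) \int[mu]_(x in E i) (F i x)%:E = c%:E)%E ->
  (\sum_(i < n) \int[mu]_(x in E i) F i x = c) /\
  forall i, (\int[mu]_(x in E i) (F i x)%:E < +oo)%E.
Proof.
move=> F0 H.
have I0 i : (0 <= \int[mu]_(x in E i) (F i x)%:E)%E by apply: integral_ge0 => x _; rewrite lee_fin.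
have fin i : (\int[mu]_(x in E i) (F i x)%:E < +oo)%E.
  apply: (@le_lt_trans _ _ c%:E); last exact: ltry.
  by rewrite -H (bigD1 i)//= leeDl// sume_ge0.
split => //; apply: EFin_inj; rewrite -H -sumEFin; apply: eq_bigr => i _.
by rewrite /Rintegral fineK// ge0_fin_numE.
Qed.

Lemma edge_ray_like l i : 0 < l -> ray_like (edge l i).
Proof.
by move=> l0; rewrite /edge; case: ifP => _; [exact: ray_like_segment|exact: ray_like_ray].
Qed.

Lemma unfold_half l f (i : 'I_3) : i != ord_max -> unfold l f i = unfold l f ord0.
Proof. by move=> /negPf i2; apply/funext => x; rewrite /unfold i2. Qed.

Lemma sum3_le (F : 'I_3 -> R) c k : F ord_max <= k - 2 * c ->
  (forall i, i != ord_max -> F i <= c) -> \sum_(i < 3) F i <= k.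
Proof.
move=> F2 Fc; rewrite !big_ord_recl big_ord0.
have -> : lift ord0 (lift ord0 ord0) = ord_max :> 'I_3 by exact: val_inj.
have := Fc ord0 isT; have := Fc (lift ord0 ord0) isT.
move: (F _) (F _) (F _) F2 => a b d; lra.
Qed.

Section graph_of_profile.
Variables (l : R) (f : R -> R) (k nu : R).
Hypotheses (l0 : 0 < l) (f0 : forall x, 0 <= f x) (D : Dle (wt l) f k)
  (f2 : (\int[mu]_(x in `[0%R, +oo[) (f x ^+ 2)%:E = nu%:E)%E).

Let f_cont : continuous f.
Proof. by apply: (@Dle_continuous _ (wt l) _ k) => // x; exact: wt_ge1. Qed.

Let U := unfold l f.

Let sqr_total : (\sum_(i < 3) \int[mu]_(x in edge l i) (`|U i x| ^+ 2)%:E = nu%:E)%E.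
Proof.
rewrite -f2 (@unfold_integral l (fun x => f x ^+ 2))//; last 2 first.
- by move=> x; apply: (@continuous_comp _ _ _ f (fun y => y ^+ 2)); [exact: f_cont|exact: exprn_continuous].
- by move=> x; rewrite sqr_ge0.
apply: eq_bigr => i _; apply: eq_integral => x _; congr EFin; rewrite real_normK ?num_real//.
by rewrite /U /unfold; case: ifP.
Qed.

Lemma unfold_mass : mass l U = nu.
Proof. by have [] := sum_Rintegral (fun i x => sqr_ge0 `|U i x|) sqr_total. Qed.

Lemma unfold_powR q : 0 < q ->
  (\sum_(i < 3) \int[mu]_(x in edge l i) (`|U i x| `^ q)%:E =
    \int[mu]_(x in `[0%R, +oo[) (f x `^ q)%:E)%E.
Proof.
move=> q0; rewrite (@unfold_integral l (fun x => f x `^ q))//; last 2 first.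
- by move=> x; apply: (@cvg_powR _ _ (nbhs x) _ f (f x) q q0 f0); exact: f_cont.
- by move=> x; exact: powR_ge0.
apply: eq_bigr => i _; apply: eq_integral => x _; congr EFin.
by rewrite /U /unfold; case: ifP => _; rewrite ger0_norm.
Qed.

Lemma unfold_H1 : graph_H1 l U /\ dirichlet l U <= k.
Proof.
have [c [D2 D0]] := unfold_Dle l0 D.
have L2U i : L2 (edge l i) (U i).
  have [_ /(_ i) fin] := sum_Rintegral (fun i x => sqr_ge0 `|U i x|) sqr_total.
  have mE : measurable (edge l i) by case: (edge_ray_like i l0).
  have cU : continuous (U i).
    have [->|i2] := eqVneq i ord_max.
      by apply: (@Dle_continuous _ (cst 1) _ (k - 2 * c)) => // x; rewrite lexx.
    rewrite /U (unfold_half l f i2).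
    by apply: (@Dle_continuous _ (cst 1) _ c) => // x; rewrite lexx.
  have mU : measurable_fun (edge l i) (U i).
    by apply: measurable_funTS; exact: continuous_measurable_fun.
  split => //; apply: (@ge0_integrable _ _ (fun x => `|U i x| ^+ 2)) => //.
    by apply: measurable_funX; apply: measurableT_comp.
have HU i v c0 := @Dle_H1 _ (edge l i) v c0 (edge_ray_like i l0).
have [H2 B2] := HU ord_max _ _ D2 (L2U ord_max).
have Hh i : i != ord_max -> H1 (edge l i) (U i) /\
    \int[mu]_(x in edge l i) (`|weak_deriv (edge l i) (U i) x| ^+ 2) <= c.
  move=> i2; have Di : Dle (cst 1) (U i) c by rewrite /U (unfold_half l f i2).
  by have [h1 h2] := HU i _ _ Di (L2U i); split => //; exact: h2.
split.
  split.
    by move=> i; have [->//|/Hh[]//] := eqVneq i ord_max.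
  by move=> i j; rewrite /U /unfold maxxx mulr0 addr0 subr0 !if_same.
apply: (@sum3_le _ c); first exact: B2.
by move=> i /Hh[].
Qed.

End graph_of_profile.

Let energy_arith (X Y Z d1 d2 : R) : d2 <= Z -> X - 2^-1 * d1 <= Y - 2^-1 * Z ->
  2^-1 * d2 - Y <= 2^-1 * d1 - X.
Proof. by lra. Qed.

Lemma energyE l p u : energy l p u = 2^-1 * dirichlet l u -
  p^-1 * \sum_(i < 3) \int[mu]_(x in edge l i) (`|u i x| `^ p).
Proof. by []. Qed.

(** A competitor of mass [c ^+ 2] is rearranged into some [g], and [c^-1 * g x] is an admissible
    profile. Maximality against it, multiplied by [c ^+ 2 / (2 * s)], is the energy inequality. *)
Lemma maximizer_ground_state l p s f k : 0 < l -> 4 < p -> p < 6 -> 0 < s ->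
  maximizer l p s f k -> let c := (p / (2 * s)) `^ (p - 2)^-1 in
  ground_state l p (c ^+ 2) (unfold l (fun x => c * f x)).
Proof.
move=> l0 p4 p6 s0 M c.
have p0 : 0 < p by lra.
have p2 : 2 < p by lra.
have ps0 : 0 < p / (2 * s) by rewrite divr_gt0// mulr_gt0.
have c0 : 0 < c by rewrite powR_gt0.
have f2 := maximizer_mass p4 p6 s0 M; have [A Mx] := M; have [nf f0 f1 D] := A.
have mf2 (D' : set R) : measurable D' -> measurable_fun D' (fun x => (f x ^+ 2)%:E).
  by move=> mD; apply/measurable_EFinP; apply: noninc_meas => //; exact: sqr_noninc.
have cf0 x : 0 <= c * f x by rewrite mulr_ge0// ltW.
have cD : Dle (wt l) (fun x => c * f x) (c ^+ 2 * k) by exact: DleZ.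
have cf2 : (\int[mu]_(x in `[0%R, +oo[) ((c * f x) ^+ 2)%:E = (c ^+ 2)%:E)%E.
  transitivity (\int[mu]_(x in `[0%R, +oo[) ((c ^+ 2)%:E * (f x ^+ 2)%:E))%E.
    by apply: eq_integral => x _; rewrite exprMn EFinM.
  rewrite ge0_integralZl// ?f2 ?mule1// ?lee_fin ?sqr_ge0//; first exact: mf2.
  by move=> x _; rewrite lee_fin sqr_ge0.
(* The purpose of this [c]: c^p / p = c^2 / (2s), so the two terms of the energy get the proportion
   prescribed by [s]. *)
have cp : c `^ p = c ^+ 2 * (p / (2 * s)).
  have -> : p / (2 * s) = c `^ (p - 2).
    by rewrite /c -powRrM mulVf ?powRr1// ?(ltW ps0)// subr_eq0 gt_eqF.
  by rewrite -powR_mulrn ?(ltW c0)// -powRD ?(gt_eqF c0) ?implybT//; congr (_ `^ _); lra.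
have scaleE (g : R -> R) (a : R) : nonincreasing_fun g -> (forall x, 0 <= g x) -> 0 <= a ->
    (\int[mu]_(x in `[0%R, +oo[) ((a * g x) `^ p)%:E =
     (a `^ p)%:E * \int[mu]_(x in `[0%R, +oo[) (g x `^ p)%:E)%E.
  move=> ng g0 a0; rewrite -ge0_integralZl//; last 3 first.
  - by apply/measurable_EFinP; apply: noninc_meas => // x y xy; apply: powR_mono => //; [exact: ltW|exact: ng].
  - by move=> x _; rewrite lee_fin powR_ge0.
  - by rewrite lee_fin powR_ge0.
  by apply: eq_integral => x _; rewrite powRM// EFinM.
have scale2 (g : R -> R) (a : R) : nonincreasing_fun g -> (forall x, 0 <= g x) ->
    (\int[mu]_(x in `[0%R, +oo[) ((a * g x) ^+ 2)%:E =
     (a ^+ 2)%:E * \int[mu]_(x in `[0%R, +oo[) (g x ^+ 2)%:E)%E.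
  move=> ng g0; rewrite -ge0_integralZl//; last 3 first.
  - by apply/measurable_EFinP; apply: noninc_meas => //; exact: sqr_noninc.
  - by move=> x _; rewrite lee_fin sqr_ge0.
  - by rewrite lee_fin sqr_ge0.
  by apply: eq_integral => x _; rewrite exprMn EFinM.
have cPE : (\int[mu]_(x in `[0%R, +oo[) ((c * f x) `^ p)%:E = (c `^ p * Pp p f)%:E)%E.
  by rewrite (scaleE f c nf f0 (ltW c0)) (PpE A p2) EFinM.
have [HU dU] := unfold_H1 l0 cD cf2.
split; [exact: HU|exact: (unfold_mass l0 cD cf2)|move=> v Hv mv].
have [g [ng g0 Dg gq]] := graph_rearr l0 Hv.
have L2v i : (\int[mu]_(x in edge l i) (`|v i x| ^+ 2)%:E)%E =
    (\int[mu]_(x in edge l i) (`|v i x| ^+ 2))%:E.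
  have [mE _ _ _] := edge_ray_like i l0.
  by have [_ [_ iv] _] := Hv.1 i; rewrite /Rintegral fineK//; exact: integrable_fin_num.
have g2 : (\int[mu]_(x in `[0%R, +oo[) (g x ^+ 2)%:E = (c ^+ 2)%:E)%E.
  transitivity (\int[mu]_(x in `[0%R, +oo[) (g x `^ 2)%:E)%E.
    by apply: eq_integral => x _; rewrite powR_mulrn.
  rewrite gq// -mv /mass -sumEFin; apply: eq_bigr => i _; rewrite -L2v.
  by apply: eq_integral => x _; rewrite powR_mulrn.
have ci0 : 0 <= c^-1 by rewrite invr_ge0 ltW.
have Ag : adm l (fun x => c^-1 * g x) (c^-1 ^+ 2 * dirichlet l v).
  split.
  - by move=> x y xy; rewrite ler_wpM2l//; exact: ng.
  - by move=> x; rewrite mulr_ge0.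
  - by rewrite scale2// g2 -EFinM lee_fin -exprMn mulVf ?expr1n// gt_eqF.
  - exact: DleZ.
have gP : (\int[mu]_(x in `[0%R, +oo[) (g x `^ p)%:E = (c `^ p * Pp p (fun x => c^-1 * g x))%:E)%E.
  rewrite EFinM -(PpE Ag p2) scaleE// muleA -EFinM -powRM ?(ltW c0)//.
  by rewrite divff ?gt_eqF// powR1 mul1e.
have Pv : \sum_(i < 3) \int[mu]_(x in edge l i) (`|v i x| `^ p) = c `^ p * Pp p (fun x => c^-1 * g x).
  have H := gq p p0; rewrite gP in H.
  by have [] := sum_Rintegral (fun i x => powR_ge0 `|v i x| p) (esym H).
have Pu : \sum_(i < 3) \int[mu]_(x in edge l i) (`|unfold l (fun x => c * f x) i x| `^ p) = c `^ p * Pp p f.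
  have H := unfold_powR l0 cf0 cD p0; rewrite cPE in H.
  by have [] := sum_Rintegral (fun i x => powR_ge0 `|unfold l (fun x => c * f x) i x| p) H.
rewrite !energyE Pu Pv cp.
have := Mx _ _ Ag; move: dU; rewrite exprVn.
move: (Pp p (fun x => c^-1 * g x)) (Pp p f) (dirichlet l v) (dirichlet l _) => P1 P2 d1 d2 dU h.
have c2 : 0 < c ^+ 2 by rewrite exprn_gt0.
move: (c ^+ 2) c2 dU h => C C0 dU h.
have -> : p^-1 * (C * (p / (2 * s)) * P2) = C / (2 * s) * P2 by field; rewrite !gt_eqF.
have -> : p^-1 * (C * (p / (2 * s)) * P1) = C / (2 * s) * P1 by field; rewrite !gt_eqF.
have W0 : 0 < C / (2 * s) by rewrite divr_gt0// mulr_gt0.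
have := ler_wpM2l (ltW W0) h.
have -> : C / (2 * s) * (P1 - s * (C^-1 * d1)) = C / (2 * s) * P1 - 2^-1 * d1.
  by field; rewrite !gt_eqF.
have -> : C / (2 * s) * (P2 - s * k) = C / (2 * s) * P2 - 2^-1 * (C * k).
  by field; rewrite gt_eqF.
exact: energy_arith.
Qed.

End unfolding.

Theorem theorem1p5 (R : realType) (l : R) (hl : 0 < l) :
  exists e0 : R, 0 < e0 /\
  forall e : R, 0 < e -> e < e0 ->
  forall p : R, 6 - e < p -> p < 6 ->
  exists (nu : R) (u v : graph_fun R),
    0 < nu /\
    ground_state l p nu u /\ ground_state l p nu v /\
    graph_positive l u /\ graph_positive l v /\
    graph_distinct l u v.
Proof.
have [e1 e10 H] := two_maximizers hl.
(* The bound 2 ensures [p > 4], as compactness requires. *)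
exists (Num.min e1 2); split; first by rewrite lt_min e10 ltr0n.
move=> e e0; rewrite lt_min => /andP[ee1 e2] p pe p6.
have p4 : 4 < p by lra.
have p2 : 0 < p by lra.
have [|s [f [k [g [m [s0 Mf Mg km]]]]]] := H p _ p6; first by lra.
pose c := (p / (2 * s)) `^ (p - 2)^-1.
have c0 : 0 < c by rewrite powR_gt0// divr_gt0// mulr_gt0.
have pos h r : maximizer l p s h r -> graph_positive l (unfold l (fun x => c * h x)).
  move=> Mh i x _; rewrite /unfold; case: ifP => _; rewrite mulr_gt0//; exact: maximizer_gt0 Mh _.
exists (c ^+ 2), (unfold l (fun x => c * f x)), (unfold l (fun x => c * g x)).
split; first by rewrite exprn_gt0.
split; first exact: maximizer_ground_state Mf.
split; first exact: maximizer_ground_state Mg.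
split; first exact: pos Mf.
split; first exact: pos Mg.
(* Profiles that agree on the half-line have the same [Pp]; optimality of [g] with [m] against [f]
   with [k] would then give [m <= k]. *)
have [y y0 fg] : exists2 y, 0 <= y & f y <> g y.
  apply: contrapT => nex.
  have fg y : 0 <= y -> f y = g y by move=> y0; apply: contrapT => h; apply: nex; exists y.
  have [Ag Mxg] := Mg; have := Mxg _ _ Mf.1.
  have -> : Pp p f = Pp p g.
    by apply: eq_Rintegral => y; rewrite inE/= in_itv/= andbT => y0; rewrite fg.
  by rewrite lerD2l lerN2 ler_pM2l// leNgt km.
(* The point of the graph where the unfolding shows the profile at [y]: on the terminal edge if
   [y <= l], otherwise at half the remaining distance on a half-line. *)
have [yl|ly] := leP y l.
  exists ord_max, (l - y); split.
    by rewrite /edge eqxx /= in_itv/= subr_ge0 yl gerBl.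
  rewrite /unfold eqxx (max_idPl _) ?subr_ge0// subKr.
  by move=> /(mulfI (lt0r_neq0 c0)).
exists ord0, ((y - l) / 2); split.
  by rewrite /edge/= in_itv/= andbT divr_ge0// subr_ge0 ltW.
rewrite /unfold/= (max_idPl _) ?divr_ge0 ?subr_ge0 ?(ltW ly)//.
have -> : l + 2 * ((y - l) / 2) = y by field.
by move=> /(mulfI (lt0r_neq0 c0)).
Qed.
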